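(* Let $T$ be a Hopf monad on an autonomous category $\mathcal{C}$ and $Q$ a comonoidal endofunctor of $T\text{-}\mathcal{C}$ such that $Q\rtimes T$ is centralizable, with centralizer $(Z_{Q\rtimes T},\partial)$. Let $(Z_Q,\widetilde\partial)$ be the centralizer of $Q$ lifting $(Z_{Q\rtimes T},\partial)$, let $\Omega$ be the canonical distributive law of the pair $(Q,T)$ and let $D_{Q,T}=Z_Q\rtimes T=Z_{Q\rtimes T}\circ_\Omega T$ be the double of the pair $(Q,T)$. (a) If $Q$ is a bimonad, then the canonical distributive law $\Omega$ is comonoidal, $D_{Q,T}$ is a bimonad, and $Z_Q=\widetilde{Z}_{Q\rtimes T}^{\Omega}$ as bimonads. (b) If $Q$ is a Hopf monad, then $D_{Q,T}$ is a Hopf monad.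
   Context: Categories are small and monoidal categories are strict, with product $\otimes$ and unit $\mathbf 1$. A monoidal category is autonomous if every object $X$ has a left dual ${}^\vee X$ (with $\mathrm{ev}_X\colon {}^\vee X\otimes X\to\mathbf 1$, $\mathrm{coev}_X\colon \mathbf 1\to X\otimes {}^\vee X$) and a right dual $X^\vee$ (with $\widetilde{\mathrm{ev}}_X\colon X\otimes X^\vee\to \mathbf 1$, $\widetilde{\mathrm{coev}}_X\colon \mathbf 1\to X^\vee\otimes X$). Duals are chosen; ${}^\vee f$, $f^\vee$ are dual morphisms. A comonoidal functor $F$ is a functor with a coassociative and counital natural transformation $F_2(X,Y)\colon F(X\otimes Y)\to F(X)\otimes F(Y)$, $F_0\colon F(\mathbf 1)\to\mathbf 1$. Comonoidal natural transformations are those compatible with these structures; composites are comonoidal by $(GF)_2(X,Y)=G_2(F(X),F(Y))G(F_2(X,Y))$, $(GF)_0=G_0G(F_0)$. A bimonad is a monad $(T,\mu,\eta)$ with a comonoidal structure on $T$ such that $\mu,\eta$ are comonoidal. A left antipode for $T$ is a natural transformation $s^l_X\colon T({}^\vee T(X))\to {}^\vee X$ with $T_0T(\mathrm{ev}_X)T({}^\vee\eta_X\otimes \mathrm{id}_X)=\mathrm{ev}_{T(X)}(s^l_{T(X)}T({}^\vee\mu_X)\otimes \mathrm{id})T_2({}^\vee T(X),X)$ and $(\eta_X\otimes \mathrm{id}_{{}^\vee X})\mathrm{coev}_XT_0=(\mu_X\otimes s^l_X)T_2(T(X),{}^\vee T(X))T(\mathrm{coev}_{T(X)})$. A right antipode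 is a natural transformation $s^r_X\colon T(T(X)^\vee)\to X^\vee$ with $T_0T(\widetilde{\mathrm{ev}}_X)T(\mathrm{id}_X\otimes\eta_X^\vee)=\widetilde{\mathrm{ev}}_{T(X)}(\mathrm{id}\otimes s^r_{T(X)}T(\mu_X^\vee))T_2(X,T(X)^\vee)$ and $(\mathrm{id}_{X^\vee}\otimes\eta_X)\widetilde{\mathrm{coev}}_XT_0=(s^r_X\otimes\mu_X)T_2(T(X)^\vee,T(X))T(\widetilde{\mathrm{coev}}_{T(X)})$. A Hopf monad is a bimonad on an autonomous category having a left and a right antipode. For a monad $T$, $T\text{-}\mathcal{C}$ is the category of $T$-modules $(M,r)$ ($r\colon T(M)\to M$, $rT(r)=r\mu_M$, $r\eta_M=\mathrm{id}_M$) and $T$-linear morphisms; $U_T$ is the forgetful functor, $F_T(X)=(T(X),\mu_X)$ its left adjoint, with unit $\eta$ and counit $\varepsilon_{(M,r)}=r$. If $T$ is a bimonad, $T\text{-}\mathcal{C}$ is monoidal with $(M,r)\otimes(N,s)=(M\otimes N,(r\otimes s)T_2(M,N))$ and unit $(\mathbf 1,T_0)$; if $T$ is a Hopf monad it is autonomous. Cross product: $Q\rtimes T=U_TQF_T$. If $(Q,q,v)$ is a monad, $Q\rtimes T$ is a monad with product $q_{F_T}Q(\varepsilon_{QF_T})$ and unit $v_{F_T}\eta$. If $Q$ is comonoidal, $Q\rtimes T$ is comonoidal with $(Q\rtimes T)_2(X,Y)=Q_2(F_T(X),F_T(Y))\,Q(\varepsilon_{F_T(X)\otimes F_T(Y)}F_T(\eta_X\otimes\eta_Y))$,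 $(Q\rtimes T)_0=Q_0Q(\varepsilon_{(\mathbf 1,T_0)})$. A centralizer of an endofunctor $P$ of a monoidal category $\mathcal{A}$ is a pair $(Z_P,\partial)$ with $Z_P$ an endofunctor of $\mathcal{A}$ and $\partial_{X,Y}\colon X\otimes Y\to P(Y)\otimes Z_P(X)$ natural in $X,Y$, such that for all objects $X,W$ and every natural $\{\xi_Y\colon X\otimes Y\to P(Y)\otimes W\}_Y$ there is a unique $r\colon Z_P(X)\to W$ with $\xi_Y=(\mathrm{id}_{P(Y)}\otimes r)\partial_{X,Y}$ for all $Y$. $P$ is centralizable if it has a centralizer. When $\mathcal{A}$ is left autonomous: if $P$ is comonoidal, $Z_P$ is a monad with product $m$ and unit $u$ determined by $(\mathrm{id}\otimes m_X)(\mathrm{id}_{P(Y_1)}\otimes\partial_{Z_P(X),Y_2})(\partial_{X,Y_1}\otimes\mathrm{id}_{Y_2})=(P_2(Y_1,Y_2)\otimes\mathrm{id}_{Z_P(X)})\partial_{X,Y_1\otimes Y_2}$, $u_X=(P_0\otimes\mathrm{id}_{Z_P(X)})\partial_{X,\mathbf 1}$; if $P$ is a bimonad with product $\mu$ and unit $\eta$, $Z_P$ is a bimonad with comonoidal structure determined by $(\mathrm{id}_{P(Y)}\otimes(Z_P)_2(X_1,X_2))\partial_{X_1\otimes X_2,Y}=(\mu_Y\otimes\mathrm{id})(\partial_{X_1,P(Y)}\otimes\mathrm{id}_{Z_P(X_2)})(\mathrm{id}_{X_1}\otimes\partial_{X_2,Y})$, $(\mathrm{id}_{P(Y)}\otimes(Z_P)_0)\partial_{\mathbf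 1,Y}=\eta_Y$. $(Z_Q,\widetilde\partial)$ denotes the unique centralizer of $Q$ such that $U_TZ_Q=Z_{Q\rtimes T}U_T$ and $\widetilde\partial_{(M,r),(N,s)}=(Q(s)\otimes\mathrm{id})\partial_{M,N}$; its monad structure is a lift of that of $Z_{Q\rtimes T}$ (i.e. product and unit correspond under $U_T$). A distributive law of a monad $(T,\mu,\eta)$ over a monad $(P,m,u)$ is a natural transformation $\Omega\colon TP\to PT$ with $\Omega_XT(m_X)=m_{T(X)}P(\Omega_X)\Omega_{P(X)}$, $\Omega_XT(u_X)=u_{T(X)}$, $\Omega_X\mu_{P(X)}=P(\mu_X)\Omega_{T(X)}T(\Omega_X)$, $\Omega_X\eta_{P(X)}=P(\eta_X)$. For bimonads it is comonoidal if it is a comonoidal natural transformation. It defines a monad $P\circ_\Omega T$ on $\mathcal{C}$: the endofunctor $PT$ with product $m_{T(X)}P^2(\mu_X)P(\Omega_{T(X)})$ and unit $u_{T(X)}\eta_X$ (and, for comonoidal $\Omega$, the composite comonoidal structure); and a lift $\widetilde P^\Omega(M,r)=(P(M),P(r)\Omega_M)$ of $P$ to $T\text{-}\mathcal{C}$, with product $m_M$ and unit $u_M$ (and comonoidal structure $P_2(M,N)$, $P_0$). Distributive laws of $T$ over $P$ correspond bijectively to lifts of the monad $P$ to $T\text{-}\mathcal{C}$ via $\Omega\mapsto\widetilde P^\Omega$. The canonical distributive law of $(Q,T)$ is the unique distributive law $\Omega$ of $T$ over $Z_{Q\rtimes T}$ with $Z_Q=\widetilde{Z}_{Q\rtimes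 T}^\Omega$ (as monads). *)

(* Defs.v *)
From Stdlib Require Import ssreflect ssrfun ssrbool ProofIrrelevance.

Set Implicit Arguments.
Unset Strict Implicit.
Unset Printing Implicit Defensive.

Declare Scope mon_scope.
Open Scope mon_scope.

Record Category := {
  ob :> Type;
  hom : ob -> ob -> Type;
  idm : forall X : ob, hom X X;
  comp : forall X Y Z : ob, hom Y Z -> hom X Y -> hom X Z;
  comp_idl : forall (X Y : ob) (f : hom X Y), comp (idm Y) f = f;
  comp_idr : forall (X Y : ob) (f : hom X Y), comp f (idm X) = f;
  comp_assoc : forall (W X Y Z : ob) (h : hom Y Z) (g : hom X Y) (f : hom W X),
    comp (comp h g) f = comp h (comp g f) }.
Arguments idm {c} X.
Notation "g ∘ f" := (comp g f) (at level 40, left associativity)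
  : mon_scope.

Record Functor (A B : Category) := {
  fob :> A -> B;
  fmap : forall X Y : A, hom X Y -> hom (fob X) (fob Y);
  fmap_id : forall X : A, fmap (idm X) = idm (fob X);
  fmap_comp : forall (X Y Z : A) (g : hom Y Z) (f : hom X Y),
    fmap (g ∘ f) = fmap g ∘ fmap f }.
Arguments fmap {A B} f {X Y} _ : rename.

Definition id_functor (A : Category) : Functor A A :=
  {| fob := fun X : A => X; fmap := fun _ _ f => f;
     fmap_id := fun _ => eq_refl; fmap_comp := fun _ _ _ _ _ => eq_refl |}.

Lemma comp_fmap_id (A B D : Category) (G : Functor B D) (F : Functor A B) (X : A) :
  fmap G (fmap F (idm X)) = idm (G (F X)).
Proof. by rewrite !fmap_id. Qed.

Lemma comp_fmap_comp (A B D : Category) (G : Functor B D) (F : Functor A B)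
  (X Y Z : A) (g : hom Y Z) (f : hom X Y) :
  fmap G (fmap F (g ∘ f)) = fmap G (fmap F g) ∘ fmap G (fmap F f).
Proof. by rewrite !fmap_comp. Qed.

Definition comp_functor (A B D : Category) (G : Functor B D) (F : Functor A B) :
  Functor A D :=
  {| fob := fun X => G (F X); fmap := fun _ _ f => fmap G (fmap F f);
     fmap_id := comp_fmap_id G F; fmap_comp := comp_fmap_comp G F |}.
Notation "G ∘F F" := (comp_functor G F) (at level 40, left associativity) : mon_scope.

Record Trans (A B : Category) (F G : Functor A B) := {
  tapp :> forall X : A, hom (F X) (G X);
  tnat : forall (X Y : A) (f : hom X Y), tapp Y ∘ fmap F f = fmap G f ∘ tapp X }.

Record MonCat := {
  cat :> Category;
  ten : cat -> cat -> cat;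
  one : cat;
  tenm : forall X X' Y Y' : cat,
    hom X X' -> hom Y Y' -> hom (ten X Y) (ten X' Y');
  tenm_id : forall X Y : cat, tenm (idm X) (idm Y) = idm (ten X Y);
  tenm_comp : forall (X X' X'' Y Y' Y'' : cat) (g : hom X' X'') (f : hom X X')
    (k : hom Y' Y'') (h : hom Y Y'),
    tenm (g ∘ f) (k ∘ h) = tenm g k ∘ tenm f h;
  asc : forall X Y Z : cat, hom (ten (ten X Y) Z) (ten X (ten Y Z));
  ascV : forall X Y Z : cat, hom (ten X (ten Y Z)) (ten (ten X Y) Z);
  lun : forall X : cat, hom (ten one X) X;
  lunV : forall X : cat, hom X (ten one X);
  run : forall X : cat, hom (ten X one) X;
  runV : forall X : cat, hom X (ten X one);
  ascK : forall X Y Z : cat, ascV X Y Z ∘ asc X Y Z = idm _;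
  ascVK : forall X Y Z : cat, asc X Y Z ∘ ascV X Y Z = idm _;
  lunK : forall X : cat, lunV X ∘ lun X = idm _;
  lunVK : forall X : cat, lun X ∘ lunV X = idm _;
  runK : forall X : cat, runV X ∘ run X = idm _;
  runVK : forall X : cat, run X ∘ runV X = idm _;
  asc_nat : forall (X X' Y Y' Z Z' : cat) (f : hom X X') (g : hom Y Y') (h : hom Z Z'),
    asc X' Y' Z' ∘ tenm (tenm f g) h = tenm f (tenm g h) ∘ asc X Y Z;
  lun_nat : forall (X X' : cat) (f : hom X X'),
    lun X' ∘ tenm (idm one) f = f ∘ lun X;
  run_nat : forall (X X' : cat) (f : hom X X'),
    run X' ∘ tenm f (idm one) = f ∘ run X;
  pentagon : forall W X Y Z : cat,
    tenm (idm W) (asc X Y Z) ∘ (asc W (ten X Y) Z ∘ tenm (asc W X Y) (idm Z))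
    = asc W X (ten Y Z) ∘ asc (ten W X) Y Z;
  triangle : forall X Y : cat,
    tenm (idm X) (lun Y) ∘ asc X one Y = tenm (run X) (idm Y) }.
Arguments one {m}.
Arguments asc {m} X Y Z.
Arguments ascV {m} X Y Z.
Arguments lun {m} X.
Arguments lunV {m} X.
Arguments run {m} X.
Arguments runV {m} X.
Notation "X ⊗ Y" := (ten X Y) (at level 35, right associativity) : mon_scope.
Notation "f ⊠ g" := (tenm f g) (at level 35, right associativity) : mon_scope.
Notation "𝟙" := one : mon_scope.

Definition eqm (A : Category) (X Y : A) (e : X = Y) : hom X Y :=
  match e in _ = Z return hom X Z with eq_refl => idm X end.

(* In a strict category the constraints are identities along equalities of
   objects; they have to stay visible for composites to be well typed. *)
Definition strict (C : MonCat) : Prop :=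
  [/\ forall X Y Z : C, exists e : (X ⊗ Y) ⊗ Z = X ⊗ (Y ⊗ Z), asc X Y Z = eqm e,
      forall X : C, exists e : 𝟙 ⊗ X = X, lun X = eqm e
    & forall X : C, exists e : X ⊗ 𝟙 = X, run X = eqm e].

Section Whisker.
Variables (A : Category).

Lemma re2 (X Y Y' Z : A) (f : hom Y Z) (g : hom X Y) (f' : hom Y' Z) (g' : hom X Y') :
  f ∘ g = f' ∘ g' ->
  forall (W : A) (k : hom W X), f ∘ (g ∘ k) = f' ∘ (g' ∘ k).
Proof. by move=> E W k; rewrite -!comp_assoc E. Qed.

Lemma re1 (X Y Z : A) (f : hom Y Z) (g : hom X Y) (h : hom X Z) :
  f ∘ g = h -> forall (W : A) (k : hom W X), f ∘ (g ∘ k) = h ∘ k.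
Proof. by move=> E W k; rewrite -!comp_assoc E. Qed.

Lemma re3 (X Y Z V : A) (f : hom Z V) (g : hom Y Z) (h : hom X Y) (l : hom X V) :
  f ∘ (g ∘ h) = l -> forall (W : A) (k : hom W X), f ∘ (g ∘ (h ∘ k)) = l ∘ k.
Proof. by move=> E W k; rewrite -E !comp_assoc. Qed.

Lemma re0 (X Y : A) (f : hom Y X) (g : hom X Y) :
  f ∘ g = idm X -> forall (W : A) (k : hom W X), f ∘ (g ∘ k) = k.
Proof. by move=> E W k; rewrite -!comp_assoc E comp_idl. Qed.

Lemma iso_epi (X Y Z : A) (f : hom X Y) (f' : hom Y X) (g h : hom Y Z) :
  f ∘ f' = idm Y -> g ∘ f = h ∘ f -> g = h.
Proof. by move=> E H; rewrite -[g]comp_idr -[h]comp_idr -E -!comp_assoc H. Qed.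

Lemma iso_mono (X Y Z : A) (f : hom X Y) (f' : hom Y X) (g h : hom Z X) :
  f' ∘ f = idm X -> f ∘ g = f ∘ h -> g = h.
Proof. by move=> E H; rewrite -[g]comp_idl -[h]comp_idl -E !comp_assoc H. Qed.
End Whisker.

Section Coherence.
Variable C : MonCat.

Lemma tenl_comp (X Y Y' Y'' : C) (g : hom Y' Y'') (f : hom Y Y') :
  idm X ⊠ (g ∘ f) = (idm X ⊠ g) ∘ (idm X ⊠ f).
Proof. by rewrite -tenm_comp comp_idl. Qed.

Lemma tenr_comp (X Y Y' Y'' : C) (g : hom Y' Y'') (f : hom Y Y') :
  (g ∘ f) ⊠ idm X = (g ⊠ idm X) ∘ (f ⊠ idm X).
Proof. by rewrite -tenm_comp comp_idl. Qed.

Lemma ten_swap (X X' Y Y' : C) (f : hom X X') (g : hom Y Y') :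
  (f ⊠ idm Y') ∘ (idm X ⊠ g) = (idm X' ⊠ g) ∘ (f ⊠ idm Y).
Proof. by rewrite -!tenm_comp !comp_idl !comp_idr. Qed.

Lemma ascV_nat (X X' Y Y' Z Z' : C) (f : hom X X') (g : hom Y Y') (h : hom Z Z') :
  ascV X' Y' Z' ∘ (f ⊠ (g ⊠ h)) = ((f ⊠ g) ⊠ h) ∘ ascV X Y Z.
Proof.
apply: (iso_mono (ascK X' Y' Z')).
rewrite (re0 (ascVK _ _ _)) (re2 (asc_nat _ _ _)).
by rewrite ascVK comp_idr.
Qed.

Lemma lunV_nat (X X' : C) (f : hom X X') :
  lunV X' ∘ f = (idm 𝟙 ⊠ f) ∘ lunV X.
Proof.
apply: (iso_mono (lunK X')).
by rewrite (re0 (lunVK _)) (re2 (lun_nat _)) lunVK comp_idr.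
Qed.

Lemma runV_nat (X X' : C) (f : hom X X') :
  runV X' ∘ f = (f ⊠ idm 𝟙) ∘ runV X.
Proof.
apply: (iso_mono (runK X')).
by rewrite (re0 (runVK _)) (re2 (run_nat _)) runVK comp_idr.
Qed.

Lemma unit_faithl (X Y : C) (f g : hom X Y) : idm 𝟙 ⊠ f = idm 𝟙 ⊠ g -> f = g.
Proof.
move=> E; apply: (iso_epi (lunVK X)).
by rewrite -!lun_nat E.
Qed.

Lemma unit_faithr (X Y : C) (f g : hom X Y) : f ⊠ idm 𝟙 = g ⊠ idm 𝟙 -> f = g.
Proof.
move=> E; apply: (iso_epi (runVK X)).
by rewrite -!run_nat E.
Qed.

Lemma kelly_lun (X Y : C) : lun (X ⊗ Y) ∘ asc 𝟙 X Y = lun X ⊠ idm Y.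
Proof.
apply: unit_faithl.
have I1 : asc 𝟙 (𝟙 ⊗ X) Y ∘ ascV _ _ _ = idm _ by rewrite ascVK.
apply: (iso_epi I1).
have I2 : (asc 𝟙 𝟙 X ⊠ idm Y) ∘ (ascV 𝟙 𝟙 X ⊠ idm Y) = idm _.
  by rewrite -tenr_comp ascVK tenm_id.
apply: (iso_epi I2).
rewrite tenl_comp !comp_assoc pentagon (re1 (triangle _ _)).
rewrite -[idm (X ⊗ Y)]tenm_id -asc_nat -triangle tenr_comp.
by rewrite (re2 (asc_nat _ _ _)) ?comp_assoc.
Qed.

Lemma kelly_unit : lun 𝟙 = run (𝟙 : C).
Proof.
have E : lun (𝟙 ⊗ 𝟙) = idm 𝟙 ⊠ lun (𝟙 : C).
  by apply: (iso_mono (lunK 𝟙)); rewrite lun_nat.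
apply: unit_faithr.
by rewrite -kelly_lun E triangle.
Qed.
End Coherence.
Arguments tenl_comp {C}. Arguments tenr_comp {C}.

(* The monoidal category with the opposite tensor product; it exchanges left and
   right duals, left and right antipodes. *)
Section Reverse.
Variable C : MonCat.

Lemma rev_tenm_comp (X X' X'' Y Y' Y'' : C) (g : hom X' X'') (f : hom X X')
    (k : hom Y' Y'') (h : hom Y Y') : (k ∘ h) ⊠ (g ∘ f) = (k ⊠ g) ∘ (h ⊠ f).
Proof. exact: tenm_comp. Qed.

Lemma rev_pentagon (W X Y Z : C) :
  (ascV Z Y X ⊠ idm W) ∘ (ascV Z (Y ⊗ X) W ∘ (idm Z ⊠ ascV Y X W))
  = ascV (Z ⊗ Y) X W ∘ ascV Z Y (X ⊗ W).
Proof.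
have I : asc Z Y (X ⊗ W) ∘ ascV _ _ _ = idm _ by rewrite ascVK.
have J : asc (Z ⊗ Y) X W ∘ ascV _ _ _ = idm _ by rewrite ascVK.
have K : ascV _ _ _ ∘ asc Z Y (X ⊗ W) = idm _ by rewrite ascK.
have L : ascV _ _ _ ∘ asc (Z ⊗ Y) X W = idm _ by rewrite ascK.
apply: (iso_mono L); apply: (iso_mono K).
rewrite (re0 J) I -(re2 (pentagon _ _ _ _)) !comp_assoc.
rewrite (re0 (f := asc Z Y X ⊠ idm W)); first by rewrite -tenr_comp ascVK tenm_id.
by rewrite (re0 (ascVK _ _ _)) -tenl_comp ascVK tenm_id.
Qed.

Lemma rev_triangle (X Y : C) :
  (run Y ⊠ idm X) ∘ ascV Y 𝟙 X = idm Y ⊠ lun X.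
Proof. by rewrite -triangle !comp_assoc ascVK comp_idr. Qed.

Definition rev : MonCat :=
  {| cat := cat C; ten := fun X Y => Y ⊗ X; one := 𝟙;
     tenm := fun _ _ _ _ f g => g ⊠ f;
     tenm_id := fun X Y => tenm_id Y X; tenm_comp := rev_tenm_comp;
     asc := fun X Y Z => ascV Z Y X; ascV := fun X Y Z => asc Z Y X;
     lun := run; lunV := runV; run := lun; runV := lunV;
     ascK := fun X Y Z => ascVK Z Y X; ascVK := fun X Y Z => ascK Z Y X;
     lunK := @runK C; lunVK := @runVK C; runK := @lunK C; runVK := @lunVK C;
     asc_nat := fun _ _ _ _ _ _ f g h => ascV_nat h g f;
     lun_nat := @run_nat C; run_nat := @lun_nat C;
     pentagon := rev_pentagon; triangle := rev_triangle |}.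
End Reverse.

Lemma kelly_run (C : MonCat) (X Y : C) :
  run (X ⊗ Y) ∘ ascV X Y 𝟙 = idm X ⊠ run Y.
Proof. exact: (kelly_lun (C := rev C)). Qed.

Record left_dual (C : MonCat) (X : C) := {
  ldob :> C;
  ev : hom (ldob ⊗ X) 𝟙;
  coev : hom 𝟙 (X ⊗ ldob);
  ev_zig : run X ∘ (idm X ⊠ ev) ∘ asc X ldob X ∘ (coev ⊠ idm X) ∘ lunV X = idm X;
  ev_zag : lun ldob ∘ (ev ⊠ idm ldob) ∘ ascV ldob X ldob ∘ (idm ldob ⊠ coev)
           ∘ runV ldob = idm ldob }.
Arguments ev {C X}.
Arguments coev {C X}.

Record right_dual (C : MonCat) (X : C) := {
  rdob :> C;
  evr : hom (X ⊗ rdob) 𝟙;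
  coevr : hom 𝟙 (rdob ⊗ X);
  evr_zig : lun X ∘ (evr ⊠ idm X) ∘ ascV X rdob X ∘ (idm X ⊠ coevr) ∘ runV X = idm X;
  evr_zag : run rdob ∘ (idm rdob ⊠ evr) ∘ asc rdob X rdob ∘ (coevr ⊠ idm rdob)
            ∘ lunV rdob = idm rdob }.
Arguments evr {C X}.
Arguments coevr {C X}.

Definition ldm (C : MonCat) (X Y : C) (X' : left_dual X) (Y' : left_dual Y)
  (f : hom X Y) : hom Y' X' :=
  lun X' ∘ (ev Y' ⊠ idm X') ∘ ascV Y' Y X' ∘ (idm Y' ⊠ ((f ⊠ idm X') ∘ coev X'))
  ∘ runV Y'.

Definition rdm (C : MonCat) (X Y : C) (X' : right_dual X) (Y' : right_dual Y)
  (f : hom X Y) : hom Y' X' :=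
  run X' ∘ (idm X' ⊠ evr Y') ∘ asc X' Y Y' ∘ (((idm X' ⊠ f) ∘ coevr X') ⊠ idm Y')
  ∘ lunV Y'.

Record Autonomous (C : MonCat) := {
  ldual : forall X : C, left_dual X;
  rdual : forall X : C, right_dual X }.

Section Duality.
Variable C : MonCat.

Definition transp (A X : C) (X' : left_dual X) (p : hom (A ⊗ X) 𝟙) : hom A X' :=
  lun X' ∘ (p ⊠ idm X') ∘ ascV A X X' ∘ (idm A ⊠ coev X') ∘ runV A.

Lemma transpK (A X : C) (X' : left_dual X) (h : hom A X') :
  transp X' (ev X' ∘ (h ⊠ idm X)) = h.
Proof.
rewrite /transp tenr_comp ?comp_assoc.
rewrite -(re2 (ascV_nat _ _ _)) tenm_id.
rewrite (re2 (ten_swap _ _)) -runV_nat -!comp_assoc. rewrite ev_zag.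
by rewrite comp_idl.
Qed.

Lemma ev_transp (A X : C) (X' : left_dual X) (p : hom (A ⊗ X) 𝟙) :
  ev X' ∘ (transp X' p ⊠ idm X) = p.
Proof.
rewrite /transp !tenr_comp ?comp_assoc.
rewrite -(re1 (kelly_lun _ _)) ?comp_assoc (re2 (asc_nat _ _ _)) tenm_id.
rewrite -(re2 (lun_nat _)) -(re2 (ten_swap _ _)) kelly_unit (re2 (run_nat _)).
have P : asc (A ⊗ X) X' X ∘ (ascV A X X' ⊠ idm X)
   = ascV A X (X' ⊗ X) ∘ ((idm A ⊠ asc X X' X) ∘ asc A (X ⊗ X') X).
  apply: (iso_mono (ascK _ _ _)).
  rewrite (re0 (ascVK _ _ _)) -(re2 (pentagon _ _ _ _)) ?comp_assoc.
  by rewrite -tenr_comp ascVK tenm_id comp_idr.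
rewrite (re2 P) ?comp_assoc (re2 (asc_nat _ _ _)).
have Q : asc A 𝟙 X ∘ (runV A ⊠ idm X) = idm A ⊠ lunV X.
  have I : (idm A ⊠ lunV X) ∘ (idm A ⊠ lun X) = idm _.
    by rewrite -tenl_comp lunK tenm_id.
  apply: (iso_mono (f := idm A ⊠ lun X) I).
  by rewrite (re1 (triangle _ _)) -tenr_comp runVK -tenl_comp lunVK !tenm_id.
rewrite Q -tenm_id -(re2 (ascV_nat _ _ _)) (re1 (kelly_run _ _)).
by rewrite -!tenl_comp -!comp_assoc ev_zig tenm_id comp_idr.
Qed.

Lemma ldm_transp (X Y : C) (X' : left_dual X) (Y' : left_dual Y) (f : hom X Y) :
  ldm X' Y' f = transp X' (ev Y' ∘ (idm Y' ⊠ f)).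
Proof.
by rewrite /ldm /transp tenr_comp tenl_comp ?comp_assoc (re2 (ascV_nat _ _ _)).
Qed.

Lemma ev_ldm (X Y : C) (X' : left_dual X) (Y' : left_dual Y) (f : hom X Y) :
  ev X' ∘ (ldm X' Y' f ⊠ idm X) = ev Y' ∘ (idm Y' ⊠ f).
Proof. by rewrite ldm_transp ev_transp. Qed.

Lemma ev_inj (A X : C) (X' : left_dual X) (g h : hom A X') :
  ev X' ∘ (g ⊠ idm X) = ev X' ∘ (h ⊠ idm X) -> g = h.
Proof. by move=> E; rewrite -[g]transpK -[h]transpK E. Qed.

Lemma ldm_id (X : C) (X' : left_dual X) : ldm X' X' (idm X) = idm X'.
Proof. by apply: ev_inj; rewrite ev_ldm. Qed.

Lemma ldm_comp (X Y Z : C) (X' : left_dual X) (Y' : left_dual Y) (Z' : left_dual Z)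
  (g : hom Y Z) (f : hom X Y) : ldm X' Z' (g ∘ f) = ldm X' Y' f ∘ ldm Y' Z' g.
Proof.
apply: ev_inj; rewrite ev_ldm tenr_comp -comp_assoc ev_ldm comp_assoc -ten_swap.
by rewrite -comp_assoc ev_ldm tenl_comp comp_assoc.
Qed.

Lemma coev_inj (X Y : C) (X' : left_dual X) (c : hom 𝟙 (Y ⊗ X')) :
  c = ((run Y ∘ (idm Y ⊠ ev X') ∘ asc Y X' X ∘ (c ⊠ idm X) ∘ lunV X) ⊠ idm X') ∘ coev X'.
Proof.
rewrite !tenr_comp ?comp_assoc -(re1 (triangle _ _)) ?comp_assoc.
rewrite (re2 (asc_nat _ _ _)).
have P : asc Y (X' ⊗ X) X' ∘ (asc Y X' X ⊠ idm X')
   = (idm Y ⊠ ascV X' X X') ∘ (asc Y X' (X ⊗ X') ∘ asc (Y ⊗ X') X X').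
  rewrite -pentagon -comp_assoc -tenl_comp ascK tenm_id.
  by rewrite comp_idl.
rewrite (re2 P) ?comp_assoc (re2 (asc_nat _ _ _)) tenm_id.
have Q : asc 𝟙 X X' ∘ (lunV X ⊠ idm X') = lunV (X ⊗ X').
  apply: (iso_mono (lunK _)).
  by rewrite (re1 (kelly_lun _ _)) -tenr_comp !lunVK tenm_id.
rewrite (re1 Q) lunV_nat (re2 (ten_swap _ _)) -tenm_id (re2 (asc_nat _ _ _)).
have R : asc Y X' 𝟙 = (idm Y ⊠ runV X') ∘ run (Y ⊗ X').
  apply: (iso_epi (ascK _ _ _)); rewrite ascVK comp_assoc kelly_run.
  by rewrite -tenl_comp runK tenm_id.
rewrite R ?comp_assoc (re2 (run_nat _)) -kelly_unit lunVK comp_idr.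
rewrite -!comp_assoc -!tenl_comp ?comp_assoc.
have := ev_zag X'; rewrite ?comp_assoc => ->.
by rewrite tenm_id comp_idl.
Qed.

Lemma coev_ldm (X Y : C) (X' : left_dual X) (Y' : left_dual Y) (f : hom X Y) :
  (idm Y ⊠ ldm X' Y' f) ∘ coev Y' = (f ⊠ idm X') ∘ coev X'.
Proof.
rewrite [LHS]coev_inj; congr ((_ ⊠ _) ∘ _).
rewrite tenr_comp ?comp_assoc (re2 (asc_nat _ _ _)) (re1 (esym (tenl_comp _ _ _ _ _ _))).
rewrite ev_ldm tenl_comp ?comp_assoc -(re2 (asc_nat _ _ _)).
rewrite tenm_id -(re2 (ten_swap _ _)) -lunV_nat -!comp_assoc ev_zig.
by rewrite comp_idl.
Qed.

Definition rev_dual (X : C) (X' : right_dual X) : left_dual (X : rev C) :=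
  {| ldob := rdob X' : rev C; ev := evr X'; coev := coevr X';
     ev_zig := evr_zig X'; ev_zag := evr_zag X' |}.
End Duality.

Record monad_data (A : Category) (T : Functor A A) := {
  mul : Trans (T ∘F T) T;
  eta : Trans (id_functor A) T }.

Definition is_monad (A : Category) (T : Functor A A) (t : monad_data T) : Prop :=
  [/\ forall X : A, mul t X ∘ fmap T (mul t X) = mul t X ∘ mul t (T X),
      forall X : A, mul t X ∘ fmap T (eta t X) = idm (T X)
    & forall X : A, mul t X ∘ eta t (T X) = idm (T X)].

Record comonoidal_data (A B : MonCat) (F : Functor A B) := {
  co2 : forall X Y : A, hom (F (X ⊗ Y)) (F X ⊗ F Y);
  co0 : hom (F 𝟙) 𝟙;
  co2_nat : forall (X X' Y Y' : A) (f : hom X X') (g : hom Y Y'),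
    co2 X' Y' ∘ fmap F (f ⊠ g) = (fmap F f ⊠ fmap F g) ∘ co2 X Y }.
Arguments co0 {A B F}.

Definition is_comonoidal (A B : MonCat) (F : Functor A B) (c : comonoidal_data F) :
    Prop :=
  [/\ forall X Y Z : A,
        asc (F X) (F Y) (F Z) ∘ (co2 c X Y ⊠ idm (F Z)) ∘ co2 c (X ⊗ Y) Z
        = (idm (F X) ⊠ co2 c Y Z) ∘ co2 c X (Y ⊗ Z) ∘ fmap F (asc X Y Z),
      forall X : A,
        lun (F X) ∘ (co0 c ⊠ idm (F X)) ∘ co2 c 𝟙 X = fmap F (lun X)
    & forall X : A,
        run (F X) ∘ (idm (F X) ⊠ co0 c) ∘ co2 c X 𝟙 = fmap F (run X)].

Definition is_comonoidal_trans (A B : MonCat) (F G : Functor A B)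
    (cF : comonoidal_data F) (cG : comonoidal_data G) (t : Trans F G) : Prop :=
  (forall X Y : A, co2 cG X Y ∘ t (X ⊗ Y) = (t X ⊠ t Y) ∘ co2 cF X Y)
  /\ co0 cG ∘ t 𝟙 = co0 cF.

Lemma id_co2_nat (A : MonCat) (X X' Y Y' : A) (f : hom X X') (g : hom Y Y') :
  idm (X' ⊗ Y') ∘ (f ⊠ g) = (f ⊠ g) ∘ idm (X ⊗ Y).
Proof. by rewrite comp_idl comp_idr. Qed.

Definition id_comonoidal (A : MonCat) : comonoidal_data (id_functor A) :=
  @Build_comonoidal_data A A (id_functor A)
    (fun X Y : A => idm (X ⊗ Y)) (idm 𝟙) (@id_co2_nat A).

Section CompComonoidal.
Variables (A B D : MonCat) (G : Functor B D) (F : Functor A B).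
Variables (cG : comonoidal_data G) (cF : comonoidal_data F).

Definition comp_co2 (X Y : A) : hom (G (F (X ⊗ Y))) (G (F X) ⊗ G (F Y)) :=
  co2 cG (F X) (F Y) ∘ fmap G (co2 cF X Y).

Lemma comp_co2_nat (X X' Y Y' : A) (f : hom X X') (g : hom Y Y') :
  comp_co2 X' Y' ∘ fmap (G ∘F F) (f ⊠ g)
  = (fmap (G ∘F F) f ⊠ fmap (G ∘F F) g) ∘ comp_co2 X Y.
Proof.
rewrite /comp_co2 /= comp_assoc -fmap_comp co2_nat fmap_comp -!comp_assoc.
by rewrite co2_nat.
Qed.

Definition comp_comonoidal : comonoidal_data (G ∘F F) :=
  @Build_comonoidal_data A D (G ∘F F) comp_co2 (co0 cG ∘ fmap G (co0 cF)) comp_co2_nat.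

Lemma comp_is_comonoidal :
  is_comonoidal cG -> is_comonoidal cF -> is_comonoidal comp_comonoidal.
Proof.
move=> [aG lG rG] [aF lF rF]; split=> [X Y Z|X|X]; rewrite /= /comp_co2.
- rewrite tenr_comp !comp_assoc -(fmap_id G).
  rewrite -(re2 (co2_nat cG _ _)) fmap_id.
  have := aG (F X) (F Y) (F Z); rewrite !comp_assoc => E.
  rewrite -(comp_assoc (co2 cG _ _ ⊠ _)) -(comp_assoc (asc _ _ _)) E !comp_assoc.
  rewrite -!fmap_comp.
  have -> : asc (F X) (F Y) (F Z) ∘ ((co2 cF X Y ⊠ idm (F Z)) ∘ co2 cF (X ⊗ Y) Z)
     = (idm (F X) ⊠ co2 cF Y Z) ∘ (co2 cF X (Y ⊗ Z) ∘ fmap F (asc X Y Z)).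
    by rewrite -!comp_assoc aF.
  rewrite !fmap_comp (re2 (co2_nat cG _ _)) fmap_id tenl_comp.
  by rewrite !comp_assoc.
- rewrite tenr_comp -(fmap_id G) !comp_assoc -(re2 (co2_nat cG _ _)) fmap_id.
  by rewrite -!comp_assoc lG -!fmap_comp lF.
- rewrite tenl_comp -(fmap_id G) !comp_assoc -(re2 (co2_nat cG _ _)) fmap_id.
  by rewrite -!comp_assoc rG -!fmap_comp rF.
Qed.
End CompComonoidal.

Definition is_bimonad (A : MonCat) (T : Functor A A) (t : monad_data T)
    (c : comonoidal_data T) : Prop :=
  [/\ is_monad t, is_comonoidal c,
      is_comonoidal_trans (comp_comonoidal c c) c (mul t)
    & is_comonoidal_trans (id_comonoidal A) c (eta t)].

Record left_antipode (A : MonCat) (L : forall X : A, left_dual X)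
    (T : Functor A A) (t : monad_data T) (c : comonoidal_data T) := {
  lant : forall X : A, hom (T (L (T X))) (L X);
  lant_nat : forall (X Y : A) (f : hom X Y),
    lant X ∘ fmap T (ldm (L (T X)) (L (T Y)) (fmap T f)) = ldm (L X) (L Y) f ∘ lant Y;
  lant_ev : forall X : A,
    co0 c ∘ fmap T (ev (L X)) ∘ fmap T (ldm (L X) (L (T X)) (eta t X) ⊠ idm X)
    = ev (L (T X))
      ∘ ((lant (T X) ∘ fmap T (ldm (L (T (T X))) (L (T X)) (mul t X))) ⊠ idm (T X))
      ∘ co2 c (L (T X)) X;
  lant_coev : forall X : A,
    (eta t X ⊠ idm (L X)) ∘ coev (L X) ∘ co0 c
    = (mul t X ⊠ lant X) ∘ co2 c (T X) (L (T X)) ∘ fmap T (coev (L (T X))) }.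

Record right_antipode (A : MonCat) (R : forall X : A, right_dual X)
    (T : Functor A A) (t : monad_data T) (c : comonoidal_data T) := {
  rant : forall X : A, hom (T (R (T X))) (R X);
  rant_nat : forall (X Y : A) (f : hom X Y),
    rant X ∘ fmap T (rdm (R (T X)) (R (T Y)) (fmap T f)) = rdm (R X) (R Y) f ∘ rant Y;
  rant_ev : forall X : A,
    co0 c ∘ fmap T (evr (R X)) ∘ fmap T (idm X ⊠ rdm (R X) (R (T X)) (eta t X))
    = evr (R (T X))
      ∘ (idm (T X) ⊠ (rant (T X) ∘ fmap T (rdm (R (T (T X))) (R (T X)) (mul t X))))
      ∘ co2 c X (R (T X));
  rant_coev : forall X : A,
    (idm (R X) ⊠ eta t X) ∘ coevr (R X) ∘ co0 c
    = (rant X ⊠ mul t X) ∘ co2 c (R (T X)) (T X) ∘ fmap T (coevr (R (T X))) }.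

Definition is_hopf_monad (A : MonCat) (D : Autonomous A) (T : Functor A A)
    (t : monad_data T) (c : comonoidal_data T) : Prop :=
  [/\ is_bimonad t c, inhabited (left_antipode (ldual D) t c)
    & inhabited (right_antipode (rdual D) t c)].

Record Bimonad (A : MonCat) := {
  bfun :> Functor A A;
  bmon : monad_data bfun;
  bcom : comonoidal_data bfun;
  bimonadP : is_bimonad bmon bcom }.

Record HopfMonad (A : MonCat) (D : Autonomous A) := {
  hbim :> Bimonad A;
  hleft : left_antipode (ldual D) (bmon hbim) (bcom hbim);
  hright : right_antipode (rdual D) (bmon hbim) (bcom hbim) }.

Record module (A : Category) (T : Functor A A) (t : monad_data T) := {
  car : A;
  act : hom (T car) car;
  act_mul : act ∘ fmap T act = act ∘ mul t car;
  act_eta : act ∘ eta t car = idm car }.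

Record linear (A : Category) (T : Functor A A) (t : monad_data T) (M N : module t) := {
  und : hom (car M) (car N);
  und_act : und ∘ act M = act N ∘ fmap T und }.

Section Modules.
Variables (A : Category) (T : Functor A A) (t : monad_data T).

Lemma linear_eq (M N : module t) (f g : linear M N) : und f = und g -> f = g.
Proof.
case: f g => [f pf] [g pg] /= E; case: _ / E pg => pg.
by rewrite (proof_irrelevance _ pf pg).
Qed.

Lemma id_und_act (M : module t) : idm (car M) ∘ act M = act M ∘ fmap T (idm (car M)).
Proof. by rewrite fmap_id comp_idl comp_idr. Qed.

Definition id_linear (M : module t) : linear M M := Build_linear (id_und_act M).

Lemma comp_und_act (M N P : module t) (g : linear N P) (f : linear M N) :
  (und g ∘ und f) ∘ act M = act P ∘ fmap T (und g ∘ und f).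
Proof. by rewrite fmap_comp comp_assoc und_act -!comp_assoc und_act. Qed.

Definition comp_linear (M N P : module t) (g : linear N P) (f : linear M N) :
  linear M P := Build_linear (comp_und_act g f).

Lemma linear_idl (M N : module t) (f : linear M N) : comp_linear (id_linear N) f = f.
Proof. by apply: linear_eq; rewrite /= comp_idl. Qed.

Lemma linear_idr (M N : module t) (f : linear M N) : comp_linear f (id_linear M) = f.
Proof. by apply: linear_eq; rewrite /= comp_idr. Qed.

Lemma linear_assoc (M N P R : module t) (h : linear P R) (g : linear N P)
  (f : linear M N) : comp_linear (comp_linear h g) f = comp_linear h (comp_linear g f).
Proof. by apply: linear_eq; rewrite /= comp_assoc. Qed.

Definition mod_cat : Category :=
  {| ob := module t; hom := @linear A T t; idm := id_linear; comp := comp_linear;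
     comp_idl := linear_idl; comp_idr := linear_idr; comp_assoc := linear_assoc |}.

Definition forget : Functor mod_cat A :=
  @Build_Functor mod_cat A (@car A T t) (@und A T t)
    (fun _ => eq_refl) (fun _ _ _ _ _ => eq_refl).

Hypothesis Ht : is_monad t.

Lemma free_mul (X : A) : mul t X ∘ fmap T (mul t X) = mul t X ∘ mul t (T X).
Proof. by case: Ht. Qed.

Lemma free_eta (X : A) : mul t X ∘ eta t (T X) = idm (T X).
Proof. by case: Ht. Qed.

Definition free_mod (X : A) : mod_cat :=
  {| car := T X; act := mul t X; act_mul := free_mul X; act_eta := free_eta X |}.

Lemma free_und_act (X Y : A) (f : hom X Y) :
  fmap T f ∘ mul t X = mul t Y ∘ fmap T (fmap T f).
Proof. by rewrite -(tnat (mul t) f). Qed.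

Definition free_map (X Y : A) (f : hom X Y) : hom (free_mod X) (free_mod Y) :=
  @Build_linear A T t (free_mod X) (free_mod Y) (fmap T f) (free_und_act f).

Lemma free_map_id (X : A) : free_map (idm X) = idm (free_mod X).
Proof. by apply: linear_eq; rewrite /= fmap_id. Qed.

Lemma free_map_comp (X Y Z : A) (g : hom Y Z) (f : hom X Y) :
  free_map (g ∘ f) = free_map g ∘ free_map f.
Proof. by apply: linear_eq; rewrite /= fmap_comp. Qed.

Definition free : Functor A mod_cat :=
  @Build_Functor A mod_cat free_mod free_map free_map_id free_map_comp.

Definition counit_app (M : mod_cat) : hom (free (forget M)) M :=
  @Build_linear A T t (free_mod (car M)) M (act M) (esym (act_mul M)).

Lemma counit_nat (M N : mod_cat) (f : hom M N) :
  counit_app N ∘ fmap free (fmap forget f) = f ∘ counit_app M.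
Proof. by apply: linear_eq; rewrite /= und_act. Qed.

Definition counit : Trans (free ∘F forget) (id_functor mod_cat) :=
  @Build_Trans mod_cat mod_cat (free ∘F forget) (id_functor mod_cat)
    counit_app counit_nat.
End Modules.

Section BimonadModules.
Variables (A : MonCat) (T : Bimonad A).
Let t := bmon T.
Let c := bcom T.
Let MC := mod_cat t.

Lemma bim_monad : is_monad t. Proof. by case: (bimonadP T). Qed.
Lemma bim_com : is_comonoidal c. Proof. by case: (bimonadP T). Qed.

Lemma bim_mul2 (X Y : A) : co2 c X Y ∘ mul t (X ⊗ Y)
  = (mul t X ⊠ mul t Y) ∘ (co2 c (T X) (T Y) ∘ fmap T (co2 c X Y)).
Proof. by case: (bimonadP T) => _ _ [] H _ _; rewrite H. Qed.

Lemma bim_mul0 : co0 c ∘ mul t 𝟙 = co0 c ∘ fmap T (co0 c).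
Proof. by case: (bimonadP T) => _ _ [] _ H _; rewrite H. Qed.

Lemma bim_eta2 (X Y : A) : co2 c X Y ∘ eta t (X ⊗ Y) = eta t X ⊠ eta t Y.
Proof. by case: (bimonadP T) => _ _ _ [] H _; rewrite H /= comp_idr. Qed.

Lemma bim_eta0 : co0 c ∘ eta t 𝟙 = idm 𝟙.
Proof. by case: (bimonadP T) => _ _ _ [] _ H; rewrite H. Qed.

Definition ten_act (M N : MC) : hom (T (car M ⊗ car N)) (car M ⊗ car N) :=
  (act M ⊠ act N) ∘ co2 c (car M) (car N).

Lemma ten_act_mul (M N : MC) :
  ten_act M N ∘ fmap T (ten_act M N) = ten_act M N ∘ mul t (car M ⊗ car N).
Proof.
rewrite /ten_act !comp_assoc bim_mul2 fmap_comp (re2 (co2_nat c _ _)).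
by rewrite -!comp_assoc -!tenm_comp !act_mul.
Qed.

Lemma ten_act_eta (M N : MC) :
  ten_act M N ∘ eta t (car M ⊗ car N) = idm (car M ⊗ car N).
Proof. by rewrite /ten_act comp_assoc bim_eta2 -tenm_comp !act_eta tenm_id. Qed.

Definition ten_mod (M N : MC) : MC :=
  {| car := car M ⊗ car N; act := ten_act M N;
     act_mul := ten_act_mul M N; act_eta := ten_act_eta M N |}.

Definition one_mod : MC :=
  {| car := 𝟙; act := co0 c; act_mul := esym bim_mul0; act_eta := bim_eta0 |}.

Lemma tenm_und_act (M M' N N' : MC) (f : hom M M') (g : hom N N') :
  (und f ⊠ und g) ∘ act (ten_mod M N)
  = act (ten_mod M' N') ∘ fmap T (und f ⊠ und g).
Proof.
by rewrite /= /ten_act !comp_assoc co2_nat -!comp_assoc -!tenm_comp !und_act.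
Qed.

Definition tenm_mod (M M' N N' : MC) (f : hom M M') (g : hom N N') :
  hom (ten_mod M N) (ten_mod M' N') :=
  @Build_linear A T t (ten_mod M N) (ten_mod M' N') (und f ⊠ und g) (tenm_und_act f g).

Lemma inv_und_act (M N : MC) (f : hom M N) (g : hom (car N) (car M)) :
  und f ∘ g = idm _ -> g ∘ und f = idm _ -> g ∘ act N = act M ∘ fmap T g.
Proof.
move=> fg gf; apply: (iso_mono gf); rewrite -!comp_assoc fg comp_idl und_act.
by rewrite comp_assoc -fmap_comp fg fmap_id comp_idr.
Qed.

Definition inv_linear (M N : MC) (f : hom M N) (g : hom (car N) (car M))
  (fg : und f ∘ g = idm _) (gf : g ∘ und f = idm _) : hom N M :=
  @Build_linear A T t N M g (inv_und_act fg gf).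

Lemma asc_und_act (M N P : MC) :
  asc (car M) (car N) (car P) ∘ act (ten_mod (ten_mod M N) P)
  = act (ten_mod M (ten_mod N P)) ∘ fmap T (asc (car M) (car N) (car P)).
Proof.
have [aT _ _] := bim_com.
rewrite /= /ten_act /= /ten_act -[act P]comp_idr -[act M in RHS]comp_idr !tenm_comp.
rewrite !comp_assoc (re2 (asc_nat _ _ _)) -[fmap T (asc _ _ _)]comp_idl.
have := aT (car M) (car N) (car P); rewrite !comp_assoc comp_idl => ->.
by rewrite comp_idr.
Qed.

Definition asc_mod (M N P : MC) :
  hom (ten_mod (ten_mod M N) P) (ten_mod M (ten_mod N P)) :=
  @Build_linear A T t (ten_mod (ten_mod M N) P) (ten_mod M (ten_mod N P))
    (asc (car M) (car N) (car P)) (asc_und_act M N P).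

Lemma lun_und_act (M : MC) :
  lun (car M) ∘ act (ten_mod one_mod M) = act M ∘ fmap T (lun (car M)).
Proof.
have [_ lT _] := bim_com.
rewrite /= /ten_act /= -lT -[co0 c]comp_idl -[act M in LHS]comp_idr tenm_comp.
by rewrite comp_idl -!comp_assoc lun_nat.
Qed.

Definition lun_mod (M : MC) : hom (ten_mod one_mod M) M :=
  @Build_linear A T t (ten_mod one_mod M) M (lun (car M)) (lun_und_act M).

Lemma run_und_act (M : MC) :
  run (car M) ∘ act (ten_mod M one_mod) = act M ∘ fmap T (run (car M)).
Proof.
have [_ _ rT] := bim_com.
rewrite /= /ten_act /= -rT -[co0 c]comp_idl -[act M in LHS]comp_idr tenm_comp.
by rewrite comp_idl -!comp_assoc run_nat.
Qed.

Definition run_mod (M : MC) : hom (ten_mod M one_mod) M :=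
  @Build_linear A T t (ten_mod M one_mod) M (run (car M)) (run_und_act M).

Definition mod_mon : MonCat.
Proof.
refine (@Build_MonCat MC ten_mod one_mod tenm_mod _ _ asc_mod
  (fun M N P => @inv_linear _ _ (asc_mod M N P) _ (ascVK _ _ _) (ascK _ _ _))
  lun_mod (fun M => @inv_linear _ _ (lun_mod M) _ (lunVK _) (lunK _))
  run_mod (fun M => @inv_linear _ _ (run_mod M) _ (runVK _) (runK _))
  _ _ _ _ _ _ _ _ _ _ _); intros; apply: linear_eq; rewrite /=.
- exact: tenm_id.
- exact: tenm_comp.
- exact: ascK.
- exact: ascVK.
- exact: lunK.
- exact: lunVK.
- exact: runK.
- exact: runVK.
- exact: asc_nat.
- exact: lun_nat.
- exact: run_nat.
- exact: pentagon.
- exact: triangle.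
Defined.
End BimonadModules.

Section DualModules.
Variables (A : MonCat).

Lemma dual_act_unique (K : Functor A A) (c : comonoidal_data K) (X : A)
    (X' : left_dual X) (r : hom (K X) X) (s s' : hom (K X') X') :
  is_comonoidal c ->
  ev X' ∘ ((s ⊠ r) ∘ co2 c X' X) = co0 c ∘ fmap K (ev X') ->
  (r ⊠ s') ∘ (co2 c X X' ∘ fmap K (coev X')) = coev X' ∘ co0 c ->
  s = s'.
Proof.
move=> [aK lK rK] E1 E2; symmetry.
have Z := ev_zag X'; rewrite !comp_assoc in Z.
rewrite -[s']comp_idr -(fmap_id K) -Z !fmap_comp -lK !comp_assoc.
rewrite -(re2 (lun_nat _)).
rewrite (re2 (co2_nat c _ _)) fmap_id (re1 (esym (tenm_comp _ _ _ _))).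
rewrite (re1 (esym (tenm_comp _ _ _ _))) !comp_idl !comp_idr -E1.
have P : (co2 c X' X ⊠ idm (K X')) ∘ (co2 c (X' ⊗ X) X' ∘ fmap K (ascV X' X X'))
  = ascV _ _ _ ∘ ((idm (K X') ⊠ co2 c X X') ∘ co2 c X' (X ⊗ X')).
  apply: (iso_mono (ascK _ _ _)); rewrite (re0 (ascVK _ _ _)) -!comp_assoc aK.
  by rewrite !comp_assoc -fmap_comp ascVK fmap_id comp_idr.
have -> : (ev X' ∘ ((s ⊠ r) ∘ co2 c X' X)) ⊠ s'
   = (ev X' ⊠ idm X') ∘ (((s ⊠ r) ⊠ s') ∘ (co2 c X' X ⊠ idm (K X'))).
  by rewrite -!tenm_comp comp_idl comp_idr.
rewrite !comp_assoc (re3 P) !comp_assoc -(re2 (ascV_nat _ _ _)).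
rewrite (re2 (co2_nat c _ _)) fmap_id !(re1 (esym (tenm_comp _ _ _ _))).
rewrite !comp_idr comp_assoc E2.
have -> : s ⊠ (coev X' ∘ co0 c)
   = (idm X' ⊠ coev X') ∘ ((s ⊠ idm 𝟙) ∘ (idm (K X') ⊠ co0 c)).
  by rewrite -!tenm_comp !comp_idl comp_idr.
have U : (idm (K X') ⊠ co0 c) ∘ (co2 c X' 𝟙 ∘ fmap K (runV X')) = runV (K X').
  apply: (iso_mono (runK _)); rewrite -!comp_assoc rK -fmap_comp.
  by rewrite !runVK fmap_id.
rewrite !comp_assoc U -runV_nat.
by have := f_equal (fun k => k ∘ s) Z; rewrite /= !comp_assoc comp_idl.
Qed.

Variables (T : Bimonad A) (L : forall X : A, left_dual X).
Let t := bmon T.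
Let c := bcom T.
Variable s : left_antipode L t c.

Section Action.
Variable M : mod_cat t.
Let X := car M.

(* The left dual of a module (X, r) is the left dual of X with this action; ev and
   coev are those of X. *)
Definition ldual_act : hom (T (L X)) (L X) :=
  lant s X ∘ fmap T (ldm (L (T X)) (L X) (act M)).

Lemma ldual_ev : ev (L X) ∘ ((ldual_act ⊠ act M) ∘ co2 c (L X) X)
  = co0 c ∘ fmap T (ev (L X)).
Proof.
have E : ev (L X) = ev (L X) ∘
   ((ldm (L X) (L (T X)) (eta t X) ∘ ldm (L (T X)) (L X) (act M)) ⊠ idm X).
  by rewrite -ldm_comp act_eta ldm_id tenm_id comp_idr.
rewrite {2}E tenr_comp !fmap_comp -!comp_assoc (lant_ev s) !comp_assoc co2_nat.
rewrite fmap_id (re1 (esym (tenm_comp _ _ _ _))) comp_idr comp_assoc.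
rewrite -fmap_comp -ldm_comp -act_mul (ldm_comp _ (L (T X))) fmap_comp.
rewrite -(comp_assoc (lant s (T X))) lant_nat comp_assoc tenr_comp.
rewrite !comp_assoc (re1 (ev_ldm _ _ _)) !comp_assoc.
by rewrite (re1 (esym (tenm_comp _ _ _ _))) comp_idl comp_idr.
Qed.

Lemma ldual_coev : (act M ⊠ ldual_act) ∘ (co2 c X (L X) ∘ fmap T (coev (L X)))
  = coev (L X) ∘ co0 c.
Proof.
rewrite /ldual_act -{1}(comp_idr (act M)) tenm_comp -(fmap_id T).
rewrite !comp_assoc -(re2 (co2_nat c _ _)) -fmap_comp coev_ldm fmap_comp.
rewrite (re2 (co2_nat c _ _)) fmap_id (re1 (esym (tenm_comp _ _ _ _))) act_mul.
rewrite comp_idr -[lant s X]comp_idl tenm_comp !comp_assoc.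
have := lant_coev s X; rewrite !comp_assoc => <-.
by rewrite (re1 (esym (tenm_comp _ _ _ _))) act_eta comp_idl tenm_id comp_idl.
Qed.

Lemma ldual_eta : ldual_act ∘ eta t (L X) = idm (L X).
Proof.
have idc : is_comonoidal (id_comonoidal A).
  split=> *; rewrite /= ?tenm_id ?comp_idr ?comp_idl //.
apply: (dual_act_unique (r := (idm X : hom (id_functor A X) X)) idc).
- rewrite /= -(act_eta M) tenm_comp !comp_assoc comp_idr -bim_eta2.
  have := ldual_ev; rewrite -!comp_assoc => ->.
  by rewrite !comp_assoc -(tnat (eta t)) /= -comp_assoc bim_eta0.
- by rewrite /= tenm_id !comp_idl comp_idr.
Qed.

Lemma ldual_mul : ldual_act ∘ fmap T ldual_act = ldual_act ∘ mul t (L X).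
Proof.
symmetry.
have Hc := comp_is_comonoidal (bim_com T) (bim_com T).
apply: (dual_act_unique (r := (act M ∘ mul t X : hom ((T ∘F T) X) X)) Hc) => /=.
- rewrite tenm_comp !comp_assoc -bim_mul2.
  have := ldual_ev; rewrite -!comp_assoc => ->.
  by rewrite !comp_assoc -(tnat (mul t)) /= -!comp_assoc bim_mul0.
- rewrite -act_mul tenm_comp /comp_co2 !comp_assoc -(re2 (co2_nat c _ _)).
  by rewrite -!fmap_comp ldual_coev fmap_comp -!comp_assoc -ldual_coev !comp_assoc.
Qed.

Definition ldual_mod : mod_cat t :=
  {| car := L X; act := ldual_act; act_mul := ldual_mul; act_eta := ldual_eta |}.
End Action.

Section DualMorphisms.
Variable M : mod_mon T.

Lemma coev_und_act : coev (L (car M)) ∘ act (one_mod T)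
  = act (ten_mod M (ldual_mod M)) ∘ fmap T (coev (L (car M))).
Proof. by rewrite /= /ten_act comp_assoc (ldual_coev M). Qed.

Definition mod_ev : hom (ten_mod (ldual_mod M) M) (one_mod T) :=
  @Build_linear A T t (ten_mod (ldual_mod M) M) (one_mod T) (ev (L (car M))) (ldual_ev M).

Definition mod_coev : hom (one_mod T) (ten_mod M (ldual_mod M)) :=
  @Build_linear A T t (one_mod T) (ten_mod M (ldual_mod M)) (coev (L (car M)))
    coev_und_act.

Definition mod_ldual : left_dual M.
Proof.
refine (@Build_left_dual (mod_mon T) M (ldual_mod M) mod_ev mod_coev _ _).
- by apply: linear_eq; exact: (ev_zig (L (car M))).
- by apply: linear_eq; exact: (ev_zag (L (car M))).
Defined.
End DualMorphisms.
End DualModules.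

Section RightDualModules.
Variables (A : MonCat) (T : Bimonad A) (R : forall X : A, right_dual X).
Let t := bmon T.
Let c := bcom T.

Let Tr : Functor (rev A) (rev A) := bfun T.

Definition rev_co2 (X Y : rev A) : hom (Tr (X ⊗ Y)) (Tr X ⊗ Tr Y) := co2 c Y X.

Lemma rev_co2_nat (X X' Y Y' : rev A) (f : hom X X') (g : hom Y Y') :
  rev_co2 X' Y' ∘ fmap Tr (f ⊠ g) = (fmap Tr f ⊠ fmap Tr g) ∘ rev_co2 X Y.
Proof. exact: (co2_nat c g f). Qed.

Definition rev_com : comonoidal_data Tr :=
  @Build_comonoidal_data (rev A) (rev A) Tr rev_co2 (co0 c) rev_co2_nat.

Lemma rev_bimonadP : is_bimonad (t : monad_data Tr) rev_com.
Proof.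
case: (bimonadP T) => H1 [aT lT rT] [M2 M0] [E2 E0].
split.
- exact: H1.
- split=> [X Y Z|X|X]; [|exact: rT|exact: lT].
  apply: (iso_mono (ascK (T Z) (T Y) (T X))) => /=.
  have E := aT Z Y X; rewrite !comp_assoc in E.
  rewrite !comp_assoc (re0 (ascVK _ _ _)).
  by rewrite (re3 E) !comp_assoc -fmap_comp ascVK fmap_id comp_idr.
- by split=> [X Y|]; [exact: M2 | exact: M0].
- by split=> [X Y|]; [exact: E2 | exact: E0].
Qed.

Definition rev_bim : Bimonad (rev A) := Build_Bimonad rev_bimonadP.

Variable s : right_antipode R t c.

Definition rev_lant :
  left_antipode (A := rev A) (fun X => rev_dual (R X)) (bmon rev_bim) (bcom rev_bim) :=
  @Build_left_antipode (rev A) (fun X => rev_dual (R X)) (bfun T) t rev_com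
    (rant s) (rant_nat s) (rant_ev s) (rant_coev s).

Section DualMorphisms.
Variable M : mod_mon T.
Let RM := R (car M).

Definition rdual_act : hom (T RM) RM :=
  rant s (car M) ∘ fmap T (rdm (R (T (car M))) RM (act M)).

Lemma rdual_mul : rdual_act ∘ fmap T rdual_act = rdual_act ∘ mul t RM.
Proof. exact: (ldual_mul rev_lant). Qed.

Lemma rdual_eta : rdual_act ∘ eta t RM = idm _.
Proof. exact: (ldual_eta rev_lant). Qed.

Definition rdual_mod : mod_mon T :=
  {| car := rdob RM; act := rdual_act; act_mul := rdual_mul; act_eta := rdual_eta |}.

Lemma evr_und_act :
  evr RM ∘ act (ten_mod M rdual_mod) = act (one_mod T) ∘ fmap T (evr RM).
Proof. exact: (ldual_ev rev_lant M). Qed.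

Lemma coevr_und_act :
  coevr RM ∘ act (one_mod T) = act (ten_mod rdual_mod M) ∘ fmap T (coevr RM).
Proof. by rewrite /= /ten_act comp_assoc; symmetry; exact: (ldual_coev rev_lant M). Qed.

Definition mod_evr : hom (ten_mod M rdual_mod) (one_mod T) :=
  @Build_linear A T t (ten_mod M rdual_mod) (one_mod T) (evr RM) evr_und_act.

Definition mod_coevr : hom (one_mod T) (ten_mod rdual_mod M) :=
  @Build_linear A T t (one_mod T) (ten_mod rdual_mod M) (coevr RM) coevr_und_act.

Definition mod_rdual : right_dual M.
Proof.
refine (@Build_right_dual (mod_mon T) M rdual_mod mod_evr mod_coevr _ _).
- by apply: linear_eq; exact: (evr_zig RM).
- by apply: linear_eq; exact: (evr_zag RM).
Defined.
End DualMorphisms.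
End RightDualModules.

Definition mod_autonomous (A : MonCat) (D : Autonomous A) (T : HopfMonad D) :
    Autonomous (mod_mon T) :=
  {| ldual := mod_ldual (hleft T); rdual := mod_rdual (hright T) |}.

Section Cross.
Variables (A : MonCat) (T : Bimonad A).
Let t := bmon T.
Let U : Functor (mod_mon T) A := forget t.
Let F : Functor A (mod_mon T) := free (bim_monad T).
Let eps : Trans (F ∘F U) (id_functor (mod_mon T)) := counit (bim_monad T).
Variable Q : Functor (mod_mon T) (mod_mon T).

Definition cross : Functor A A := U ∘F Q ∘F F.

Section Monad.
Variable q : monad_data Q.

Definition cross_mul_app (X : A) : hom (cross (cross X)) (cross X) :=
  fmap U (mul q (F X) ∘ fmap Q (eps (Q (F X)))).

Lemma cross_mul_nat (X Y : A) (f : hom X Y) :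
  cross_mul_app Y ∘ fmap (cross ∘F cross) f = fmap cross f ∘ cross_mul_app X.
Proof.
have E : (mul q (F Y) ∘ fmap Q (eps (Q (F Y)))) ∘ fmap Q (fmap F (fmap cross f))
  = fmap Q (fmap F f) ∘ (mul q (F X) ∘ fmap Q (eps (Q (F X)))).
  rewrite -comp_assoc -(tnat (mul q)) !comp_assoc; congr (_ ∘ _).
  by rewrite -!fmap_comp; congr (fmap Q _); exact: (tnat eps).
exact: (f_equal (@fmap _ _ U _ _) E).
Qed.

Definition cross_eta_app (X : A) : hom X (cross X) :=
  fmap U (eta q (F X)) ∘ eta t X.

Lemma cross_eta_nat (X Y : A) (f : hom X Y) :
  cross_eta_app Y ∘ f = fmap cross f ∘ cross_eta_app X.
Proof.
have E := f_equal (@fmap _ _ U _ _) (tnat (eta q) (fmap F f)).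
rewrite !fmap_comp in E.
rewrite /cross_eta_app !comp_assoc (tnat (eta t) f) -!comp_assoc.
by congr (_ ∘ _); exact: E.
Qed.

Definition cross_monad : monad_data cross :=
  {| mul := @Build_Trans A A (cross ∘F cross) cross cross_mul_app cross_mul_nat;
     eta := @Build_Trans A A (id_functor A) cross cross_eta_app cross_eta_nat |}.
End Monad.

Section Comonoidal.
Variable c : comonoidal_data Q.

Definition cross_co2 (X Y : A) : hom (cross (X ⊗ Y)) (cross X ⊗ cross Y) :=
  fmap U (co2 c (F X) (F Y)
          ∘ fmap Q (eps (F X ⊗ F Y) ∘ fmap F (eta t X ⊠ eta t Y))).

Lemma cross_co2_nat (X X' Y Y' : A) (f : hom X X') (g : hom Y Y') :
  cross_co2 X' Y' ∘ fmap cross (f ⊠ g) = (fmap cross f ⊠ fmap cross g) ∘ cross_co2 X Y.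
Proof.
have E : (eps (F X' ⊗ F Y') ∘ fmap F (eta t X' ⊠ eta t Y')) ∘ fmap F (f ⊠ g)
  = (fmap F f ⊠ fmap F g) ∘ (eps (F X ⊗ F Y) ∘ fmap F (eta t X ⊠ eta t Y)).
  have N : eps (F X' ⊗ F Y') ∘ fmap F (fmap U (fmap F f ⊠ fmap F g))
    = (fmap F f ⊠ fmap F g) ∘ eps (F X ⊗ F Y) := tnat eps _.
  rewrite -(re2 N) !comp_assoc; congr (_ ∘ _).
  rewrite -!fmap_comp; congr (fmap F _) => /=.
  by rewrite -!tenm_comp !(tnat (eta t)).
have E' : (co2 c (F X') (F Y') ∘ fmap Q (eps (F X' ⊗ F Y') ∘ fmap F (eta t X' ⊠ eta t Y')))
    ∘ fmap Q (fmap F (f ⊠ g))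
  = (fmap Q (fmap F f) ⊠ fmap Q (fmap F g))
    ∘ (co2 c (F X) (F Y) ∘ fmap Q (eps (F X ⊗ F Y) ∘ fmap F (eta t X ⊠ eta t Y))).
  by rewrite comp_assoc -fmap_comp E (fmap_comp Q (fmap F f ⊠ fmap F g)) (re2 (co2_nat c _ _)).
exact: (f_equal (@fmap _ _ U _ _) E').
Qed.

Definition cross_com : comonoidal_data cross :=
  @Build_comonoidal_data A A cross cross_co2 (fmap U (co0 c ∘ fmap Q (eps 𝟙)))
    cross_co2_nat.
End Comonoidal.
End Cross.

Section Centralizer.
Variables (A : MonCat) (P Z : Functor A A).
Variable d : forall X Y : A, hom (X ⊗ Y) (P Y ⊗ Z X).

Definition is_centralizer : Prop :=
  (forall (X X' Y Y' : A) (f : hom X X') (g : hom Y Y'),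
    d X' Y' ∘ (f ⊠ g) = (fmap P g ⊠ fmap Z f) ∘ d X Y)
  /\ forall (X W : A) (xi : forall Y : A, hom (X ⊗ Y) (P Y ⊗ W)),
    (forall (Y Y' : A) (g : hom Y Y'),
      xi Y' ∘ (idm X ⊠ g) = (fmap P g ⊠ idm W) ∘ xi Y) ->
    exists! r : hom (Z X) W, forall Y : A, xi Y = (idm (P Y) ⊠ r) ∘ d X Y.

(* The following two predicates are the equations that determine the monad
   structure of a centralizer of a comonoidal endofunctor, and the comonoidal
   structure of a centralizer of a bimonad. *)
Definition is_centralizer_monad (c : comonoidal_data P) (z : monad_data Z) : Prop :=
  (forall X Y1 Y2 : A,
    (idm (P Y1) ⊠ (idm (P Y2) ⊠ mul z X)) ∘ (idm (P Y1) ⊠ d (Z X) Y2)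
      ∘ asc (P Y1) (Z X) Y2 ∘ (d X Y1 ⊠ idm Y2)
    = asc (P Y1) (P Y2) (Z X) ∘ (co2 c Y1 Y2 ⊠ idm (Z X)) ∘ d X (Y1 ⊗ Y2)
      ∘ asc X Y1 Y2)
  /\ forall X : A,
    eta z X = lun (Z X) ∘ (co0 c ⊠ idm (Z X)) ∘ d X 𝟙 ∘ runV X.

Definition is_centralizer_com (p : monad_data P) (cz : comonoidal_data Z) : Prop :=
  (forall X1 X2 Y : A,
    (idm (P Y) ⊠ co2 cz X1 X2) ∘ d (X1 ⊗ X2) Y
    = (mul p Y ⊠ idm (Z X1 ⊗ Z X2)) ∘ asc (P (P Y)) (Z X1) (Z X2)
      ∘ (d X1 (P Y) ⊠ idm (Z X2)) ∘ ascV X1 (P Y) (Z X2) ∘ (idm X1 ⊠ d X2 Y)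
      ∘ asc X1 X2 Y)
  /\ forall Y : A,
    run (P Y) ∘ (idm (P Y) ⊠ co0 cz) ∘ d 𝟙 Y = eta p Y ∘ lun Y.
End Centralizer.

(* An endofunctor G of the category of modules with U G = Z U, where U is the
   forgetful functor, amounts to an action on each Z (car M) for which the
   morphisms fmap Z (und f) are linear. *)
Record lift (A : Category) (T : Functor A A) (t : monad_data T) (Z : Functor A A) := {
  lact : forall M : module t, hom (T (Z (car M))) (Z (car M));
  lact_mul : forall M : module t,
    lact M ∘ fmap T (lact M) = lact M ∘ mul t (Z (car M));
  lact_eta : forall M : module t, lact M ∘ eta t (Z (car M)) = idm (Z (car M));
  lact_nat : forall (M N : module t) (f : linear M N),
    fmap Z (und f) ∘ lact M = lact N ∘ fmap T (fmap Z (und f)) }.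

Section LiftFunctor.
Variables (A : Category) (T : Functor A A) (t : monad_data T) (Z : Functor A A).
Variable l : lift t Z.

Definition lift_ob (M : mod_cat t) : mod_cat t :=
  {| car := Z (car M); act := lact l M;
     act_mul := lact_mul l M; act_eta := lact_eta l M |}.

Definition lift_map (M N : mod_cat t) (f : hom M N) : hom (lift_ob M) (lift_ob N) :=
  @Build_linear A T t (lift_ob M) (lift_ob N) (fmap Z (und f)) (lact_nat l f).

Lemma lift_map_id (M : mod_cat t) : lift_map (idm M) = idm (lift_ob M).
Proof. by apply: linear_eq; rewrite /= fmap_id. Qed.

Lemma lift_map_comp (M N P : mod_cat t) (g : hom N P) (f : hom M N) :
  lift_map (g ∘ f) = lift_map g ∘ lift_map f.
Proof. by apply: linear_eq; rewrite /= fmap_comp. Qed.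

Definition lift_functor : Functor (mod_cat t) (mod_cat t) :=
  @Build_Functor (mod_cat t) (mod_cat t) lift_ob lift_map lift_map_id lift_map_comp.

Lemma forget_lift : forget t ∘F lift_functor = Z ∘F forget t.
Proof. by congr Build_Functor; exact: proof_irrelevance. Qed.
End LiftFunctor.

Section DistributiveLaws.
Variables (A : Category) (T P : Functor A A) (t : monad_data T) (p : monad_data P).
Variable om : Trans (T ∘F P) (P ∘F T).

Definition is_distributive_law : Prop :=
  [/\ forall X : A, om X ∘ fmap T (mul p X) = mul p (T X) ∘ fmap P (om X) ∘ om (P X),
      forall X : A, om X ∘ fmap T (eta p X) = eta p (T X),
      forall X : A, om X ∘ mul t (P X) = fmap P (mul t X) ∘ om (T X) ∘ fmap T (om X)
    & forall X : A, om X ∘ eta t (P X) = fmap P (eta t X)].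

Definition law_mul_app (X : A) : hom (P (T (P (T X)))) (P (T X)) :=
  mul p (T X) ∘ fmap P (fmap P (mul t X)) ∘ fmap P (om (T X)).

Lemma law_mul_nat (X Y : A) (f : hom X Y) :
  law_mul_app Y ∘ fmap ((P ∘F T) ∘F (P ∘F T)) f = fmap (P ∘F T) f ∘ law_mul_app X.
Proof.
rewrite /law_mul_app /= !comp_assoc -!fmap_comp.
rewrite (tnat om (fmap T f)) /= -comp_assoc -fmap_comp (tnat (mul t) f) /=.
rewrite !fmap_comp -!comp_assoc; congr (_ ∘ _); congr (_ ∘ _).
exact: (tnat (mul p) (fmap T f)).
Qed.

Definition law_eta_app (X : A) : hom X (P (T X)) := eta p (T X) ∘ eta t X.

Lemma law_eta_nat (X Y : A) (f : hom X Y) :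
  law_eta_app Y ∘ f = fmap (P ∘F T) f ∘ law_eta_app X.
Proof.
rewrite /law_eta_app comp_assoc (tnat (eta t) f) -!comp_assoc.
by congr (_ ∘ _); exact: (tnat (eta p) (fmap T f)).
Qed.

Definition law_monad : monad_data (P ∘F T) :=
  {| mul := @Build_Trans A A ((P ∘F T) ∘F (P ∘F T)) (P ∘F T) law_mul_app law_mul_nat;
     eta := @Build_Trans A A (id_functor A) (P ∘F T) law_eta_app law_eta_nat |}.
End DistributiveLaws.

(* The lift of the monad P defined by a distributive law om sends a module
   (M, r) to (P M, P(r) om_M), and its product and unit at (M, r) are those of P
   at M; likewise for its comonoidal structure when P is a bimonad. *)
Definition is_law_lift (A : Category) (T P : Functor A A) (t : monad_data T)
    (p : monad_data P) (om : Trans (T ∘F P) (P ∘F T)) (l : lift t P)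
    (pl : monad_data (lift_functor l)) : Prop :=
  [/\ forall M : mod_cat t, lact l M = fmap P (act M) ∘ om (car M),
      forall M : mod_cat t, und (mul pl M) = mul p (car M)
    & forall M : mod_cat t, und (eta pl M) = eta p (car M)].

Definition is_law_lift_bimonad (A : MonCat) (T : Bimonad A) (P : Functor A A)
    (p : monad_data P) (cp : comonoidal_data P) (om : Trans (T ∘F P) (P ∘F T))
    (l : lift (bmon T) P) (pl : monad_data (lift_functor l))
    (cl : @comonoidal_data (mod_mon T) (mod_mon T) (lift_functor l)) : Prop :=
  [/\ is_law_lift p om pl, @is_bimonad (mod_mon T) (lift_functor l) pl cl,
      forall M N : mod_mon T, und (co2 cl M N) = co2 cp (car M) (car N)
    & und (co0 cl) = co0 cp].

(* The cross product with T of the lift of P is the composite P T with the monad and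
   comonoidal structures defined by the distributive law; so both presentations of
   the double, as a cross product and as a composite, are the same bimonad. *)
Section CrossLift.
Variables (A : MonCat) (T : Bimonad A) (P : Functor A A).
Variables (p : monad_data P) (cp : comonoidal_data P) (om : Trans (T ∘F P) (P ∘F T)).
Variables (l : lift (bmon T) P) (pl : monad_data (lift_functor l)).
Variable cl : @comonoidal_data (mod_mon T) (mod_mon T) (lift_functor l).
Let F : Functor A (mod_mon T) := free (bim_monad T).

Lemma cross_lift_functor : cross (T := T) (lift_functor l) = P ∘F T.
Proof. by rewrite /cross /comp_functor /=; congr Build_Functor; exact: proof_irrelevance. Qed.

Lemma cross_lift_monad (X : A) : is_law_lift p om pl ->
  cross_mul_app (T := T) pl X = law_mul_app (bmon T) p om X
  /\ cross_eta_app (T := T) pl X = law_eta_app (bmon T) p X.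
Proof.
move=> [Ha Hm He]; rewrite /cross_mul_app /law_mul_app /law_eta_app.
split; last by congr (_ ∘ _); exact: (He (F X)).
rewrite comp_assoc -fmap_comp.
change (und (mul pl (F X)) ∘ fmap P (lact l (F X))
        = mul p (T X) ∘ fmap P (fmap P (act (F X)) ∘ om (T X))).
by rewrite Ha; congr (_ ∘ _); exact: (Hm (F X)).
Qed.

Lemma cross_lift_com : is_law_lift_bimonad p cp om pl cl ->
  (forall X Y : A, cross_co2 (T := T) cl X Y = comp_co2 cp (bcom T) X Y)
  /\ co0 (cross_com (T := T) cl) = co0 (comp_comonoidal cp (bcom T)).
Proof.
move=> [_ _ H2 H0]; split=> [X Y|].
- rewrite /cross_co2 /comp_co2.
  change (und (co2 cl (F X) (F Y)) ∘ fmap P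
    (((act (F X) ⊠ act (F Y)) ∘ co2 (bcom T) (T X) (T Y))
       ∘ fmap T (eta (bmon T) X ⊠ eta (bmon T) Y))
    = co2 cp (T X) (T Y) ∘ fmap P (co2 (bcom T) X Y)).
  rewrite comp_assoc co2_nat -comp_assoc -tenm_comp.
  have [_ E _] := bim_monad T.
  rewrite /= !E tenm_id comp_idl; congr (_ ∘ _); exact: (H2 (F X) (F Y)).
- change (und (co0 cl) ∘ fmap P (co0 (bcom T)) = co0 cp ∘ fmap P (co0 (bcom T))).
  by rewrite H0.
Qed.
End CrossLift.

(* Main.v *)
(** The universal morphism of a centralizer turns an action of Z on M into
    a half-braiding sg : M ⊗ Y → P Y ⊗ M, and equations between morphisms out of iterated
    values of Z are checked on universal morphisms, whose tails cancel because objects have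
    duals; this makes the centralizer of a bimonad a bimonad. When P is a Hopf monad, the
    right antipode of P makes sg convolution invertible and the inverse transports along
    the left dual of M; dually, the left antipode gives the half-braiding on the right dual.
    A bimonad has antipodes as soon as the duals of its free modules carry actions for
    which evaluation and coevaluation are linear, so the centralizer is a Hopf monad, and
    so is a cross product of Hopf monads, whose free modules are free over the lift.
    All this is applied to Q on the category of T-modules. As d M Y is recovered from the
    lifted universal morphism at the free module on Y, the lifted comonoidal structure is
    that of Z, and Om_X = act(Z (F X)) ∘ T (Z eta_X) is comonoidal because the lifted
    structure is T-linear. *)

Require Import Defs.
From Stdlib Require Import ssreflect ssrfun ssrbool.
From Stdlib Require Import ProofIrrelevance FunctionalExtensionality IndefiniteDescription.

Set Implicit Arguments.
Unset Strict Implicit.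
Unset Printing Implicit Defensive.

Local Notation "X ◁ f" := (idm X ⊠ f) (at level 35, right associativity).
Local Notation "f ▷ V" := (f ⊠ idm V) (at level 35, right associativity).

(** * Tensoring with a tail *)

Section Calculus.
Variable A : MonCat.
Implicit Types U V W X Y : A.

(** Whiskered forms of an equation, shaped to be passed to [re1] and [re2], so that it can be
    rewritten under a tensor product in the middle of a composite. *)
Lemma wl1 X (Y1 Y2 Y3 : A) (f : hom Y2 Y3) (g : hom Y1 Y2) (h : hom Y1 Y3) :
  f ∘ g = h -> (X ◁ f) ∘ (X ◁ g) = X ◁ h.
Proof. by move=> <-; rewrite tenl_comp. Qed.

Lemma wl2 X (Y1 Y2 Y2' Y3 : A) (f : hom Y2 Y3) (g : hom Y1 Y2) (f' : hom Y2' Y3)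
    (g' : hom Y1 Y2') :
  f ∘ g = f' ∘ g' -> (X ◁ f) ∘ (X ◁ g) = (X ◁ f') ∘ (X ◁ g').
Proof. by move=> E; rewrite -!tenl_comp E. Qed.

Lemma wr1 X (Y1 Y2 Y3 : A) (f : hom Y2 Y3) (g : hom Y1 Y2) (h : hom Y1 Y3) :
  f ∘ g = h -> (f ▷ X) ∘ (g ▷ X) = h ▷ X.
Proof. by move=> <-; rewrite tenr_comp. Qed.

Lemma wr2 X (Y1 Y2 Y2' Y3 : A) (f : hom Y2 Y3) (g : hom Y1 Y2) (f' : hom Y2' Y3)
    (g' : hom Y1 Y2') :
  f ∘ g = f' ∘ g' -> (f ▷ X) ∘ (g ▷ X) = (f' ▷ X) ∘ (g' ▷ X).
Proof. by move=> E; rewrite -!tenr_comp E. Qed.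

Lemma ten_lr (X X' Y Y' : A) (f : hom X X') (g : hom Y Y') :
  f ⊠ g = (X' ◁ g) ∘ (f ▷ Y).
Proof. by rewrite -tenm_comp comp_idl comp_idr. Qed.

Lemma ten_rl (X X' Y Y' : A) (f : hom X X') (g : hom Y Y') :
  f ⊠ g = (f ▷ Y') ∘ (X ◁ g).
Proof. by rewrite -tenm_comp comp_idl comp_idr. Qed.

(* Every morphism is tensored with an arbitrary tail V and rebracketed to the right, as
   in [out], [tail], [cap] and [cup] below; string diagrams then compose without
   associators, by naturality in V and interchange alone. They are locked because
   ssreflect matching would otherwise unfold them when rewriting with [comp_assoc]. *)
Definition out W X Y (f : hom W (X ⊗ Y)) V : hom (W ⊗ V) (X ⊗ Y ⊗ V) :=
  locked (asc X Y V ∘ (f ▷ V)).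

Lemma outE W X Y (f : hom W (X ⊗ Y)) V : out f V = asc X Y V ∘ (f ▷ V).
Proof. by rewrite /out -lock. Qed.

Lemma out_nat W X Y (f : hom W (X ⊗ Y)) V V' (k : hom V V') :
  out f V' ∘ (W ◁ k) = (X ◁ Y ◁ k) ∘ out f V.
Proof.
rewrite !outE comp_assoc ten_swap -(comp_assoc (X ◁ Y ◁ k)) -asc_nat tenm_id.
by rewrite comp_assoc.
Qed.

Lemma out_pre W' W X Y (f : hom W (X ⊗ Y)) (g : hom W' W) V :
  out (f ∘ g) V = out f V ∘ (g ▷ V).
Proof. by rewrite !outE tenr_comp comp_assoc. Qed.

Lemma out_post W X Y X' Y' (f : hom W (X ⊗ Y)) (g : hom X X') (h : hom Y Y') V :
  out ((g ⊠ h) ∘ f) V = (g ⊠ (h ▷ V)) ∘ out f V.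
Proof. by rewrite !outE tenr_comp -comp_assoc asc_nat comp_assoc. Qed.

(** The tail [𝟙] already detects equality: [asc] is invertible and tensoring with the unit object is
    faithful. *)
Lemma out_inj W X Y (f g : hom W (X ⊗ Y)) : out f 𝟙 = out g 𝟙 -> f = g.
Proof.
by rewrite !outE => E; apply: unit_faithr; exact: (iso_mono (ascK _ _ _) E).
Qed.

Lemma out_asc W X Y Z (f : hom W ((X ⊗ Y) ⊗ Z)) V :
  (X ◁ asc Y Z V) ∘ out (asc X Y Z ∘ f) V = asc X Y (Z ⊗ V) ∘ out f V.
Proof. by rewrite !outE tenr_comp -!comp_assoc -pentagon !comp_assoc. Qed.

Lemma asc_pentagon X Y Z V :
  asc X (Y ⊗ Z) V ∘ (asc X Y Z ▷ V)
  = (X ◁ ascV Y Z V) ∘ (asc X Y (Z ⊗ V) ∘ asc (X ⊗ Y) Z V).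
Proof.
by rewrite -pentagon -comp_assoc -tenl_comp ascK tenm_id comp_idl.
Qed.

Definition tail X Y X' Y' (f : hom (X ⊗ Y) (X' ⊗ Y')) V :
  hom (X ⊗ Y ⊗ V) (X' ⊗ Y' ⊗ V) :=
  locked (out f V ∘ ascV X Y V).

Lemma tailE X Y X' Y' (f : hom (X ⊗ Y) (X' ⊗ Y')) V :
  tail f V = out f V ∘ ascV X Y V.
Proof. by rewrite /tail -lock. Qed.

Lemma tail_asc X Y X' Y' (f : hom (X ⊗ Y) (X' ⊗ Y')) V :
  tail f V ∘ asc X Y V = out f V.
Proof. by rewrite !tailE comp_assoc ascK comp_idr. Qed.

Lemma tail_nat X Y X' Y' (f : hom (X ⊗ Y) (X' ⊗ Y')) V V' (k : hom V V') :
  tail f V' ∘ (X ◁ Y ◁ k) = (X' ◁ Y' ◁ k) ∘ tail f V.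
Proof.
by rewrite !tailE comp_assoc ascV_nat -comp_assoc tenm_id out_nat comp_assoc.
Qed.

Lemma tail_inj X Y X' Y' (f g : hom (X ⊗ Y) (X' ⊗ Y')) :
  tail f 𝟙 = tail g 𝟙 -> f = g.
Proof.
by move=> E; apply: out_inj; rewrite -!tail_asc E.
Qed.

Lemma tail_pre X Y X' Y' X0 Y0 (f : hom (X ⊗ Y) (X' ⊗ Y')) (g : hom X0 X)
    (h : hom Y0 Y) V :
  tail (f ∘ (g ⊠ h)) V = tail f V ∘ (g ⊠ (h ▷ V)).
Proof.
by rewrite !tailE out_pre !comp_assoc ascV_nat.
Qed.

Lemma tail_post X Y X' Y' X0 Y0 (f : hom (X ⊗ Y) (X' ⊗ Y')) (g : hom X' X0)
    (h : hom Y' Y0) V :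
  tail ((g ⊠ h) ∘ f) V = (g ⊠ (h ▷ V)) ∘ tail f V.
Proof. by rewrite !tailE out_post !comp_assoc. Qed.

Definition cap X Y (e : hom (X ⊗ Y) 𝟙) V : hom (X ⊗ Y ⊗ V) V :=
  locked (lun V ∘ ((e ▷ V) ∘ ascV X Y V)).

Lemma capE X Y (e : hom (X ⊗ Y) 𝟙) V : cap e V = lun V ∘ ((e ▷ V) ∘ ascV X Y V).
Proof. by rewrite /cap -lock. Qed.

Definition cup X Y (c : hom 𝟙 (X ⊗ Y)) V : hom V (X ⊗ Y ⊗ V) :=
  locked (out c V ∘ lunV V).

Lemma cupE X Y (c : hom 𝟙 (X ⊗ Y)) V : cup c V = out c V ∘ lunV V.
Proof. by rewrite /cup -lock. Qed.

Lemma cap_asc X Y (e : hom (X ⊗ Y) 𝟙) V :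
  cap e V ∘ asc X Y V = lun V ∘ (e ▷ V).
Proof. by rewrite !capE !comp_assoc ascK comp_idr. Qed.

Lemma cap_nat X Y (e : hom (X ⊗ Y) 𝟙) V V' (k : hom V V') :
  cap e V' ∘ (X ◁ Y ◁ k) = k ∘ cap e V.
Proof.
rewrite !capE !comp_assoc ascV_nat tenm_id (re2 (ten_swap _ _)).
by rewrite (re2 (lun_nat _)).
Qed.

Lemma cup_nat X Y (c : hom 𝟙 (X ⊗ Y)) V V' (k : hom V V') :
  cup c V' ∘ k = (X ◁ Y ◁ k) ∘ cup c V.
Proof. by rewrite !cupE comp_assoc lunV_nat (re2 (out_nat _ _)). Qed.

Lemma cap_pre X Y X0 Y0 (e : hom (X ⊗ Y) 𝟙) (g : hom X0 X) (h : hom Y0 Y) V :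
  cap (e ∘ (g ⊠ h)) V = cap e V ∘ (g ⊠ (h ▷ V)).
Proof. by rewrite !capE tenr_comp !comp_assoc ascV_nat. Qed.

Lemma cup_post X Y X' Y' (c : hom 𝟙 (X ⊗ Y)) (g : hom X X') (h : hom Y Y') V :
  cup ((g ⊠ h) ∘ c) V = (g ⊠ (h ▷ V)) ∘ cup c V.
Proof. by rewrite !cupE out_post comp_assoc. Qed.

Lemma asc_lunV X V : asc 𝟙 X V ∘ (lunV X ▷ V) = lunV (X ⊗ V).
Proof.
apply: (iso_mono (lunK _)).
by rewrite (re1 (kelly_lun _ _)) -tenr_comp !lunVK tenm_id.
Qed.

Lemma ascV_runV Y V : ascV Y 𝟙 V ∘ (Y ◁ lunV V) = runV Y ▷ V.
Proof.
apply: (iso_mono (ascK _ _ _)); rewrite (re0 (ascVK _ _ _)).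
have I : (Y ◁ lunV V) ∘ (Y ◁ lun V) = idm _ by rewrite -tenl_comp lunK tenm_id.
apply: (iso_mono (f := Y ◁ lun V) I).
by rewrite (re1 (triangle _ _)) -tenr_comp runVK -tenl_comp lunVK !tenm_id.
Qed.

(** The snake identities with a tail are stated for bare morphisms [e] and [c], so that this one
    serves left duals ([lzig]) and [cap_cup_zag] serves right duals ([rzig]). *)
Lemma cap_cup_zig X Y (e : hom (Y ⊗ X) 𝟙) (c : hom 𝟙 (X ⊗ Y)) V :
  run X ∘ (X ◁ e) ∘ asc X Y X ∘ (c ▷ X) ∘ lunV X = idm X ->
  (X ◁ cap e V) ∘ cup c (X ⊗ V) = idm (X ⊗ V).
Proof.
move=> E; rewrite -[RHS]tenm_id -[in RHS]E capE cupE outE !tenl_comp !tenr_comp !comp_assoc.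
rewrite -asc_lunV -tenm_id -(re2 (asc_nat c _ _)).
have P : (X ◁ ascV Y X V) ∘ (asc X Y (X ⊗ V) ∘ asc (X ⊗ Y) X V)
   = asc X (Y ⊗ X) V ∘ (asc X Y X ▷ V) by rewrite asc_pentagon.
rewrite (re3 P) !comp_assoc -(re2 (asc_nat _ _ _)).
by rewrite (re1 (triangle _ _)).
Qed.

Lemma cap_cup_zag X Y (e : hom (Y ⊗ X) 𝟙) (c : hom 𝟙 (X ⊗ Y)) V :
  lun Y ∘ (e ▷ Y) ∘ ascV Y X Y ∘ (Y ◁ c) ∘ runV Y = idm Y ->
  cap e (Y ⊗ V) ∘ (Y ◁ cup c V) = idm (Y ⊗ V).
Proof.
move=> E; rewrite -[RHS]tenm_id -[in RHS]E capE cupE outE !tenl_comp !tenr_comp !comp_assoc.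
rewrite -ascV_runV -(re2 (ascV_nat _ _ _)).
have P : ascV Y X (Y ⊗ V) ∘ (Y ◁ asc X Y V)
   = asc (Y ⊗ X) Y V ∘ ((ascV Y X Y ▷ V) ∘ ascV Y (X ⊗ Y) V).
  apply: (iso_mono (ascK _ _ _)); rewrite (re0 (ascVK _ _ _)).
  rewrite -(re2 (pentagon _ _ _ _)) comp_assoc.
  rewrite (re1 (wr1 _ (ascVK _ _ _))) tenm_id comp_idl.
  by rewrite ascVK comp_idr.
rewrite (re2 P) !comp_assoc -tenm_id -(re2 (asc_nat _ _ _)).
by rewrite (re1 (kelly_lun _ _)).
Qed.

Lemma ten_one_inj X Y (f g : hom X Y) :
  (forall V, f ▷ V = g ▷ V) -> f = g.
Proof. by move=> E; exact: unit_faithr. Qed.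
End Calculus.

(** * Antipodes from actions on the duals of free modules *)

Section LinearMaps.
Variables (A : MonCat) (K : Functor A A) (c : comonoidal_data K).
Hypothesis Hc : is_comonoidal c.

(** Phrased for bare morphisms [K X → X], so that it applies to candidate actions built directly on
    an object, such as the dual of a free module. *)
Definition lin (X Y : A) (r : hom (K X) X) (s : hom (K Y) Y) (f : hom X Y) : Prop :=
  f ∘ r = s ∘ fmap K f.

Definition act2 (X Y : A) (r : hom (K X) X) (s : hom (K Y) Y) :
  hom (K (X ⊗ Y)) (X ⊗ Y) := (r ⊠ s) ∘ co2 c X Y.

Lemma lin_comp (X Y W : A) r s u (g : hom Y W) (f : hom X Y) :
  lin s u g -> lin r s f -> lin r u (g ∘ f).
Proof. by rewrite /lin => Hg Hf; rewrite comp_assoc Hf (re2 Hg) fmap_comp. Qed.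

Lemma lin_idm (X : A) (r : hom (K X) X) : lin r r (idm X).
Proof. by rewrite /lin fmap_id comp_idl comp_idr. Qed.

Lemma lin_inv (X Y : A) r s (f : hom X Y) (g : hom Y X) :
  g ∘ f = idm X -> f ∘ g = idm Y -> lin r s f -> lin s r g.
Proof.
rewrite /lin => gf fg Hf; apply: (iso_mono gf); rewrite (re0 fg) (re2 Hf).
by rewrite -fmap_comp fg fmap_id comp_idr.
Qed.

Lemma lin_ten (X X' Y Y' : A) r r' s s' (f : hom X X') (g : hom Y Y') :
  lin r r' f -> lin s s' g -> lin (act2 r s) (act2 r' s') (f ⊠ g).
Proof.
rewrite /lin /act2 => Hf Hg.
by rewrite comp_assoc co2_nat -!comp_assoc -!tenm_comp Hf Hg.
Qed.

Lemma lin_asc (X Y W : A) (r : hom (K X) X) (s : hom (K Y) Y) (u : hom (K W) W) :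
  lin (act2 (act2 r s) u) (act2 r (act2 s u)) (asc X Y W).
Proof.
have [aK _ _] := Hc; rewrite /lin /act2.
have E := aK X Y W; rewrite !comp_assoc in E.
rewrite -{1}[u]comp_idr -{2}[r]comp_idr !tenm_comp !comp_assoc -E.
by rewrite (re2 (asc_nat _ _ _)).
Qed.

Lemma lin_lun (X : A) (r : hom (K X) X) : lin (act2 (co0 c) r) r (lun X).
Proof.
have [_ lK _] := Hc; rewrite /lin /act2 -lK ten_lr !comp_assoc.
by rewrite (re2 (lun_nat _)).
Qed.

Lemma lin_run (X : A) (r : hom (K X) X) : lin (act2 r (co0 c)) r (run X).
Proof.
have [_ _ rK] := Hc; rewrite /lin /act2 -rK ten_rl !comp_assoc.
by rewrite (re2 (run_nat _)).
Qed.

(** The dual of [f] is a composite of [coev X'], [f], [ev Y'] and monoidal constraints. Each of them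
    is linear, and linear morphisms are closed under composition and tensor product. *)
Lemma lin_ldm (X Y : A) (X' : left_dual X) (Y' : left_dual Y) (r : hom (K X) X)
    (r' : hom (K X') X') (s : hom (K Y) Y) (s' : hom (K Y') Y') (f : hom X Y) :
  lin (co0 c) (act2 r r') (coev X') -> lin (act2 s' s) (co0 c) (ev Y') ->
  lin r s f -> lin s' r' (ldm X' Y' f).
Proof.
move=> Hcoev Hev Hf; rewrite /ldm.
apply: (lin_comp (s := act2 s' (co0 c))); last first.
  exact: lin_inv (runK _) (runVK _) (lin_run _).
apply: (lin_comp (s := act2 s' (act2 s r'))); last first.
  apply: lin_ten; first exact: lin_idm.
  by apply: lin_comp Hcoev; apply: lin_ten => //; exact: lin_idm.
apply: (lin_comp (s := act2 (act2 s' s) r')); last first.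
  exact: lin_inv (ascK _ _ _) (ascVK _ _ _) (lin_asc _ _ _).
apply: lin_comp (lin_lun _) _.
by apply: lin_ten => //; exact: lin_idm.
Qed.
End LinearMaps.

(* Only free modules occur: for the cross product of Q and T, a general module need not
   come from a module over Q, since a composite of monadic functors may fail to be
   monadic. *)
Section AntipodeOfDualActions.
Variables (A : MonCat) (K : Functor A A) (k : monad_data K) (c : comonoidal_data K).
Hypothesis Hb : is_bimonad k c.
Variable L : forall X : A, left_dual X.
Variable al : forall X : A, hom (K (L (K X))) (L (K X)).
Hypothesis al_ev : forall X : A,
  lin (act2 c (al X) (mul k X)) (co0 c) (ev (L (K X))).
Hypothesis al_coev : forall X : A,
  lin (co0 c) (act2 c (mul k X) (al X)) (coev (L (K X))).

Let k_mul (X : A) : mul k X ∘ fmap K (mul k X) = mul k X ∘ mul k (K X).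
Proof. by case: Hb => [[]]. Qed.
Let k_eta (X : A) : mul k X ∘ fmap K (eta k X) = idm (K X).
Proof. by case: Hb => [[]]. Qed.
Let c_com : is_comonoidal c. Proof. by case: Hb. Qed.

Lemma al_ldm (X Y : A) (f : hom (K X) (K Y)) :
  lin (K := K) (X := K X) (mul k X) (mul k Y) f ->
  al X ∘ fmap K (ldm (L (K X)) (L (K Y)) f) = ldm (L (K X)) (L (K Y)) f ∘ al Y.
Proof. by move=> Hf; rewrite (lin_ldm c_com (al_coev X) (al_ev Y) Hf). Qed.

(** For a Hopf monad this formula recovers the antipode from the action on the dual of a free
    module. *)
Definition ant (X : A) : hom (K (L (K X))) (L X) :=
  ldm (L X) (L (K X)) (eta k X) ∘ al X.

Lemma ant_nat (X Y : A) (f : hom X Y) :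
  ant X ∘ fmap K (ldm (L (K X)) (L (K Y)) (fmap K f)) = ldm (L X) (L Y) f ∘ ant Y.
Proof.
rewrite /ant comp_assoc al_ldm; first by rewrite /lin; symmetry; exact: (tnat (mul k) f).
apply: re2; rewrite -!ldm_comp; congr ldm.
by symmetry; exact: (tnat (eta k) f).
Qed.

(** The product [mul k X] is linear between free modules, so its dual slides past the actions by
    [al_ldm] and is then cancelled by the dual of the unit. Hence the action induced by [ant] is the
    given [al], which brings the evaluation axiom back to [al_ev]. *)
Lemma ant_mul (X : A) :
  ant (K X) ∘ fmap K (ldm (L (K (K X))) (L (K X)) (mul k X)) = al X.
Proof.
rewrite /ant comp_assoc al_ldm; first by rewrite /lin k_mul.
have [[_ _ E] _ _ _] := Hb.
by rewrite -comp_assoc -ldm_comp E ldm_id comp_idl.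
Qed.

Lemma ant_ev (X : A) :
  co0 c ∘ fmap K (ev (L X)) ∘ fmap K (ldm (L X) (L (K X)) (eta k X) ⊠ idm X)
  = ev (L (K X))
    ∘ ((ant (K X) ∘ fmap K (ldm (L (K (K X))) (L (K X)) (mul k X))) ⊠ idm (K X))
    ∘ co2 c (L (K X)) X.
Proof.
rewrite ant_mul comp_assoc -fmap_comp ev_ldm fmap_comp -comp_assoc -al_ev /act2.
by rewrite !comp_assoc co2_nat fmap_id (re1 (esym (tenm_comp _ _ _ _))) k_eta comp_idr.
Qed.

Lemma ant_coev (X : A) :
  (eta k X ⊠ idm (L X)) ∘ coev (L X) ∘ co0 c
  = (mul k X ⊠ ant X) ∘ co2 c (K X) (L (K X)) ∘ fmap K (coev (L (K X))).
Proof.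
rewrite -(coev_ldm (L X) (L (K X))) comp_assoc al_coev /act2 -!comp_assoc.
by rewrite -tenm_comp comp_idl.
Qed.

Definition dual_left_antipode : left_antipode L k c :=
  {| lant := ant; lant_nat := ant_nat; lant_ev := ant_ev; lant_coev := ant_coev |}.
End AntipodeOfDualActions.

(** For the opposite tensor product, right duals are left duals and a right antipode is a left
    antipode. *)
Lemma dual_right_antipode (A : MonCat) (K : Functor A A) (k : monad_data K)
    (c : comonoidal_data K) (Hb : is_bimonad k c) (R : forall X : A, right_dual X)
    (al : forall X : A, hom (K (R (K X))) (R (K X))) :
  (forall X : A, lin (act2 c (mul k X) (al X)) (co0 c) (evr (R (K X)))) ->
  (forall X : A, lin (co0 c) (act2 c (al X) (mul k X)) (coevr (R (K X)))) ->
  right_antipode R k c.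
Proof.
move=> Hev Hcoev; pose B := Build_Bimonad Hb.
pose s := @dual_left_antipode (rev A) K k (rev_com B) (rev_bimonadP B)
  (fun X => rev_dual (R X)) al Hev Hcoev.
exact: (@Build_right_antipode A R K k c (lant s) (lant_nat s) (lant_ev s) (lant_coev s)).
Qed.

(** * Cross products *)

Section FreeComonoidal.
Variables (A : MonCat) (T : Bimonad A).
Let U : Functor (mod_mon T) A := forget (bmon T).
Let F : Functor A (mod_mon T) := free (bim_monad T).
Let eps : Trans (F ∘F U) (id_functor (mod_mon T)) := counit (bim_monad T).

(** The comonoidal structure of the free functor. It is also the factor under [Q] in [cross_co2], so
    a cross product is a composite of comonoidal functors whose last factor, the forgetful functor,
    is strict. *)
Definition free_co2 (X Y : A) : hom (F (X ⊗ Y)) (F X ⊗ F Y) :=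
  eps (F X ⊗ F Y) ∘ fmap F (eta (bmon T) X ⊠ eta (bmon T) Y).

Lemma und_free_co2 (X Y : A) : und (free_co2 X Y) = co2 (bcom T) X Y.
Proof.
change (((mul (bmon T) X ⊠ mul (bmon T) Y) ∘ co2 (bcom T) (T X) (T Y))
  ∘ fmap T (eta (bmon T) X ⊠ eta (bmon T) Y) = co2 (bcom T) X Y).
have [_ E _] := bim_monad T.
rewrite comp_assoc co2_nat -comp_assoc -tenm_comp.
by rewrite /= !E tenm_id comp_idl.
Qed.

Lemma free_co2_nat (X X' Y Y' : A) (f : hom X X') (g : hom Y Y') :
  free_co2 X' Y' ∘ fmap F (f ⊠ g) = (fmap F f ⊠ fmap F g) ∘ free_co2 X Y.
Proof.
apply: linear_eq; rewrite /= -!/(free_co2 _ _).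
change (und (free_co2 X' Y') ∘ fmap T (f ⊠ g)
  = (fmap T f ⊠ fmap T g) ∘ und (free_co2 X Y)).
by rewrite !und_free_co2 co2_nat.
Qed.

Definition free_com : comonoidal_data F :=
  @Build_comonoidal_data A (mod_mon T) F free_co2 (eps 𝟙) free_co2_nat.

Lemma free_is_comonoidal : is_comonoidal free_com.
Proof.
have [aT lT rT] := bim_com T.
split=> [X Y Z|X|X]; apply: linear_eq.
- change (asc (T X) (T Y) (T Z) ∘ (und (free_co2 X Y) ⊠ idm (T Z)) ∘ und (free_co2 (X ⊗ Y) Z)
    = (idm (T X) ⊠ und (free_co2 Y Z)) ∘ und (free_co2 X (Y ⊗ Z)) ∘ fmap T (asc X Y Z)).
  by rewrite !und_free_co2 aT.
- change (lun (T X) ∘ (co0 (bcom T) ⊠ idm (T X)) ∘ und (free_co2 𝟙 X) = fmap T (lun X)).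
  by rewrite und_free_co2 lT.
- change (run (T X) ∘ (idm (T X) ⊠ co0 (bcom T)) ∘ und (free_co2 X 𝟙) = fmap T (run X)).
  by rewrite und_free_co2 rT.
Qed.

(** Comonoidality of the counit of the adjunction. It makes [cross_act] compatible with tensor
    products and the product of the cross product comonoidal. *)
Lemma counit_free_co2 (M N : mod_mon T) :
  (eps M ⊠ eps N) ∘ free_co2 (U M) (U N) = eps (M ⊗ N).
Proof.
apply: linear_eq.
change ((act M ⊠ act N) ∘ und (free_co2 (car M) (car N)) = ten_act M N).
by rewrite und_free_co2.
Qed.

Variables (Q : Functor (mod_mon T) (mod_mon T)) (q : monad_data Q) (c : comonoidal_data Q).
Let K : Functor A A := cross Q.

Let eps_nat (M N : mod_mon T) (f : hom M N) :
  eps N ∘ fmap F (fmap U f) = f ∘ eps M.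
Proof. exact: (tnat eps f). Qed.

Let mul_nat (M N : mod_mon T) (f : hom M N) :
  fmap Q f ∘ mul q M = mul q N ∘ fmap Q (fmap Q f).
Proof. by symmetry; exact: (tnat (mul q) f). Qed.

Let eta_nat (M N : mod_mon T) (f : hom M N) : fmap Q f ∘ eta q M = eta q N ∘ f.
Proof. by symmetry; exact: (tnat (eta q) f). Qed.

(** The comparison from modules over [Q] to modules over the cross product. The product [mul] of the
    cross product at [X] is its value at the free [Q]-module on [F X]. *)
Definition cross_act (M : mod_mon T) (w : hom (Q M) M) : hom (K (U M)) (U M) :=
  fmap U (w ∘ fmap Q (eps M)).

Lemma cross_lin (M N : mod_mon T) (w : hom (Q M) M) (w' : hom (Q N) N) (f : hom M N) :
  lin w w' f -> lin (K := K) (cross_act w) (cross_act w') (fmap U f).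
Proof.
move=> H.
have E : f ∘ (w ∘ fmap Q (eps M)) = (w' ∘ fmap Q (eps N)) ∘ fmap Q (fmap F (fmap U f)).
  rewrite (re2 H) comp_assoc -!fmap_comp; congr (_ ∘ fmap Q _).
  by symmetry; exact: (tnat eps f).
exact: (f_equal (@fmap _ _ U _ _) E).
Qed.

Lemma cross_act2 (M N : mod_mon T) (w : hom (Q M) M) (w' : hom (Q N) N) :
  cross_act (act2 c w w') = act2 (cross_com c) (cross_act w) (cross_act w').
Proof.
have E : ((w ⊠ w') ∘ co2 c M N) ∘ fmap Q (eps (M ⊗ N))
  = ((w ∘ fmap Q (eps M)) ⊠ (w' ∘ fmap Q (eps N)))
    ∘ (co2 c (F (U M)) (F (U N)) ∘ fmap Q (free_co2 (U M) (U N))).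
  rewrite -counit_free_co2 fmap_comp tenm_comp !comp_assoc; congr (_ ∘ _).
  by rewrite (re2 (co2_nat c _ _)).
exact: (f_equal (@fmap _ _ U _ _) E).
Qed.

(** The forgetful functor is strict monoidal, so the axioms are the images under [U] of those of [Q]
    composed with the free functor. *)
Lemma cross_is_comonoidal : is_comonoidal c -> is_comonoidal (cross_com c).
Proof.
move=> Hc; have [a l r] := comp_is_comonoidal Hc free_is_comonoidal.
split=> [X Y Z|X|X].
- exact: (f_equal (@fmap _ _ U _ _) (a X Y Z)).
- exact: (f_equal (@fmap _ _ U _ _) (l X)).
- exact: (f_equal (@fmap _ _ U _ _) (r X)).
Qed.

Lemma cross_is_monad : is_monad q -> is_monad (cross_monad q).
Proof.
move=> [qa ql qr]; split=> X.
(* The equation is proved between [T]-linear morphisms, where naturality of [eps] and of [mul q]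
   applies, and is then transported along [U]. *)
- have E : (mul q (F X) ∘ fmap Q (eps (Q (F X))))
      ∘ fmap Q (fmap F (fmap U (mul q (F X) ∘ fmap Q (eps (Q (F X))))))
    = (mul q (F X) ∘ fmap Q (eps (Q (F X))))
      ∘ (mul q (F (K X)) ∘ fmap Q (eps (Q (F (K X))))).
    rewrite comp_assoc -(fmap_comp Q) eps_nat !fmap_comp !comp_assoc (re2 (mul_nat _)).
    exact: (re2 (qa (F X))).
  exact: (f_equal (@fmap _ _ U _ _) E).
- have E : (mul q (F X) ∘ fmap Q (eps (Q (F X))))
      ∘ fmap Q (fmap F (fmap U (eta q (F X)) ∘ eta (bmon T) X)) = idm (Q (F X)).
    rewrite fmap_comp comp_assoc -(fmap_comp Q) -comp_assoc eps_nat.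
    have I : eps (F X) ∘ fmap F (eta (bmon T) X) = idm (F X).
      by apply: linear_eq; have [_ E _] := bim_monad T; exact: E.
    by rewrite comp_assoc I comp_idr; exact: ql.
  exact: (f_equal (@fmap _ _ U _ _) E).
(* The unit of [T] is not a morphism of modules. Only the part with [eta q] is proved among modules;
   what remains is the unit axiom of the module [Q (F X)]. *)
- have E : (mul q (F X) ∘ fmap Q (eps (Q (F X)))) ∘ eta q (F (K X)) = eps (Q (F X)).
    by rewrite comp_assoc eta_nat -comp_assoc qr comp_idl.
  have E' := f_equal (@fmap _ _ U _ _) E.
  rewrite /= /cross_mul_app /cross_eta_app -comp_assoc.
  rewrite [X in X ∘ _](_ : _ = act (Q (F X))); first exact: E'.
  exact: act_eta.
Qed.

Lemma cross_bimonad : is_bimonad q c -> is_bimonad (cross_monad q) (cross_com c).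
Proof.
move=> [Hq Hc [m2 m0] [e2 e0]].
split; [exact: cross_is_monad | exact: cross_is_comonoidal | |].
- split=> [X Y|].
  + have E : (co2 c (F X) (F Y) ∘ fmap Q (free_co2 X Y))
        ∘ (mul q (F (X ⊗ Y)) ∘ fmap Q (eps (Q (F (X ⊗ Y)))))
      = ((mul q (F X) ∘ fmap Q (eps (Q (F X)))) ⊠ (mul q (F Y) ∘ fmap Q (eps (Q (F Y)))))
        ∘ ((co2 c (F (K X)) (F (K Y)) ∘ fmap Q (free_co2 (K X) (K Y)))
           ∘ fmap Q (fmap F (fmap U (co2 c (F X) (F Y) ∘ fmap Q (free_co2 X Y))))).
      rewrite tenm_comp !comp_assoc -(re2 (co2_nat c _ _)) -!fmap_comp.
      rewrite -(comp_assoc (eps _ ⊠ eps _)) (counit_free_co2 (Q (F X)) (Q (F Y))).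
      rewrite (eps_nat (co2 c (F X) (F Y) ∘ fmap Q (free_co2 X Y))).
      rewrite (fmap_comp Q _ (eps _)) (fmap_comp Q (co2 c _ _)) (re2 (mul_nat (free_co2 X Y))).
      have M : co2 c (F X) (F Y) ∘ mul q (F X ⊗ F Y) = (mul q (F X) ⊠ mul q (F Y))
        ∘ (co2 c (Q (F X)) (Q (F Y)) ∘ fmap Q (co2 c (F X) (F Y))) := m2 (F X) (F Y).
      rewrite -!comp_assoc in M.
      by rewrite -!comp_assoc M.
    exact: (f_equal (@fmap _ _ U _ _) E).
  + have E : (co0 c ∘ fmap Q (eps 𝟙)) ∘ (mul q (F 𝟙) ∘ fmap Q (eps (Q (F 𝟙))))
      = (co0 c ∘ fmap Q (eps 𝟙)) ∘ fmap Q (fmap F (fmap U (co0 c ∘ fmap Q (eps 𝟙)))).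
      rewrite !comp_assoc -fmap_comp (eps_nat (co0 c ∘ fmap Q (eps 𝟙))) !fmap_comp.
      rewrite (re2 (mul_nat (eps 𝟙))).
      have M : co0 c ∘ mul q 𝟙 = co0 c ∘ fmap Q (co0 c) := m0.
      by rewrite -!comp_assoc M.
    exact: (f_equal (@fmap _ _ U _ _) E).
- split=> [X Y|].
  + have E : (co2 c (F X) (F Y) ∘ fmap Q (free_co2 X Y)) ∘ eta q (F (X ⊗ Y))
      = (eta q (F X) ⊠ eta q (F Y)) ∘ free_co2 X Y.
      by rewrite comp_assoc eta_nat -comp_assoc e2 comp_idr.
    have E' := f_equal (@fmap _ _ U _ _) E.
    rewrite /= comp_idr /cross_eta_app -comp_assoc tenm_comp -bim_eta2 -und_free_co2.
    by rewrite -comp_assoc; congr (_ ∘ _); exact: E'.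
  + have E : (co0 c ∘ fmap Q (eps 𝟙)) ∘ eta q (F 𝟙) = eps 𝟙.
      by rewrite comp_assoc eta_nat -comp_assoc e0 comp_idl.
    have E' := f_equal (@fmap _ _ U _ _) E.
    rewrite /= /cross_eta_app -comp_assoc -(bim_eta0 T).
    by congr (_ ∘ _); exact: E'.
Qed.
End FreeComonoidal.

Section DualLinear.
Variables (A : MonCat) (T : Bimonad A).

Lemma ldual_ev_lin (L : forall X : A, left_dual X)
    (s : left_antipode L (bmon T) (bcom T)) (M : mod_mon T) :
  lin (act2 (bcom T) (ldual_act s M) (act M)) (co0 (bcom T)) (ev (L (car M))).
Proof. exact: (ldual_ev s M). Qed.

Lemma ldual_coev_lin (L : forall X : A, left_dual X)
    (s : left_antipode L (bmon T) (bcom T)) (M : mod_mon T) :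
  lin (co0 (bcom T)) (act2 (bcom T) (act M) (ldual_act s M)) (coev (L (car M))).
Proof. exact: (coev_und_act s M). Qed.

Lemma rdual_ev_lin (R : forall X : A, right_dual X)
    (s : right_antipode R (bmon T) (bcom T)) (M : mod_mon T) :
  lin (act2 (bcom T) (act M) (rdual_act s M)) (co0 (bcom T)) (evr (R (car M))).
Proof. exact: (evr_und_act s M). Qed.

Lemma rdual_coev_lin (R : forall X : A, right_dual X)
    (s : right_antipode R (bmon T) (bcom T)) (M : mod_mon T) :
  lin (co0 (bcom T)) (act2 (bcom T) (rdual_act s M) (act M)) (coevr (R (car M))).
Proof. exact: (coevr_und_act s M). Qed.
End DualLinear.

(** * Antipodes of a cross product *)

Section CrossHopf.
Variables (A : MonCat) (D : Autonomous A) (T : HopfMonad D).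
Variables (Q : Functor (mod_mon T) (mod_mon T)) (q : monad_data Q) (c : comonoidal_data Q).

Lemma cross_hopf_monad : is_hopf_monad (mod_autonomous T) q c ->
  is_hopf_monad D (cross_monad q) (cross_com c).
Proof.
move=> [Hb [sl] [sr]]; have HB := cross_bimonad Hb.
pose B := Build_Bimonad Hb.
(* A free module over the cross product comes from the free [Q]-module on a free [T]-module. Duals
   of [T]-modules have the duals in [A] as underlying objects, so [cross_act] carries the dual
   [Q]-actions to the required ones. *)
pose M X : mod_mon B := free (bim_monad B) (free (bim_monad T) X).
split=> //; constructor.
- apply: (dual_left_antipode HB (al := fun X => cross_act (ldual_act (T := B) sl (M X)))) => X.
  + by have := cross_lin (ldual_ev_lin (T := B) sl (M X)); rewrite cross_act2; exact.
  + by have := cross_lin (ldual_coev_lin (T := B) sl (M X)); rewrite cross_act2; exact.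
- apply: (dual_right_antipode HB (al := fun X => cross_act (rdual_act (T := B) sr (M X)))) => X.
  + by have := cross_lin (rdual_ev_lin (T := B) sr (M X)); rewrite cross_act2; exact.
  + by have := cross_lin (rdual_coev_lin (T := B) sr (M X)); rewrite cross_act2; exact.
Qed.
End CrossHopf.

(** * Cancelling the universal morphism of a centralizer *)

Lemma re4 (A : Category) (X Y Z V W : A) (f : hom V W) (g : hom Z V) (h : hom Y Z)
    (i : hom X Y) (l : hom X W) :
  f ∘ (g ∘ (h ∘ i)) = l ->
  forall (U : A) (k : hom U X), f ∘ (g ∘ (h ∘ (i ∘ k))) = l ∘ k.
Proof. by move=> E U k; rewrite -E !comp_assoc. Qed.

Section Discard.
Variable A : MonCat.
Implicit Types V W X Y : A.

Lemma wl3 X (Y1 Y2 Y3 Y4 : A) (f : hom Y3 Y4) (g : hom Y2 Y3) (h : hom Y1 Y2)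
    (l : hom Y1 Y4) :
  f ∘ (g ∘ h) = l -> (X ◁ f) ∘ ((X ◁ g) ∘ (X ◁ h)) = X ◁ l.
Proof. by move=> <-; rewrite !tenl_comp. Qed.

Lemma asc_nat3 X Y V V' (k : hom V V') :
  asc X Y V' ∘ ((X ⊗ Y) ◁ k) = (X ◁ Y ◁ k) ∘ asc X Y V.
Proof. by rewrite -asc_nat tenm_id. Qed.

Lemma ascV_pentagon X Y W V :
  (asc X Y W ▷ V) ∘ (ascV (X ⊗ Y) W V ∘ ascV X Y (W ⊗ V))
  = ascV X (Y ⊗ W) V ∘ (X ◁ ascV Y W V).
Proof. by rewrite -rev_pentagon (re1 (wr1 _ (ascVK _ _ _))) tenm_id comp_idl. Qed.

Lemma out_outl W W' X Y U (f : hom W' (X ⊗ Y)) (g : hom W (W' ⊗ U)) V :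
  (X ◁ asc Y U V) ∘ out (asc X Y U ∘ ((f ▷ U) ∘ g)) V = out f (U ⊗ V) ∘ out g V.
Proof.
rewrite out_asc !outE tenr_comp (re2 (asc_nat _ _ _)) tenm_id.
by rewrite -comp_assoc.
Qed.

Lemma out_outr W W' X Y U (f : hom W' (Y ⊗ U)) (g : hom W (X ⊗ W')) V :
  (X ◁ asc Y U V) ∘ out ((X ◁ f) ∘ g) V = (X ◁ out f V) ∘ out g V.
Proof. by rewrite out_post [out f V]outE tenl_comp comp_assoc. Qed.

Lemma ascV_out W X Y (f : hom W (X ⊗ Y)) V : ascV X Y V ∘ out f V = f ▷ V.
Proof. by rewrite outE (re0 (ascK _ _ _)). Qed.

Lemma wl4 X (Y1 Y2 Y3 Y4 Y5 : A) (f : hom Y4 Y5) (g : hom Y3 Y4) (h : hom Y2 Y3)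
    (i : hom Y1 Y2) (l : hom Y1 Y5) :
  f ∘ (g ∘ (h ∘ i)) = l -> (X ◁ f) ∘ ((X ◁ g) ∘ ((X ◁ h) ∘ (X ◁ i))) = X ◁ l.
Proof. by move=> <-; rewrite !tenl_comp. Qed.

Definition del X (e : hom X 𝟙) V : hom (X ⊗ V) V := locked (lun V ∘ (e ▷ V)).

Lemma delE X (e : hom X 𝟙) V : del e V = lun V ∘ (e ▷ V).
Proof. by rewrite /del -lock. Qed.

Lemma lunV_del X (e : hom X 𝟙) V : lunV V ∘ del e V = e ▷ V.
Proof. by rewrite delE (re0 (lunK _)). Qed.

Lemma out_ten X Y X' Y' (f : hom X X') (g : hom Y Y') V :
  out (f ⊠ g) V = (f ▷ (Y' ⊗ V)) ∘ ((X ◁ (g ▷ V)) ∘ asc X Y V).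
Proof. by rewrite outE asc_nat ten_rl comp_assoc. Qed.

Lemma del_nat X (e : hom X 𝟙) V V' (k : hom V V') :
  del e V' ∘ (X ◁ k) = k ∘ del e V.
Proof. by rewrite !delE comp_assoc ten_swap (re2 (lun_nat _)). Qed.

Lemma del_pre X' X (e : hom X 𝟙) (g : hom X' X) V :
  del (e ∘ g) V = del e V ∘ (g ▷ V).
Proof. by rewrite !delE tenr_comp comp_assoc. Qed.

Lemma del_out W X Y (f : hom W (X ⊗ Y)) (e : hom X 𝟙) V :
  del e (Y ⊗ V) ∘ out f V = (lun Y ∘ ((e ▷ Y) ∘ f)) ▷ V.
Proof.
rewrite delE outE !tenr_comp comp_assoc -tenm_id -(re2 (asc_nat _ _ _)).
by rewrite (re1 (kelly_lun _ _)).
Qed.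

Lemma out_del W X Y (f : hom W (X ⊗ Y)) (e : hom Y 𝟙) V :
  (X ◁ del e V) ∘ out f V = (run X ∘ ((X ◁ e) ∘ f)) ▷ V.
Proof.
rewrite delE outE tenl_comp !tenr_comp comp_assoc -(re2 (asc_nat _ _ _)).
by rewrite (re1 (triangle _ _)).
Qed.

Lemma tail_run X Y X' Y' (f : hom (X ⊗ Y) (X' ⊗ Y')) :
  tail f 𝟙 ∘ (X ◁ runV Y) = (X' ◁ runV Y') ∘ f.
Proof.
have I : (X' ◁ runV Y') ∘ (X' ◁ run Y') = idm _ by rewrite -tenl_comp runK tenm_id.
have J : (X ◁ runV Y) ∘ (X ◁ run Y) = idm _ by rewrite -tenl_comp runK tenm_id.
have J' : (X ◁ run Y) ∘ (X ◁ runV Y) = idm _ by rewrite -tenl_comp runVK tenm_id.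
have I' : (X' ◁ run Y') ∘ (X' ◁ runV Y') = idm _ by rewrite -tenl_comp runVK tenm_id.
apply: (iso_mono I); rewrite (re0 I') tailE outE -kelly_run !comp_assoc (re0 (ascK _ _ _)).
by rewrite (re2 (run_nat _)) (re1 (kelly_run _ _)) J' comp_idr.
Qed.

Lemma out_tail X Y X' Y' (f : hom (X ⊗ Y) (X' ⊗ Y')) V V' :
  (X' ◁ asc Y' V V') ∘ out (tail f V) V'
  = tail f (V ⊗ V') ∘ ((X ◁ asc Y V V') ∘ asc X (Y ⊗ V) V').
Proof.
have I : (asc X Y V ▷ V') ∘ (ascV X Y V ▷ V') = idm _.
  by rewrite -tenr_comp ascVK tenm_id.
apply: (iso_epi I).
rewrite !comp_assoc pentagon (re1 (tail_asc _ _)) -out_pre tail_asc.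
by rewrite !outE tenr_comp (re3 (pentagon _ _ _ _)) !comp_assoc asc_nat tenm_id.
Qed.

Lemma out_bend X V W (L : left_dual V) (f : hom (X ⊗ V) W) U :
  out ((f ▷ L) ∘ (ascV X V L ∘ ((X ◁ coev L) ∘ runV X))) U
  = (f ▷ (L ⊗ U)) ∘ (ascV X V (L ⊗ U) ∘ (X ◁ cup (coev L) U)).
Proof.
rewrite outE cupE outE !tenr_comp !tenl_comp (re2 (asc_nat _ _ _)) tenm_id comp_assoc.
have P : asc (X ⊗ V) L U ∘ (ascV X V L ▷ U)
   = ascV X V (L ⊗ U) ∘ ((X ◁ asc V L U) ∘ asc X (V ⊗ L) U).
  apply: (iso_mono (ascK _ _ _)); rewrite (re0 (ascVK _ _ _)).
  rewrite -(re2 (pentagon _ _ _ _)) !comp_assoc (wr1 _ (ascVK _ _ _)).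
  by rewrite tenm_id comp_idr.
rewrite (re2 P) !comp_assoc (re2 (asc_nat _ _ _)).
have R : asc X 𝟙 U ∘ (runV X ▷ U) = X ◁ lunV U.
  by apply: (iso_mono (ascVK _ _ _)); rewrite (re0 (ascK _ _ _)) ascV_runV.
by rewrite R.
Qed.

(** Bending the input [V] into an output along [coev L] loses nothing, since bending back with
    [ev L] recovers the morphism by a zigzag identity. *)
Lemma bend_inj X V W (L : left_dual V) (f g : hom (X ⊗ V) W) :
  (f ▷ L) ∘ (ascV X V L ∘ ((X ◁ coev L) ∘ runV X))
  = (g ▷ L) ∘ (ascV X V L ∘ ((X ◁ coev L) ∘ runV X)) -> f = g.
Proof.
have key (h : hom (X ⊗ V) W) : run W ∘ ((W ◁ ev L)
    ∘ out ((h ▷ L) ∘ (ascV X V L ∘ ((X ◁ coev L) ∘ runV X))) V) = h.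
  rewrite out_bend -(re2 (ten_swap _ _)) (re2 (run_nat _)) -tenm_id -(re2 (ascV_nat _ _ _)).
  rewrite (re1 (kelly_run _ _)) -!tenl_comp cupE outE.
  have Z := ev_zig L; rewrite !comp_assoc in Z.
  by rewrite !comp_assoc Z tenm_id comp_idr.
by move=> E; rewrite -(key f) E key.
Qed.
End Discard.

Section Centralizers.
Variables (A : MonCat) (P Z : Functor A A).
Variable d : forall X Y : A, hom (X ⊗ Y) (P Y ⊗ Z X).
Hypothesis Hd : is_centralizer d.

Lemma d_nat1 (X X' Y V : A) (f : hom X X') :
  tail (d X' Y) V ∘ (f ▷ (Y ⊗ V)) = (P Y ◁ (fmap Z f ▷ V)) ∘ tail (d X Y) V.
Proof.
have [N _] := Hd.
by rewrite -tenm_id -tail_pre N fmap_id tail_post.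
Qed.

Lemma d_nat2 (X Y Y' V : A) (g : hom Y Y') :
  tail (d X Y') V ∘ (X ◁ (g ▷ V)) = (fmap P g ▷ (Z X ⊗ V)) ∘ tail (d X Y) V.
Proof.
have [N _] := Hd.
by rewrite -tail_pre N fmap_id tail_post tenm_id.
Qed.

(** The uniqueness half of the universal property, applied to the natural family that [g]
    defines. *)
Lemma d_inj (X W : A) (f g : hom (Z X) W) :
  (forall Y, (P Y ◁ f) ∘ d X Y = (P Y ◁ g) ∘ d X Y) -> f = g.
Proof.
move=> E; have [N U] := Hd.
have [|r [_ Hr]] := U X W (fun Y => (P Y ◁ g) ∘ d X Y).
  by move=> Y Y' k; rewrite comp_assoc N fmap_id -!comp_assoc -!tenm_comp !comp_idl !comp_idr.
by rewrite -(Hr f) // -(Hr g).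
Qed.

Lemma d_inj1 (X W : A) (f g : hom (Z X) W) :
  (forall Y V, (P Y ◁ (f ▷ V)) ∘ tail (d X Y) V = (P Y ◁ (g ▷ V)) ∘ tail (d X Y) V) ->
  f = g.
Proof.
by move=> E; apply: d_inj => Y; apply: tail_inj; rewrite !tail_post E.
Qed.

Lemma d_inj_out (X W W' : A) (f g : hom (Z X) (W ⊗ W')) :
  (forall Y V, (P Y ◁ out f V) ∘ tail (d X Y) V = (P Y ◁ out g V) ∘ tail (d X Y) V) ->
  f = g.
Proof.
move=> E; apply: d_inj1 => Y V;
  apply: (iso_mono (f := P Y ◁ asc W W' V) (f' := P Y ◁ ascV _ _ _)).
  by rewrite -tenl_comp ascK tenm_id.
by rewrite !(re1 (wl1 _ (esym (outE _ _)))) E.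
Qed.

Lemma d_inj_del (X : A) (f g : hom (Z X) 𝟙) :
  (forall Y V, (P Y ◁ del f V) ∘ tail (d X Y) V = (P Y ◁ del g V) ∘ tail (d X Y) V) ->
  f = g.
Proof.
move=> E; apply: d_inj1 => Y V; apply: (iso_mono (f := P Y ◁ lun V) (f' := P Y ◁ lunV _)).
  by rewrite -tenl_comp lunK tenm_id.
by rewrite !(re1 (wl1 _ (esym (delE _ _)))) E.
Qed.

(* The dual of V turns f into a morphism out of Z X, where the universal property applies. *)
Lemma d_cancel (L : forall X : A, left_dual X) (X V W : A) (f g : hom (Z X ⊗ V) W) :
  (forall Y, (P Y ◁ f) ∘ tail (d X Y) V = (P Y ◁ g) ∘ tail (d X Y) V) -> f = g.
Proof.
move=> E; apply: (bend_inj (L := L V)); apply: d_inj => Y.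
have key (h : hom (Z X ⊗ V) W) :
    (P Y ◁ ((h ▷ L V) ∘ (ascV (Z X) V (L V) ∘ ((Z X ◁ coev (L V)) ∘ runV (Z X))))) ∘ d X Y
    = out ((P Y ◁ h) ∘ tail (d X Y) V) (L V)
      ∘ (ascV X (Y ⊗ V) (L V) ∘ ((X ◁ ascV Y V (L V)) ∘ ((X ◁ Y ◁ coev (L V)) ∘ (X ◁ runV Y)))).
  rewrite !tenl_comp !comp_assoc -tail_run -(re2 (tail_nat _ _)) out_post !comp_assoc.
  congr (_ ∘ _).
  have I : (X ◁ asc Y V (L V)) ∘ ((X ◁ ascV Y V (L V)) : hom (X ⊗ _) _) = idm _.
    by rewrite -tenl_comp ascVK tenm_id.
  have J : (P Y ◁ ascV (Z X) V (L V)) ∘ (P Y ◁ asc (Z X) V (L V)) = idm _.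
    by rewrite -tenl_comp ascK tenm_id.
  rewrite -[X in X ∘ (ascV _ _ _ ∘ _)]comp_idl -J !comp_assoc (re2 (out_tail _ _ _)).
  by rewrite !comp_assoc (re0 (ascVK _ _ _)) (re0 I).
by rewrite !key E.
Qed.
End Centralizers.

(** * The monad of a centralizer *)

Section ComonoidalTails.
Variables (A : MonCat) (P : Functor A A) (c : comonoidal_data P).
Hypothesis Hc : is_comonoidal c.
Implicit Types V X Y : A.

Lemma out_co2_asc (X Y W V : A) :
  (P X ◁ out (co2 c Y W) V) ∘ (out (co2 c X (Y ⊗ W)) V ∘ (fmap P (asc X Y W) ▷ V))
  = out (co2 c X Y) (P W ⊗ V) ∘ out (co2 c (X ⊗ Y) W) V.
Proof.
have [aP _ _] := Hc.
rewrite -out_pre -out_outr -comp_assoc.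
by have := aP X Y W; rewrite !comp_assoc => <-; rewrite out_outl.
Qed.

Lemma del_co2 (X V : A) :
  del (co0 c) (P X ⊗ V) ∘ out (co2 c 𝟙 X) V = fmap P (lun X) ▷ V.
Proof. by have [_ E _] := Hc; rewrite del_out -E !comp_assoc. Qed.

Lemma co2_del (X V : A) :
  (P X ◁ del (co0 c) V) ∘ out (co2 c X 𝟙) V = fmap P (run X) ▷ V.
Proof. by have [_ _ E] := Hc; rewrite out_del -E !comp_assoc. Qed.
End ComonoidalTails.

Section CentralizerMonad.
Variables (A : MonCat) (L : forall X : A, left_dual X) (P Z : Functor A A).
Variable d : forall X Y : A, hom (X ⊗ Y) (P Y ⊗ Z X).
Hypothesis Hd : is_centralizer d.
Variables (c : comonoidal_data P) (z : monad_data Z).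
Hypothesis Hz : is_centralizer_monad d c z.

(** The tail form of the equation for [mul z]: as a rewriting rule it merges two successive
    universal morphisms into one at [Y1 ⊗ Y2]. *)
Lemma d_mul (X Y1 Y2 V : A) :
  (P Y1 ◁ P Y2 ◁ (mul z X ▷ V))
    ∘ ((P Y1 ◁ tail (d (Z X) Y2) V) ∘ tail (d X Y1) (Y2 ⊗ V))
  = out (co2 c Y1 Y2) (Z X ⊗ V)
    ∘ (tail (d X (Y1 ⊗ Y2)) V ∘ (X ◁ ascV Y1 Y2 V)).
Proof.
have [E _] := Hz.
have I : asc X Y1 (Y2 ⊗ V) ∘ (asc (X ⊗ Y1) Y2 V
    ∘ (ascV (X ⊗ Y1) Y2 V ∘ ascV X Y1 (Y2 ⊗ V))) = idm _.
  by rewrite (re0 (ascVK _ _ _)) ascVK.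
apply: (iso_epi (f := asc X Y1 (Y2 ⊗ V) ∘ asc (X ⊗ Y1) Y2 V)).
  by rewrite comp_assoc; exact: I.
have -> : ((P Y1 ◁ P Y2 ◁ (mul z X ▷ V))
    ∘ ((P Y1 ◁ tail (d (Z X) Y2) V) ∘ tail (d X Y1) (Y2 ⊗ V)))
    ∘ (asc X Y1 (Y2 ⊗ V) ∘ asc (X ⊗ Y1) Y2 V)
  = (P Y1 ◁ asc (P Y2) (Z X) V) ∘ out ((P Y1 ◁ P Y2 ◁ mul z X)
    ∘ ((P Y1 ◁ d (Z X) Y2) ∘ (asc (P Y1) (Z X) Y2 ∘ (d X Y1 ▷ Y2)))) V.
  rewrite !out_post (re2 (wl2 _ (asc_nat _ _ _))).
  rewrite (re1 (wl1 _ (esym (outE _ _)))) -(tail_asc (d (Z X) Y2)) tenl_comp !comp_assoc.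
  rewrite out_asc (re1 (tail_asc _ _)) ![out _ _]outE asc_nat tenm_id.
  by rewrite !comp_assoc.
have := E X Y1 Y2; rewrite !comp_assoc => ->.
rewrite out_asc !out_pre -asc_pentagon (re1 (tail_asc _ _)).
by rewrite !outE tenr_comp -tenm_id !comp_assoc (re2 (asc_nat _ _ _)).
Qed.

Lemma d_eta (X V : A) :
  eta z X ▷ V = del (co0 c) (Z X ⊗ V) ∘ (tail (d X 𝟙) V ∘ (X ◁ lunV V)).
Proof.
have [_ ->] := Hz.
rewrite delE tailE outE !tenr_comp !comp_assoc -tenm_id -(re2 (asc_nat _ _ _)).
by rewrite (re1 (kelly_lun _ _)) ascV_runV.
Qed.

Hypothesis Hc : is_comonoidal c.

Lemma centralizer_is_monad : is_monad z.
Proof.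
split=> X.
- apply: (d_inj1 Hd) => Y3 V; apply: (d_cancel Hd L) => Y2; apply: (d_cancel Hd L) => Y1.
  (* The common value is one universal morphism at [Y1 ⊗ (Y2 ⊗ Y3)] followed by an iterated [co2 c].
     The side with [fmap Z (mul z X)] yields the other bracketing, which coassociativity of [c]
     corrects. *)
  transitivity ((P Y1 ◁ out (co2 c Y2 Y3) (Z X ⊗ V)) ∘ (out (co2 c Y1 (Y2 ⊗ Y3)) (Z X ⊗ V)
    ∘ (tail (d X (Y1 ⊗ (Y2 ⊗ Y3))) V ∘ ((X ◁ ascV Y1 (Y2 ⊗ Y3) V) ∘ (X ◁ Y1 ◁ ascV Y2 Y3 V))))).
  + rewrite !tenr_comp !tenl_comp !comp_assoc.
    rewrite (re2 (wl2 _ (wl2 _ (esym (d_nat1 Hd _ _ _))))).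
    rewrite (d_mul _ _ _ _) -(re2 (out_nat _ _)) -(re2 (out_nat _ _)).
    rewrite (re3 (d_mul _ _ _ _)) !comp_assoc.
    rewrite -(re2 (out_co2_asc Hc _ _ _ _)) !comp_assoc -(re2 (d_nat2 Hd _ _ _)).
    by rewrite -!tenl_comp ascV_pentagon.
  + symmetry; rewrite !tenr_comp !tenl_comp !comp_assoc.
    rewrite (re3 (wl3 _ (d_mul _ _ _ _))) !tenl_comp !comp_assoc.
    rewrite -(re2 (wl2 _ (out_nat _ _))) -tail_nat.
    by rewrite (re3 (d_mul _ _ _ _)) !comp_assoc.
(* Expanding the unit by [d_eta] turns the unit laws of [z] into the counit laws of [c]. *)
- apply: (d_inj1 Hd) => Y V.
  rewrite !tenr_comp !tenl_comp !comp_assoc -(d_nat1 Hd) d_eta.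
  rewrite -(re2 (del_nat _ _)) -(re2 (del_nat _ _)) (re3 (d_mul _ _ _ _)) !comp_assoc.
  rewrite (re1 (del_co2 Hc _ _)) -(re2 (d_nat2 Hd _ _ _)) -!tenl_comp.
  rewrite -kelly_lun comp_assoc (re0 (ascVK _ _ _)) lunVK.
  by rewrite !tenm_id comp_idl comp_idr.
- apply: (d_inj1 Hd) => Y V.
  rewrite !tenr_comp !tenl_comp !comp_assoc d_eta !tenl_comp !comp_assoc -tail_nat.
  rewrite -(re2 (wl2 _ (del_nat _ _))) (re3 (d_mul _ _ _ _)) !comp_assoc.
  rewrite (re1 (co2_del Hc _ _)) -(re2 (d_nat2 Hd _ _ _)) -!tenl_comp ascV_runV.
  by rewrite -tenr_comp runVK !tenm_id comp_idl comp_idr.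
Qed.
End CentralizerMonad.

(** * The bimonad of a centralizer *)

Section CentralizerBimonad.
Variables (A : MonCat) (L : forall X : A, left_dual X) (P Z : Functor A A).
Variable d : forall X Y : A, hom (X ⊗ Y) (P Y ⊗ Z X).
Hypothesis Hd : is_centralizer d.
Variables (p : monad_data P) (cz : comonoidal_data Z).
Hypothesis Hcz : is_centralizer_com d p cz.

Lemma d_co2 (X1 X2 Y V : A) :
  (P Y ◁ out (co2 cz X1 X2) V) ∘ tail (d (X1 ⊗ X2) Y) V
  = (mul p Y ▷ (Z X1 ⊗ Z X2 ⊗ V)) ∘ (tail (d X1 (P Y)) (Z X2 ⊗ V)
      ∘ ((X1 ◁ tail (d X2 Y) V) ∘ asc X1 X2 (Y ⊗ V))).
Proof.
have [E _] := Hcz.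
rewrite outE tenl_comp comp_assoc -tail_post E.
have -> : (mul p Y ▷ (Z X1 ⊗ Z X2)) ∘ asc (P (P Y)) (Z X1) (Z X2)
    ∘ (d X1 (P Y) ▷ Z X2) ∘ ascV X1 (P Y) (Z X2) ∘ (X1 ◁ d X2 Y) ∘ asc X1 X2 Y
  = (mul p Y ▷ (Z X1 ⊗ Z X2)) ∘ (tail (d X1 (P Y)) (Z X2) ∘ ((X1 ◁ d X2 Y) ∘ asc X1 X2 Y)).
  by rewrite tailE outE !comp_assoc.
rewrite tail_post tenm_id -(re2 (ten_swap _ _)); congr (_ ∘ _).
rewrite [tail (_ ∘ _) V]tailE out_pre !comp_assoc (re2 (out_tail _ _ _)) tenr_comp.
rewrite !comp_assoc (re2 (asc_nat _ _ _)) (re2 (asc_pentagon _ _ _ _)) !comp_assoc ascVK comp_idr.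
by rewrite [tail (d X2 Y) V]tailE outE !tenl_comp !comp_assoc.
Qed.

Lemma d_co0 (Y V : A) :
  (P Y ◁ del (co0 cz) V) ∘ tail (d 𝟙 Y) V = (eta p Y ▷ V) ∘ lun (Y ⊗ V).
Proof.
have [_ E] := Hcz.
rewrite tailE (re1 (out_del _ _ _)) -comp_assoc E tenr_comp -kelly_lun !comp_assoc.
by rewrite ascVK comp_idr.
Qed.

(** The centralizer exchanges the two kinds of structure: associativity of [mul p] gives
    coassociativity of [co2 cz], and the unit laws of [p] give the counit laws. *)
Lemma centralizer_is_comonoidal : is_monad p -> is_comonoidal cz.
Proof.
move=> [pa pl pr]; split=> [X1 X2 X3|X|X].
- apply: (d_inj_out Hd) => Y V.
  apply: (iso_mono (f := P Y ◁ Z X1 ◁ asc (Z X2) (Z X3) V) (f' := P Y ◁ Z X1 ◁ ascV _ _ _)).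
    by rewrite -!tenl_comp ascK !tenm_id.
  rewrite !(re1 (esym (tenl_comp _ _ _ _ _ _))) !comp_assoc out_outl out_outr out_pre.
  rewrite !tenl_comp !comp_assoc -(d_nat1 Hd).
  rewrite d_co2 -(re2 (ten_swap _ _)) (re2 (d_co2 X1 X2 _ _)) !comp_assoc (re2 (asc_nat3 _ _ _)).
  rewrite (re2 (d_co2 _ _ _ _)) !comp_assoc -(re2 (ten_swap _ _)) -(re2 (tail_nat _ _)).
  rewrite (re2 (wl2 _ (d_co2 _ _ _ _))) !tenl_comp !comp_assoc (re2 (d_nat2 Hd _ _ _)).
  rewrite pentagon.
  by rewrite !(re1 (esym (tenr_comp _ _ _ _ _ _))) pa.
- apply: (d_inj1 Hd) => Y V.
  rewrite !comp_assoc -del_out !tenl_comp !comp_assoc d_co2.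
  rewrite -(re2 (ten_swap _ _)) (re2 (d_co0 _ _)) ?comp_assoc -(d_nat1 Hd).
  rewrite (re2 (lun_nat _)) kelly_lun (re1 (wr1 _ (pr _))) tenm_id.
  by rewrite comp_idl.
- apply: (d_inj1 Hd) => Y V.
  rewrite !comp_assoc -out_del !tenl_comp !comp_assoc d_co2.
  rewrite -(re2 (ten_swap _ _)) -(re2 (tail_nat _ _)) (re2 (wl2 _ (d_co0 _ _))).
  rewrite -(d_nat1 Hd) (re2 (d_nat2 Hd _ _ _)) triangle.
  by rewrite (re1 (wr1 _ (pl _))) tenm_id comp_idl.
Qed.

Variable c : comonoidal_data P.
Hypothesis Hpc : is_bimonad p c.
Variable z : monad_data Z.
Hypothesis Hz : is_centralizer_monad d c z.

(** The bimonad compatibilities are permuted. Those of [mul p] and [eta p] with [co2 c] give those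
    of [mul z] with [co2 cz] and [co0 cz]; those with [co0 c] give the conditions on [eta z]. *)
Lemma centralizer_mul_comonoidal :
  is_comonoidal_trans (comp_comonoidal cz cz) cz (mul z).
Proof.
have [_ Hc [m2 m0] [e2 e0]] := Hpc.
split=> [X1 X2|] /=.
- apply: (d_inj_out Hd) => Y2 V; apply: (d_cancel Hd L) => Y1.
  rewrite /comp_co2 out_post !out_pre !tenl_comp !comp_assoc.
  rewrite (d_mul Hz) -(re2 (out_nat _ _)) (re2 (d_co2 _ _ _ _)) !comp_assoc.
  rewrite asc_nat3.
  rewrite (re2 (wl2 _ (esym (d_nat1 Hd _ _ _)))) (re2 (wl2 _ (d_co2 _ _ _ _))).
  rewrite !tenl_comp !comp_assoc (re1 (wl1 _ (esym (outE _ _)))) d_co2.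
  rewrite -!(re2 (ten_swap _ _)) -(re2 (wl2 _ (ten_swap _ _))).
  rewrite -(re2 (tail_nat (d X1 (P Y1)) _)) (ten_rl (mul z X1)) !tenl_comp !comp_assoc.
  rewrite -(re2 (wl2 _ (tail_nat (d (Z X1) (P Y2)) _))).
  rewrite -(re2 (tail_nat (d X1 (P Y1)) _)) (re3 (d_mul Hz _ _ _ _)).
  rewrite (re3 (wl3 _ (d_mul Hz _ _ _ _))) !tenl_comp !comp_assoc.
  rewrite (re1 (wl1 _ (ascV_out _ _))) (re2 (d_nat2 Hd _ _ _)).
  rewrite (re1 (esym (out_pre (co2 c Y1 Y2) (mul p _) _))) m2 out_post /= /comp_co2 out_pre.
  by rewrite (ten_rl (mul p Y1)) !comp_assoc.
- apply: (d_inj_del Hd) => Y2 V; apply: (d_cancel Hd L) => Y1.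
  rewrite !del_pre !tenl_comp !comp_assoc.
  rewrite (d_mul Hz) -(re2 (out_nat _ _)) (re2 (d_co0 _ _)) ?comp_assoc.
  rewrite (re2 (wl2 _ (esym (d_nat1 Hd _ _ _)))) (re2 (wl2 _ (d_co0 _ _))).
  rewrite (re1 (wl1 _ (esym (delE _ _)))) d_co0.
  rewrite (re1 (esym (out_pre _ _ _))) e2 out_post outE tenm_id !comp_assoc comp_idl.
  rewrite -(re2 (lun_nat (asc Y1 Y2 V))) -tenl_comp ascVK tenm_id comp_idr.
  by rewrite (re1 (esym (ten_lr _ _))).
Qed.

Lemma centralizer_eta_comonoidal :
  is_comonoidal_trans (id_comonoidal A) cz (eta z).
Proof.
have [_ Hc [m2 m0] [e2 e0]] := Hpc.
split=> [X1 X2|] /=.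
- apply: out_inj; rewrite comp_idr out_pre (d_eta Hz).
  rewrite -(re2 (del_nat _ _)) (re2 (d_co2 _ _ _ _)) (re1 (esym (del_pre _ _ _))) ?comp_assoc.
  rewrite m0 /= del_pre comp_assoc -(re2 (d_nat2 Hd _ _ _)) -lunV_del.
  by rewrite out_ten !(d_eta Hz) asc_nat3 !tenl_comp !comp_assoc.
- apply: ten_one_inj => V; rewrite -lunV_del del_pre (d_eta Hz) -(re2 (del_nat (co0 c) _)).
  rewrite (re2 (d_co0 _ _)) (re1 (esym (del_pre _ _ _))) e0 delE /= tenm_id comp_idr.
  by rewrite lun_nat (re0 (lunVK _)) lunK.
Qed.

Lemma centralizer_bimonad : is_bimonad z cz.
Proof.
have [Hp Hc _ _] := Hpc; split.
- exact: (centralizer_is_monad L Hd Hz Hc).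
- exact: (centralizer_is_comonoidal Hp).
- exact: centralizer_mul_comonoidal.
- exact: centralizer_eta_comonoidal.
Qed.
End CentralizerBimonad.

(** * Rotations of morphisms through duals *)

Section Rotations.
Variable A : MonCat.
Implicit Types U V W X Y B C : A.

Lemma cap_out W X Y (e : hom (X ⊗ Y) 𝟙) (f : hom W (X ⊗ Y)) V :
  cap e V ∘ out f V = del (e ∘ f) V.
Proof. by rewrite capE delE !comp_assoc ascV_out tenr_comp. Qed.

Lemma cup_del X Y (c : hom 𝟙 (X ⊗ Y)) Z (e : hom Z 𝟙) V :
  cup c V ∘ del e V = out (c ∘ e) V.
Proof. by rewrite cupE out_pre comp_assoc lunV_del. Qed.

Lemma cap_ten X Y U V (e : hom (X ⊗ Y) 𝟙) :
  cap e (U ⊗ V) ∘ ((X ◁ asc Y U V) ∘ asc X (Y ⊗ U) V) = cap e U ▷ V.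
Proof.
rewrite !capE !tenr_comp -kelly_lun !comp_assoc.
have -> : ascV X Y (U ⊗ V) ∘ ((X ◁ asc Y U V) ∘ asc X (Y ⊗ U) V)
  = asc (X ⊗ Y) U V ∘ (ascV X Y U ▷ V).
  apply: (iso_mono (ascK _ _ _)); rewrite (re0 (ascVK _ _ _)) -(re2 (pentagon _ _ _ _)).
  by rewrite !comp_assoc (wr1 _ (ascVK _ _ _)) tenm_id comp_idr.
by rewrite (re2 (asc_nat _ _ _)) tenm_id.
Qed.

Lemma cup_ten X Y U V (c : hom 𝟙 (X ⊗ Y)) :
  (X ◁ asc Y U V) ∘ (asc X (Y ⊗ U) V ∘ (cup c U ▷ V)) = cup c (U ⊗ V).
Proof.
rewrite !cupE !outE !tenr_comp !comp_assoc (re3 (pentagon _ _ _ _)) !comp_assoc.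
by rewrite (re2 (asc_nat _ _ _)) asc_lunV tenm_id.
Qed.

Section Left.
Variables (Y B B0 C C0 W : A) (e : hom (Y ⊗ C) 𝟙) (c : hom 𝟙 (B ⊗ W)).
Variable f : hom (B0 ⊗ B) (C ⊗ C0).

(** The last input [B] is bent along [c] into the last output [W], and the first output [C] along
    [e] into the first input [Y]. The mirror image is [rotr]. *)
Definition rotl : hom (Y ⊗ B0) (C0 ⊗ W) :=
  cap e (C0 ⊗ W) ∘ (Y ◁ (tail f W ∘ ((B0 ◁ c) ∘ runV B0))).

Lemma tail_rotl V : tail rotl V
  = cap e (C0 ⊗ W ⊗ V) ∘ ((Y ◁ tail f (W ⊗ V)) ∘ (Y ◁ B0 ◁ cup c V)).
Proof.
rewrite tailE /rotl outE tenr_comp -cap_ten !comp_assoc -(re2 (cap_nat e _)).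
congr (_ ∘ _); rewrite (re2 (asc_nat _ _ _)) ascVK comp_idr -!tenl_comp.
congr (_ ◁ _); rewrite !tenr_comp.
have -> : asc C (C0 ⊗ W) V ∘ ((tail f W ▷ V) ∘ (((B0 ◁ c) ▷ V) ∘ (runV B0 ▷ V)))
  = out (tail f W) V ∘ (((B0 ◁ c) ▷ V) ∘ (runV B0 ▷ V)) by rewrite outE !comp_assoc.
rewrite (re2 (out_tail _ _ _)) !comp_assoc (re2 (asc_nat _ _ _)) cupE outE !tenl_comp.
by rewrite -ascV_runV (re0 (ascVK _ _ _)) !comp_assoc.
Qed.

Variable e' : hom (W ⊗ B) 𝟙.
Hypothesis zig : forall V, (B ◁ cap e' V) ∘ cup c (B ⊗ V) = idm (B ⊗ V).

(** Evaluating the output [W] against a following [B] straightens the bent strand and undoes half of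
    the rotation. The other cap and cup lemmas straighten the remaining bends in the same way. *)
Lemma rotl_cap V :
  (C0 ◁ cap e' V) ∘ tail rotl (B ⊗ V) = cap e (C0 ⊗ V) ∘ (Y ◁ tail f V).
Proof.
rewrite tail_rotl -(re2 (cap_nat e _)) -(re2 (wl2 _ (tail_nat f _))) -!tenl_comp zig.
by rewrite !tenm_id comp_idr.
Qed.
End Left.

Lemma rotl_cup (Y B B0 C C0 W : A) (e : hom (Y ⊗ C) 𝟙) (c : hom 𝟙 (B ⊗ W))
    (c' : hom 𝟙 (C ⊗ Y)) (f : hom (B0 ⊗ B) (C ⊗ C0)) V :
  (forall V, (C ◁ cap e V) ∘ cup c' (C ⊗ V) = idm (C ⊗ V)) ->
  (C ◁ tail (rotl e c f) V) ∘ cup c' (B0 ⊗ V) = tail f (W ⊗ V) ∘ (B0 ◁ cup c V).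
Proof.
move=> zig; rewrite tail_rotl !tenl_comp !comp_assoc -cup_nat -(re2 (cup_nat _ _)).
by rewrite (re1 (zig _)) comp_idl.
Qed.

Section Right.
Variables (Y B B0 C C0 W : A) (e : hom (C ⊗ Y) 𝟙) (c : hom 𝟙 (W ⊗ B)).
Variable f : hom (B ⊗ B0) (C0 ⊗ C).

Definition rotr : hom (B0 ⊗ Y) (W ⊗ C0) :=
  (W ◁ (run C0 ∘ ((C0 ◁ e) ∘ tail f Y))) ∘ cup c (B0 ⊗ Y).

Lemma tail_rotr V : tail rotr V
  = (W ◁ C0 ◁ cap e V) ∘ ((W ◁ tail f (Y ⊗ V)) ∘ cup c (B0 ⊗ Y ⊗ V)).
Proof.
rewrite tailE /rotr out_post !comp_assoc.
have E : out (cup c (B0 ⊗ Y)) V ∘ ascV B0 Y V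
  = (W ◁ ascV B (B0 ⊗ Y) V) ∘ ((W ◁ B ◁ ascV B0 Y V) ∘ cup c (B0 ⊗ Y ⊗ V)).
  rewrite -cup_nat -(cup_ten (B0 ⊗ Y)) !comp_assoc (re1 (wl1 _ (ascK _ _ _))) tenm_id comp_idl.
  by rewrite outE comp_assoc.
rewrite E (re1 (esym (tenl_comp _ _ _ _ _ _))) (re1 (esym (tenl_comp _ _ _ _ _ _))).
rewrite (re1 (esym (tenl_comp _ _ _ _ _ _))); congr ((_ ◁ _) ∘ _).
rewrite !tenr_comp !comp_assoc.
have F : (tail f Y ▷ V) ∘ (ascV B (B0 ⊗ Y) V ∘ (B ◁ ascV B0 Y V))
  = ascV C0 (C ⊗ Y) V ∘ ((C0 ◁ ascV C Y V) ∘ tail f (Y ⊗ V)).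
  apply: (iso_mono (ascK _ _ _)); rewrite (re0 (ascVK _ _ _)).
  apply: (iso_mono (f := C0 ◁ asc C Y V) (f' := C0 ◁ ascV C Y V)).
    by rewrite -tenl_comp ascK tenm_id.
  rewrite (re1 (wl1 _ (ascVK _ _ _))) tenm_id comp_idl.
  rewrite (re1 (esym (outE _ _))) (re2 (out_tail _ _ _)) !comp_assoc (re0 (ascVK _ _ _)).
  by rewrite -tenl_comp ascVK tenm_id comp_idr.
rewrite F -(re2 (ascV_nat _ _ _)) (re1 (rev_triangle _ _)) capE.
by rewrite !tenl_comp !comp_assoc.
Qed.
End Right.

Lemma rotr_cap (Y B B0 C C0 W : A) (e : hom (C ⊗ Y) 𝟙) (c : hom 𝟙 (W ⊗ B))
    (e' : hom (B ⊗ W) 𝟙) (f : hom (B ⊗ B0) (C0 ⊗ C)) V :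
  (forall V, cap e' (B ⊗ V) ∘ (B ◁ cup c V) = idm (B ⊗ V)) ->
  cap e' (C0 ⊗ V) ∘ (B ◁ tail (rotr e c f) V) = (C0 ◁ cap e V) ∘ tail f (Y ⊗ V).
Proof.
move=> zig; rewrite tail_rotr !tenl_comp !(re2 (cap_nat e' _)).
by rewrite zig comp_idr.
Qed.

Lemma rotr_cup (Y B B0 C C0 W : A) (e : hom (C ⊗ Y) 𝟙) (c : hom 𝟙 (W ⊗ B))
    (c' : hom 𝟙 (Y ⊗ C)) (f : hom (B ⊗ B0) (C0 ⊗ C)) V :
  (forall V, cap e (C ⊗ V) ∘ (C ◁ cup c' V) = idm (C ⊗ V)) ->
  tail (rotr e c f) (C ⊗ V) ∘ (B0 ◁ cup c' V) = (W ◁ tail f V) ∘ cup c (B0 ⊗ V).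
Proof.
move=> zig; rewrite tail_rotr !comp_assoc cup_nat (re2 (wl2 _ (tail_nat f _))).
by rewrite (re1 (wl1 _ (wl1 _ (zig _)))) !tenm_id comp_idl.
Qed.
End Rotations.

(** * Half-braidings on dual objects *)

Section DualTails.
Variable A : MonCat.
Implicit Types V X Y : A.

Lemma lzig X (X' : left_dual X) V :
  (X ◁ cap (ev X') V) ∘ cup (coev X') (X ⊗ V) = idm (X ⊗ V).
Proof. exact: (cap_cup_zig V (ev_zig X')). Qed.

Lemma rzig X (X' : right_dual X) V :
  cap (evr X') (X ⊗ V) ∘ (X ◁ cup (coevr X') V) = idm (X ⊗ V).
Proof. exact: (cap_cup_zag V (evr_zig X')). Qed.

Lemma evr_rdm X Y (X' : right_dual X) (Y' : right_dual Y) (f : hom X Y) :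
  evr X' ∘ (idm X ⊠ rdm X' Y' f) = evr Y' ∘ (f ⊠ idm Y').
Proof. exact: (ev_ldm (rev_dual X') (rev_dual Y') f). Qed.

Lemma coevr_rdm X Y (X' : right_dual X) (Y' : right_dual Y) (f : hom X Y) :
  (rdm X' Y' f ⊠ idm Y) ∘ coevr Y' = (idm X' ⊠ f) ∘ coevr X'.
Proof. exact: (coev_ldm (rev_dual X') (rev_dual Y') f). Qed.

Lemma cap_ldm X Y (X' : left_dual X) (Y' : left_dual Y) (f : hom X Y) V :
  cap (ev X') V ∘ (ldm X' Y' f ▷ (X ⊗ V)) = cap (ev Y') V ∘ (Y' ◁ (f ▷ V)).
Proof. by rewrite -tenm_id -!cap_pre ev_ldm. Qed.

Lemma cup_ldm X Y (X' : left_dual X) (Y' : left_dual Y) (f : hom X Y) V :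
  (Y ◁ (ldm X' Y' f ▷ V)) ∘ cup (coev Y') V = (f ▷ (X' ⊗ V)) ∘ cup (coev X') V.
Proof. by rewrite -[idm (X' ⊗ V)]tenm_id -!cup_post coev_ldm. Qed.

Lemma cap_rdm X Y (X' : right_dual X) (Y' : right_dual Y) (f : hom X Y) V :
  cap (evr X') V ∘ (X ◁ (rdm X' Y' f ▷ V)) = cap (evr Y') V ∘ (f ▷ (Y' ⊗ V)).
Proof. by rewrite -[idm (Y' ⊗ V)]tenm_id -!cap_pre evr_rdm. Qed.

Lemma cup_rdm X Y (X' : right_dual X) (Y' : right_dual Y) (f : hom X Y) V :
  (rdm X' Y' f ▷ (Y ⊗ V)) ∘ cup (coevr Y') V = (X' ◁ (f ▷ V)) ∘ cup (coevr X') V.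
Proof. by rewrite -tenm_id -!cup_post coevr_rdm. Qed.
End DualTails.

(** * The antipode axioms with a tail *)

Section AntipodeTails.
Variables (A : MonCat) (P : Functor A A) (p : monad_data P) (c : comonoidal_data P).

Lemma lant_ev_tail (L : forall X : A, left_dual X) (s : left_antipode L p c) (X V : A) :
  cap (ev (L (P X))) V
    ∘ (((lant s (P X) ∘ fmap P (ldm (L (P (P X))) (L (P X)) (mul p X))) ▷ (P X ⊗ V))
    ∘ out (co2 c (L (P X)) X) V)
  = del (co0 c) V ∘ (fmap P (ev (L X) ∘ (ldm (L X) (L (P X)) (eta p X) ▷ X)) ▷ V).
Proof.
have E := lant_ev s X; rewrite -[RHS]del_pre fmap_comp -[co0 c ∘ _]comp_assoc E.
by rewrite comp_assoc -cap_out out_post tenm_id.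
Qed.

Lemma lant_coev_tail (L : forall X : A, left_dual X) (s : left_antipode L p c) (X V : A) :
  (mul p X ⊠ (lant s X ▷ V))
    ∘ (out (co2 c (P X) (L (P X))) V ∘ (fmap P (coev (L (P X))) ▷ V))
  = (eta p X ▷ (L X ⊗ V)) ∘ (cup (coev (L X)) V ∘ del (co0 c) V).
Proof.
have := lant_coev s X; rewrite comp_assoc => E.
by rewrite -out_pre -out_post -comp_assoc -E cup_del -[idm (L X ⊗ V)]tenm_id -out_post.
Qed.

Lemma rant_ev_tail (R : forall X : A, right_dual X) (s : right_antipode R p c) (X V : A) :
  cap (evr (R (P X))) V
    ∘ ((P X ◁ ((rant s (P X) ∘ fmap P (rdm (R (P (P X))) (R (P X)) (mul p X))) ▷ V))
    ∘ out (co2 c X (R (P X))) V)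
  = del (co0 c) V ∘ (fmap P (evr (R X) ∘ (X ◁ rdm (R X) (R (P X)) (eta p X))) ▷ V).
Proof.
have E := rant_ev s X; rewrite -[RHS]del_pre fmap_comp -[co0 c ∘ _]comp_assoc E.
by rewrite comp_assoc -cap_out out_post.
Qed.

Lemma rant_coev_tail (R : forall X : A, right_dual X) (s : right_antipode R p c) (X V : A) :
  (rant s X ⊠ (mul p X ▷ V))
    ∘ (out (co2 c (R (P X)) (P X)) V ∘ (fmap P (coevr (R (P X))) ▷ V))
  = (R X ◁ (eta p X ▷ V)) ∘ (cup (coevr (R X)) V ∘ del (co0 c) V).
Proof.
have := rant_coev s X; rewrite comp_assoc => E.
by rewrite -out_pre -out_post -comp_assoc -E cup_del -out_post.
Qed.
End AntipodeTails.

Section DualHalfBraidings.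
Variables (A : MonCat) (P : Functor A A) (p : monad_data P) (c : comonoidal_data P).
Variable M : A.
Variable sg : forall Y : A, hom (M ⊗ Y) (P Y ⊗ M).
Hypothesis sg_nat : forall (Y Y' : A) (g : hom Y Y'),
  sg Y' ∘ (M ◁ g) = (fmap P g ▷ M) ∘ sg Y.
Hypothesis sg_co2 : forall Y1 Y2 V : A,
  (P Y1 ◁ tail (sg Y2) V) ∘ tail (sg Y1) (Y2 ⊗ V)
  = out (co2 c Y1 Y2) (M ⊗ V) ∘ (tail (sg (Y1 ⊗ Y2)) V ∘ (M ◁ ascV Y1 Y2 V)).
Hypothesis sg_co0 : forall V : A,
  del (co0 c) (M ⊗ V) ∘ (tail (sg 𝟙) V ∘ (M ◁ lunV V)) = idm (M ⊗ V).

Lemma sg_tail (Y Y' V : A) (g : hom Y Y') :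
  tail (sg Y') V ∘ (M ◁ (g ▷ V)) = (fmap P g ▷ (M ⊗ V)) ∘ tail (sg Y) V.
Proof. by rewrite -tail_pre sg_nat tail_post tenm_id. Qed.

(** The two half-braidings merge into one at [X ⊗ Y], and naturality pulls [f] through it, leaving
    the half-braiding at [𝟙]. *)
Lemma sg_cup (X Y V : A) (f : hom 𝟙 (X ⊗ Y)) :
  (P X ◁ tail (sg Y) V) ∘ (tail (sg X) (Y ⊗ V) ∘ (M ◁ cup f V))
  = out (co2 c X Y) (M ⊗ V) ∘ ((fmap P f ▷ (M ⊗ V)) ∘ (tail (sg 𝟙) V ∘ (M ◁ lunV V))).
Proof.
rewrite (re2 (sg_co2 _ _ _)) !comp_assoc -tenl_comp cupE (re1 (ascV_out _ _)) tenl_comp.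
by rewrite (re2 (sg_tail _ _)).
Qed.

(** By naturality [e] moves before the half-braiding, which becomes the one at [𝟙] and is removed by
    the counit. *)
Lemma sg_cap (X Y V : A) (e : hom (X ⊗ Y) 𝟙) :
  del (co0 c) (M ⊗ V) ∘ ((fmap P e ▷ (M ⊗ V)) ∘ (tail (sg (X ⊗ Y)) V ∘ (M ◁ ascV X Y V)))
  = M ◁ cap e V.
Proof.
rewrite -(re2 (sg_tail _ _)) -tenl_comp.
have -> : (e ▷ V) ∘ ascV X Y V = lunV V ∘ cap e V by rewrite capE (re0 (lunK _)).
by rewrite tenl_comp (re3 (sg_co0 _)) comp_idl.
Qed.

Section LeftDual.
Variables (R : forall X : A, right_dual X) (s : right_antipode R p c) (M' : left_dual M).

(* The convolution inverse of the half-braiding [sg]: [sg_kap] and [kap_sg] come from the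
   second and the first axiom of the right antipode. *)
Definition kap (Y : A) : hom (Y ⊗ M) (M ⊗ P Y) :=
  rotl (evr (R Y)) (coevr (R (P Y))) ((rant s Y ▷ M) ∘ sg (R (P Y))).

Lemma tail_kap (Y V : A) : tail (kap Y) V
  = cap (evr (R Y)) (M ⊗ P Y ⊗ V) ∘ ((Y ◁ (rant s Y ▷ (M ⊗ P Y ⊗ V)))
     ∘ ((Y ◁ tail (sg (R (P Y))) (P Y ⊗ V)) ∘ (Y ◁ M ◁ cup (coevr (R (P Y))) V))).
Proof. by rewrite tail_rotl tail_post tenm_id tenl_comp !comp_assoc. Qed.

Lemma sg_kap (Y V : A) :
  (mul p Y ▷ (M ⊗ V)) ∘ (tail (sg (P Y)) V ∘ tail (kap Y) V) = eta p Y ▷ (M ⊗ V).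
Proof.
rewrite tail_kap -(re2 (cap_nat _ _)) -(re2 (wl2 _ (ten_swap _ _))).
(* Pulling the cup through both half-braidings brings it next to the antipode, where the
   coevaluation axiom applies; a zigzag for [R Y] then remains. *)
rewrite (wl3 _ (sg_cup _ _)) !tenl_comp -(re2 (cap_nat _ _)).
rewrite (re1 (wl1 _ (esym (ten_lr _ _)))) (re3 (wl3 _ (rant_coev_tail s _ _))).
rewrite !tenl_comp !comp_assoc -!tenl_comp sg_co0 comp_idr !tenl_comp.
by rewrite (re2 (cap_nat _ _)) rzig comp_idr.
Qed.

Lemma kap_sg (Y V : A) :
  (M ◁ (mul p Y ▷ V)) ∘ (tail (kap (P Y)) V ∘ tail (sg Y) V) = M ◁ (eta p Y ▷ V).
Proof.
rewrite tail_kap !comp_assoc -(re2 (cap_nat _ _)).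
rewrite -(re2 (wl2 _ (ten_swap _ _))) -(re2 (wl2 _ (tail_nat _ _))).
(* The product moves across the cup as its dual, and forms with [rant] the composite occurring in
   the evaluation axiom. *)
rewrite (re2 (wl2 _ (wl2 _ (esym (cup_rdm (R (P (P Y))) (R (P Y)) (mul p Y) V))))).
rewrite (re2 (wl2 _ (sg_tail _ _))) (re1 (wl1 _ (esym (tenr_comp _ _ _ _ _ _)))).
rewrite -tail_nat (re2 (sg_co2 _ _ _)) !comp_assoc (re3 (rant_ev_tail s _ _)) !comp_assoc.
rewrite (re4 (sg_cap _ _)) -!tenl_comp cap_pre comp_assoc.
rewrite (wl1 _ (cup_rdm (R Y) (R (P Y)) (eta p Y) V)) !tenl_comp.
by rewrite (re2 (wl2 _ (cap_nat _ _))) -!tenl_comp rzig comp_idr.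
Qed.
Lemma kap_nat (Y Y' V : A) (g : hom Y Y') :
  tail (kap Y') V ∘ (g ▷ (M ⊗ V)) = (M ◁ (fmap P g ▷ V)) ∘ tail (kap Y) V.
Proof.
rewrite !tail_kap !comp_assoc -(ten_swap g) -!(re2 (ten_swap g _)).
rewrite -(re2 (cap_rdm (R Y) (R Y') g _)) -[RHS](re2 (cap_nat _ _)).
rewrite -(re2 (wl2 Y (ten_swap (rant s Y) _))) -(re2 (wl2 Y (tail_nat (sg (R (P Y))) _))).
rewrite (wl2 Y (wl2 M (esym (cup_rdm (R (P Y)) (R (P Y')) (fmap P g) V)))).
by rewrite (re2 (wl2 _ (sg_tail _ _))) (re2 (wl2 _ (wr2 _ (rant_nat s g)))).
Qed.

(** The mate of [kap] along the duality of [M'] and [M]: [kap_sg] becomes the compatibility with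
    evaluation and [sg_kap] the one with coevaluation. *)
Definition ltau (Y : A) : hom (M' ⊗ Y) (P Y ⊗ M') := rotl (ev M') (coev M') (kap Y).

Lemma tail_ltau (Y V : A) : tail (ltau Y) V
  = cap (ev M') (P Y ⊗ M' ⊗ V) ∘ ((M' ◁ tail (kap Y) (M' ⊗ V))
      ∘ (M' ◁ Y ◁ cup (coev M') V)).
Proof. exact: tail_rotl. Qed.

Lemma ltau_nat (Y Y' : A) (g : hom Y Y') :
  ltau Y' ∘ (M' ◁ g) = (fmap P g ▷ M') ∘ ltau Y.
Proof.
apply: tail_inj; rewrite tail_pre tail_post tenm_id !tail_ltau !comp_assoc.
rewrite -(wl2 M' (ten_swap g _)) (re2 (wl2 _ (kap_nat _ _))).
by rewrite (re2 (cap_nat _ _)).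
Qed.

Lemma ltau_ev (Y V : A) :
  (mul p Y ▷ V) ∘ ((P (P Y) ◁ cap (ev M') V)
    ∘ (tail (ltau (P Y)) (M ⊗ V) ∘ (M' ◁ tail (sg Y) V)))
  = (eta p Y ▷ V) ∘ cap (ev M') (Y ⊗ V).
Proof.
rewrite (re2 (rotl_cap _ _ (lzig M') _)) -(re2 (cap_nat _ _)) -!tenl_comp kap_sg.
by rewrite cap_nat.
Qed.

Lemma ltau_coev (Y V : A) :
  (mul p Y ▷ (M ⊗ M' ⊗ V)) ∘ (tail (sg (P Y)) (M' ⊗ V)
    ∘ ((M ◁ tail (ltau Y) V) ∘ cup (coev M') (Y ⊗ V)))
  = (eta p Y ▷ (M ⊗ M' ⊗ V)) ∘ (Y ◁ cup (coev M') V).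
Proof.
rewrite (rotl_cup _ _ _ (lzig M')).
by rewrite (re3 (sg_kap _ _)).
Qed.
End LeftDual.

Section RightDual.
Variables (L : forall X : A, left_dual X) (s : left_antipode L p c) (M' : right_dual M).

(* On the right dual no convolution inverse is available: the half-braiding [rtau] is the
   full right dual of (lant ▷ M) ∘ sg, obtained by rotating it twice. *)
Definition rho (Y : A) : hom (L (P Y) ⊗ M') (M' ⊗ L Y) :=
  rotr (evr M') (coevr M') ((lant s Y ▷ M) ∘ sg (L (P Y))).

Lemma lam_tail (Y V : A) : tail ((lant s Y ▷ M) ∘ sg (L (P Y))) V
  = (lant s Y ▷ (M ⊗ V)) ∘ tail (sg (L (P Y))) V.
Proof. by rewrite tail_post tenm_id. Qed.

Lemma tail_rho (Y V : A) : tail (rho Y) V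
  = (M' ◁ L Y ◁ cap (evr M') V) ∘ ((M' ◁ (lant s Y ▷ (M ⊗ M' ⊗ V)))
      ∘ ((M' ◁ tail (sg (L (P Y))) (M' ⊗ V)) ∘ cup (coevr M') (L (P Y) ⊗ M' ⊗ V))).
Proof. by rewrite tail_rotr lam_tail tenl_comp !comp_assoc. Qed.

Lemma rho_nat (Y Y' V : A) (g : hom Y Y') :
  tail (rho Y) V ∘ (ldm (L (P Y)) (L (P Y')) (fmap P g) ▷ (M' ⊗ V))
  = (M' ◁ (ldm (L Y) (L Y') g ▷ V)) ∘ tail (rho Y') V.
Proof.
rewrite !tail_rho !comp_assoc cup_nat (re2 (wl2 _ (sg_tail _ _))).
rewrite (re2 (wl2 _ (wr2 _ (lant_nat s g)))).
by rewrite -(re2 (wl2 _ (ten_swap _ _))).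
Qed.

Definition rtau (Y : A) : hom (M' ⊗ Y) (P Y ⊗ M') :=
  rotr (ev (L Y)) (coev (L (P Y))) (rho Y).

Lemma tail_rtau (Y V : A) : tail (rtau Y) V
  = (P Y ◁ M' ◁ cap (ev (L Y)) V) ∘ ((P Y ◁ tail (rho Y) (Y ⊗ V))
      ∘ cup (coev (L (P Y))) (M' ⊗ Y ⊗ V)).
Proof. exact: tail_rotr. Qed.

Lemma rtau_nat (Y Y' : A) (g : hom Y Y') :
  rtau Y' ∘ (M' ◁ g) = (fmap P g ▷ M') ∘ rtau Y.
Proof.
apply: tail_inj; rewrite tail_pre tail_post tenm_id !tail_rtau !comp_assoc.
rewrite cup_nat (re2 (wl2 _ (tail_nat (rho Y') _))).
rewrite (re1 (wl1 _ (wl1 _ (esym (cap_ldm (L Y) (L Y') g _))))) !tenl_comp !comp_assoc.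
rewrite -(re2 (wl2 _ (rho_nat _ _))) cup_ldm.
by rewrite -!(re2 (ten_swap (fmap P g) _)).
Qed.

Lemma rtau_ev (Y V : A) :
  (mul p Y ▷ V) ∘ ((P (P Y) ◁ cap (evr M') V)
    ∘ (tail (sg (P Y)) (M' ⊗ V) ∘ (M ◁ tail (rtau Y) V)))
  = (eta p Y ▷ V) ∘ cap (evr M') (Y ⊗ V).
Proof.
rewrite tail_rtau !tenl_comp !(re2 (tail_nat (sg (P Y)) _)).
(* Evaluation on [M'] undoes the rotation defining [rho], which leaves the left antipode after a
   half-braiding on [M]. *)
rewrite (re2 (wl2 _ (cap_nat _ _))) (re2 (wl2 _ (rotr_cap _ _ _ (rzig M')))).
rewrite lam_tail !tenl_comp !comp_assoc sg_cup.
rewrite !(re2 (ten_swap (mul p Y) _)).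
rewrite (re1 (esym (ten_lr _ _))) (re3 (lant_coev_tail s _ _)) !comp_assoc sg_co0 comp_idr.
rewrite -!(re2 (ten_swap (eta p Y) _)) -cup_nat.
by rewrite (re1 (lzig _ _)) comp_idl.
Qed.

(** The evaluation axiom of the left antipode carried past [M]: the half-braidings merge by
    [sg_co2], and [sg_cap] removes the result. *)
Lemma sg_lant (Y V : A) :
  cap (ev (L (P Y))) (M ⊗ V) ∘ ((L (P Y) ◁ tail (sg Y) V)
    ∘ (((lant s (P Y) ∘ fmap P (ldm (L (P (P Y))) (L (P Y)) (mul p Y))) ▷ (M ⊗ Y ⊗ V))
    ∘ tail (sg (L (P Y))) (Y ⊗ V)))
  = M ◁ cap (ev (L Y) ∘ (ldm (L Y) (L (P Y)) (eta p Y) ▷ Y)) V.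
Proof.
rewrite -(re2 (ten_swap _ _)) sg_co2 (re3 (lant_ev_tail s _ _)) !comp_assoc.
by rewrite sg_cap.
Qed.

Lemma rtau_coev (Y V : A) :
  (mul p Y ▷ (M' ⊗ M ⊗ V)) ∘ (tail (rtau (P Y)) (M ⊗ V)
    ∘ ((M' ◁ tail (sg Y) V) ∘ cup (coevr M') (Y ⊗ V)))
  = (eta p Y ▷ (M' ⊗ M ⊗ V)) ∘ (Y ◁ cup (coevr M') V).
Proof.
rewrite tail_rtau !comp_assoc (re2 (cup_nat _ _)) cup_nat (re2 (wl2 _ (tail_nat (rho (P Y)) _))).
rewrite (re2 (wl2 _ (rotr_cup _ _ _ (rzig M')))) lam_tail !tenl_comp !comp_assoc.
rewrite !(re2 (ten_swap (mul p Y) _)).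
(* The product moves across the cup as its dual, so that it meets [lant] in the form required by
   [sg_lant]. *)
rewrite -(cup_ldm (L (P (P Y))) (L (P Y)) (mul p Y)) (re2 (wl2 _ (cup_nat _ _))).
rewrite (re2 (wl2 _ (wl2 _ (sg_tail _ _)))).
rewrite (re1 (wl1 _ (wl1 _ (esym (tenr_comp _ _ _ _ _ _))))).
rewrite (re4 (wl4 _ (wl4 _ (sg_lant _ _)))) -(re2 (wl2 _ (cup_nat _ _))).
rewrite cap_pre tenm_id tenl_comp !comp_assoc cup_ldm -(re2 (ten_swap (eta p Y) _)).
by rewrite lzig comp_idr ten_swap.
Qed.
End RightDual.
End DualHalfBraidings.

(** * The Hopf monad of a centralizer *)

Section CentralizerLift.
Variables (A : MonCat) (P Z : Functor A A).
Variable d : forall X Y : A, hom (X ⊗ Y) (P Y ⊗ Z X).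
Hypothesis Hd : is_centralizer d.

(** The universal property only asserts existence; a choice principle extracts the factorization so
    that it can enter data. *)
Lemma d_lift (X W : A) (xi : forall Y : A, hom (X ⊗ Y) (P Y ⊗ W)) :
  (forall (Y Y' : A) (g : hom Y Y'), xi Y' ∘ (X ◁ g) = (fmap P g ▷ W) ∘ xi Y) ->
  {r : hom (Z X) W | forall Y, (P Y ◁ r) ∘ d X Y = xi Y}.
Proof.
move=> H; apply: constructive_indefinite_description.
have [_ U] := Hd; have [r [Hr _]] := U X W xi H.
by exists r => Y; rewrite -Hr.
Qed.

Lemma d_tail_nat (X X' Y Y' V V' : A) (f : hom X X') (g : hom Y Y') (k : hom V V') :
  tail (d X' Y') V' ∘ (f ⊠ (g ⊠ k))
  = (fmap P g ⊠ (fmap Z f ⊠ k)) ∘ tail (d X Y) V.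
Proof.
have [N _] := Hd.
have -> : f ⊠ (g ⊠ k) = (f ⊠ (g ▷ V')) ∘ (X ◁ Y ◁ k).
  by rewrite -!tenm_comp !comp_idl !comp_idr.
rewrite (re1 (esym (tail_pre _ _ _ _))) N tail_post comp_assoc tail_nat -comp_assoc.
by rewrite -!tenm_comp !comp_idl !comp_idr.
Qed.

Variable p : monad_data P.

Let xi (X1 X2 Y : A) : hom ((X1 ⊗ X2) ⊗ Y) (P Y ⊗ (Z X1 ⊗ Z X2)) :=
  (mul p Y ▷ (Z X1 ⊗ Z X2)) ∘ (tail (d X1 (P Y)) (Z X2) ∘ ((X1 ◁ d X2 Y) ∘ asc X1 X2 Y)).

Let xi_nat (X1 X2 X1' X2' Y Y' : A) (f1 : hom X1 X1') (f2 : hom X2 X2') (g : hom Y Y') :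
  xi X1' X2' Y' ∘ ((f1 ⊠ f2) ⊠ g) = (fmap P g ⊠ (fmap Z f1 ⊠ fmap Z f2)) ∘ xi X1 X2 Y.
Proof.
have [N _] := Hd; rewrite /xi !comp_assoc asc_nat.
rewrite (re1 (esym (tenm_comp _ _ _ _))) comp_idl N -[f1]comp_idr tenm_comp comp_idr.
rewrite comp_assoc (re2 (d_tail_nat _ _ _)) !(re1 (esym (tenm_comp _ _ _ _))).
by have /= -> := tnat (mul p) g; rewrite comp_idl comp_idr.
Qed.

(** The two defining equations prescribe natural families, which factor through the universal
    morphisms; naturality of the resulting [co2] follows from uniqueness. *)
Lemma centralizer_com_exists :
  exists cz : comonoidal_data Z, is_centralizer_com d p cz.
Proof.
pose r (X1 X2 : A) := @d_lift (X1 ⊗ X2) (Z X1 ⊗ Z X2) (xi X1 X2)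
  (fun Y Y' g => ltac:(by have := xi_nat (idm X1) (idm X2) g; rewrite !fmap_id !tenm_id)).
pose e := @d_lift 𝟙 𝟙 (fun Y => runV (P Y) ∘ (eta p Y ∘ lun Y))
  (fun Y Y' g => ltac:(by have E := tnat (eta p) g;
     rewrite !comp_assoc lun_nat (re2 E) (re2 (runV_nat _)))).
have r_nat (X X' Y Y' : A) (f : hom X X') (g : hom Y Y') :
    sval (r X' Y') ∘ fmap Z (f ⊠ g) = (fmap Z f ⊠ fmap Z g) ∘ sval (r X Y).
  apply: (d_inj Hd) => W; rewrite !tenl_comp !comp_assoc (svalP (r X Y)).
  have [N _] := Hd; have := N _ _ _ _ (f ⊠ g) (idm W); rewrite fmap_id => <-.
  rewrite -comp_assoc (svalP (r X' Y')).
  by have := xi_nat f g (idm W); rewrite fmap_id.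
exists (Build_comonoidal_data (sval e) r_nat); split=> [X1 X2 Y|Y].
- rewrite (svalP (r X1 X2)) /xi tailE outE.
  by rewrite !comp_assoc.
- by rewrite comp_assoc (svalP e) (re0 (runVK _)).
Qed.
End CentralizerLift.

Section CentralizerHopf.
Variables (A : MonCat) (D : Autonomous A) (P Z : Functor A A).
Variable d : forall X Y : A, hom (X ⊗ Y) (P Y ⊗ Z X).
Hypothesis Hd : is_centralizer d.
Variables (p : monad_data P) (c : comonoidal_data P) (Hpc : is_bimonad p c).
Variables (z : monad_data Z) (Hz : is_centralizer_monad d c z).
Variables (cz : comonoidal_data Z) (Hcz : is_centralizer_com d p cz).
Let L := ldual D.
Let R := rdual D.

Definition hbr (M : A) (w : hom (Z M) M) (Y : A) : hom (M ⊗ Y) (P Y ⊗ M) :=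
  (P Y ◁ w) ∘ d M Y.

Lemma hbr_tail (M : A) (w : hom (Z M) M) (Y V : A) :
  tail (hbr w Y) V = (P Y ◁ (w ▷ V)) ∘ tail (d M Y) V.
Proof. exact: tail_post. Qed.

Lemma hbr_nat (M : A) (w : hom (Z M) M) (Y Y' : A) (g : hom Y Y') :
  hbr w Y' ∘ (M ◁ g) = (fmap P g ▷ M) ∘ hbr w Y.
Proof.
have [N _] := Hd.
by rewrite /hbr comp_assoc N fmap_id -(re2 (ten_swap _ _)).
Qed.

(** The module axiom of [w] for the product becomes the hypothesis [sg_co2] on half-braidings; the
    unit axiom becomes [sg_co0] in [hbr_co0]. *)
Lemma hbr_co2 (M : A) (w : hom (Z M) M) (Y1 Y2 V : A) :
  w ∘ mul z M = w ∘ fmap Z w ->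
  (P Y1 ◁ tail (hbr w Y2) V) ∘ tail (hbr w Y1) (Y2 ⊗ V)
  = out (co2 c Y1 Y2) (M ⊗ V) ∘ (tail (hbr w (Y1 ⊗ Y2)) V ∘ (M ◁ ascV Y1 Y2 V)).
Proof.
move=> w_mul; rewrite !hbr_tail !tenl_comp !comp_assoc (re2 (wl2 _ (d_nat1 Hd _ _ _))).
rewrite (re2 (wl2 _ (wl2 _ (wr2 _ (esym w_mul))))) (d_mul Hz).
by rewrite -(re2 (out_nat _ _)).
Qed.

Lemma hbr_co0 (M : A) (w : hom (Z M) M) (V : A) :
  w ∘ eta z M = idm M ->
  del (co0 c) (M ⊗ V) ∘ (tail (hbr w 𝟙) V ∘ (M ◁ lunV V)) = idm (M ⊗ V).
Proof.
move=> w_eta; rewrite hbr_tail !comp_assoc (re2 (del_nat _ _)) -(d_eta Hz) -tenr_comp.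
by rewrite w_eta tenm_id.
Qed.

Section Pairing.
Variables (M1 M2 : A) (w1 : hom (Z M1) M1) (w2 : hom (Z M2) M2).

(** Tested on universal morphisms, linearity of [e] becomes an equation between half-braidings, in
    the form supplied by [ltau_ev] and [rtau_ev]. *)
Lemma hbr_ev_lin (e : hom (M1 ⊗ M2) 𝟙) :
  (forall Y V, (mul p Y ▷ V) ∘ ((P (P Y) ◁ cap e V)
    ∘ (tail (hbr w1 (P Y)) (M2 ⊗ V) ∘ (M1 ◁ tail (hbr w2 Y) V)))
    = (eta p Y ▷ V) ∘ cap e (Y ⊗ V)) ->
  lin (act2 cz w1 w2) (co0 cz) e.
Proof.
move=> H; apply: (d_inj_del Hd) => Y V.
rewrite /act2 -cap_out out_post del_pre !tenl_comp !comp_assoc -(d_nat1 Hd).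
rewrite (re2 (d_co0 Hcz _ _)) (d_co2 Hcz) -!(re2 (ten_swap (mul p Y) _)).
rewrite (ten_rl w1) tenl_comp !comp_assoc -(re2 (tail_nat _ _)).
rewrite (re1 (esym (hbr_tail _ _ _))) (re1 (wl1 _ (esym (hbr_tail _ _ _)))).
by rewrite (re4 (H _ _)) !comp_assoc cap_asc.
Qed.

Lemma hbr_coev_lin (e : hom 𝟙 (M1 ⊗ M2)) :
  (forall Y V, (mul p Y ▷ (M1 ⊗ M2 ⊗ V)) ∘ (tail (hbr w1 (P Y)) (M2 ⊗ V)
    ∘ ((M1 ◁ tail (hbr w2 Y) V) ∘ cup e (Y ⊗ V)))
  = (eta p Y ▷ (M1 ⊗ M2 ⊗ V)) ∘ (Y ◁ cup e V)) ->
  lin (co0 cz) (act2 cz w1 w2) e.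
Proof.
move=> H; apply: (d_inj_out Hd) => Y V.
rewrite /act2 -cup_del comp_assoc out_post !out_pre !tenl_comp !comp_assoc -(d_nat1 Hd).
rewrite (re2 (d_co2 Hcz _ _ _ _)) !comp_assoc -!(re2 (ten_swap (mul p Y) _)).
rewrite (ten_rl w1) tenl_comp !comp_assoc -(re2 (tail_nat _ _)).
rewrite (re1 (esym (hbr_tail _ _ _))) (re1 (wl1 _ (esym (hbr_tail _ _ _)))) (d_co0 Hcz).
have E : asc M1 M2 (Y ⊗ V) ∘ (e ▷ (Y ⊗ V)) = cup e (Y ⊗ V) ∘ lun (Y ⊗ V).
  by rewrite cupE outE !comp_assoc lunK comp_idr.
by rewrite E (re4 (H _ _)) !comp_assoc (re2 (ten_swap (eta p Y) _)).
Qed.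
End Pairing.

Lemma centralizer_hopf_monad : is_hopf_monad D p c -> is_hopf_monad D z cz.
Proof.
move=> [Hb [sl] [sr]].
have HB := centralizer_bimonad (ldual D) Hd Hcz Hpc Hz.
have [[z_mul z_etal z_eta] _ _ _] := HB.
have w_mul X : mul z X ∘ mul z (Z X) = mul z X ∘ fmap Z (mul z X) by rewrite z_mul.
have s_nat X := hbr_nat (M := Z X) (mul z X).
have s_co2 X Y1 Y2 V := hbr_co2 (M := Z X) Y1 Y2 V (w_mul X).
have s_co0 X V := hbr_co0 (M := Z X) V (z_eta X).
(* The sides are exchanged: the right antipode of [P] gives the action on left duals, the left
   antipode the action on right duals. *)
have al X := d_lift Hd (ltau_nat (s_nat X) sr (ldual D (Z X))).
have ar X := d_lift Hd (rtau_nat (s_nat X) sl (rdual D (Z X))).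
split=> //; constructor.
- apply: (dual_left_antipode HB (al := fun X => sval (al X))) => X.
  + apply: hbr_ev_lin => Y V.
    have := ltau_ev (s_nat X) (s_co2 X) (s_co0 X) sr (ldual D (Z X)) Y V.
    by rewrite -(svalP (al X)).
  + apply: hbr_coev_lin => Y V.
    have := ltau_coev (s_nat X) (s_co2 X) (s_co0 X) sr (ldual D (Z X)) Y V.
    by rewrite -(svalP (al X)).
- apply: (dual_right_antipode HB (al := fun X => sval (ar X))) => X.
  + apply: hbr_ev_lin => Y V.
    have := rtau_ev (s_nat X) (s_co2 X) (s_co0 X) sl (rdual D (Z X)) Y V.
    by rewrite -(svalP (ar X)).
  + apply: hbr_coev_lin => Y V.
    have := rtau_coev (s_nat X) (s_co2 X) (s_co0 X) sl (rdual D (Z X)) Y V.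
    by rewrite -(svalP (ar X)).
Qed.
End CentralizerHopf.

(** * The canonical distributive law and the double *)

Lemma trans_eq (B D : Category) (G H : Functor B D) (a b : Trans G H) :
  (forall X, a X = b X) -> a = b.
Proof.
case: a b => [a na] [b nb] /= E.
have {}E : a = b by apply: functional_extensionality_dep.
by case: _ / E nb => nb; rewrite (proof_irrelevance _ na nb).
Qed.

Lemma monad_eq (B : Category) (F : Functor B B) (t t' : monad_data F) :
  (forall X, mul t X = mul t' X) -> (forall X, eta t X = eta t' X) -> t = t'.
Proof.
case: t t' => [m1 e1] [m2 e2] /= Em Ee.
by rewrite (trans_eq (a := m1) (b := m2) Em) (trans_eq (a := e1) (b := e2) Ee).
Qed.

Lemma comonoidal_eq (B D : MonCat) (F : Functor B D) (c c' : comonoidal_data F) :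
  (forall X Y, co2 c X Y = co2 c' X Y) -> co0 c = co0 c' -> c = c'.
Proof.
case: c c' => [x x0 nx] [y y0 ny] /= E2 E0.
have {}E2 : x = y by do 2!apply: functional_extensionality_dep => ?.
case: _ / E2 ny => ny; case: _ / E0.
by rewrite (proof_irrelevance _ nx ny).
Qed.

(** A cross product with a lift and the composite with [T] have the same object and morphism maps
    but different proofs of functoriality. Proof irrelevance identifies the functors, and then
    componentwise equal data can be exchanged in any property. *)
Lemma functor_data_eq (A : MonCat) (fo : A -> A)
    (fm : forall X Y : A, hom X Y -> hom (fo X) (fo Y))
    (i i' : forall X : A, fm X X (idm X) = idm (fo X))
    (m m' : forall (X Y Z : A) (g : hom Y Z) (f : hom X Y),
      fm X Z (g ∘ f) = fm Y Z g ∘ fm X Y f)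
    (F := Build_Functor i m) (F' := Build_Functor i' m')
    (t : monad_data F) (t' : monad_data F') (c : comonoidal_data F) (c' : comonoidal_data F')
    (S : forall G : Functor A A, monad_data G -> comonoidal_data G -> Prop) :
  (forall X, mul t X = mul t' X) -> (forall X, eta t X = eta t' X) ->
  (forall X Y, co2 c X Y = co2 c' X Y) -> co0 c = co0 c' ->
  S F t c -> S F' t' c'.
Proof.
move: t' c'; rewrite /F' (proof_irrelevance _ i' i) (proof_irrelevance _ m' m).
move=> s d Em Ee E2 E0; have <- := monad_eq (t := t) (t' := s) Em Ee.
by have <- := comonoidal_eq (c := c) (c' := d) E2 E0.
Qed.

Section LiftedCentralizer.
Variables (C : MonCat) (T : Bimonad C) (Q : Functor (mod_mon T) (mod_mon T)).
Variables (q : monad_data Q) (Z : Functor C C).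
Variables (d : forall X Y : C, hom (X ⊗ Y) (cross Q Y ⊗ Z X)) (Hd : is_centralizer d).
Variables (l : lift (bmon T) Z)
  (dQ : forall M N : mod_mon T, hom (M ⊗ N) (Q N ⊗ (lift_functor l M : mod_mon T))).
Hypothesis HdQd : forall M N : mod_mon T,
  und (dQ M N)
  = (und (fmap Q (counit (bim_monad T) N)) ⊠ idm (Z (car M))) ∘ d (car M) (car N).
Variables (cZ : comonoidal_data Z)
  (cZQ : @comonoidal_data (mod_mon T) (mod_mon T) (lift_functor l)).
Hypotheses (HcZ : is_centralizer_com d (cross_monad q) cZ)
  (HcZQ : is_centralizer_com dQ q cZQ).
Let F : Functor C (mod_mon T) := free (bim_monad T).

(** By naturality of [d] the unit meets the counit under [Q] in [HdQd], and a triangle identity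
    cancels them. *)
Lemma und_dQ_free (M : mod_mon T) (Y : C) :
  und (dQ M (F Y)) ∘ (car M ◁ eta (bmon T) Y) = d (car M) Y.
Proof.
have [N _] := Hd; rewrite HdQd comp_assoc N fmap_id -comp_assoc -tenr_comp.
have E : fmap Q (counit (bim_monad T) (F Y)) ∘ fmap Q (fmap F (eta (bmon T) Y)) = idm _.
  rewrite -fmap_comp -fmap_id; congr (fmap Q _); apply: linear_eq.
  by have [_ E _] := bim_monad T; exact: E.
have E' := f_equal (@und _ _ _ _ _) E; rewrite /= in E'.
rewrite [X in X ▷ _](_ : _ = idm _); first exact: E'.
by rewrite tenm_id comp_idl.
Qed.

Lemma und_lift_co2 (M N : mod_mon T) : und (co2 cZQ M N) = co2 cZ (car M) (car N).
Proof.
apply: (d_inj Hd) => Y; have [-> _] := HcZ.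
rewrite -(und_dQ_free (M ⊗ N) Y) -(und_dQ_free N Y).
have [E _] := HcZQ.
have {}E : (cross Q Y ◁ und (co2 cZQ M N)) ∘ und (dQ (M ⊗ N) (F Y))
  = (und (mul q (F Y)) ▷ (Z (car M) ⊗ Z (car N)))
    ∘ asc (car (Q (Q (F Y)))) (Z (car M)) (Z (car N))
    ∘ (und (dQ M (Q (F Y))) ▷ Z (car N)) ∘ ascV (car M) (cross Q Y) (Z (car N))
    ∘ (car M ◁ und (dQ N (F Y))) ∘ asc (car M) (car N) (T Y).
  exact: (f_equal (@und _ _ _ _ _) (E M N (F Y))).
(* The counit that [HdQd] contributes at the module [Q (F Y)] is the factor by which [cross_mul_app]
   differs from [mul q]. *)
rewrite (re1 E) (HdQd M (Q (F Y))) tenr_comp tenl_comp !comp_assoc.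
rewrite -asc_nat tenm_id (re2 (asc_nat _ _ _)) tenm_id.
by rewrite (re1 (esym (tenr_comp _ _ _ _ _ _))).
Qed.

Lemma und_lift_co0 : und (co0 cZQ) = co0 cZ.
Proof.
apply: (d_inj Hd) => Y; apply: (iso_mono (runK (cross Q Y))).
have [_ E0] := HcZ; rewrite -!comp_assoc E0.
have [_ E] := HcZQ.
have {}E : run (cross Q Y) ∘ (cross Q Y ◁ und (co0 cZQ)) ∘ und (dQ 𝟙 (F Y))
  = und (eta q (F Y)) ∘ lun (T Y).
  exact: (f_equal (@und _ _ _ _ _) (E (F Y))).
rewrite -(und_dQ_free 𝟙 Y) -comp_assoc E comp_assoc lun_nat.
by rewrite -comp_assoc.
Qed.

Variables (z : monad_data Z) (zQ : monad_data (lift_functor l)).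
Variable Om : Trans (T ∘F Z) (Z ∘F T).
Hypothesis Hcan : is_law_lift z Om zQ.

Lemma law_eq (X : C) : Om X = lact l (F X) ∘ fmap T (fmap Z (eta (bmon T) X)).
Proof.
have [-> _ _] := Hcan; have N := tnat Om (eta (bmon T) X); rewrite /= in N.
rewrite comp_assoc N -comp_assoc -fmap_comp.
by have [_ E _] := bim_monad T; rewrite /= E fmap_id comp_idl.
Qed.

Lemma law_comonoidal :
  is_comonoidal_trans (comp_comonoidal (bcom T) cZ) (comp_comonoidal cZ (bcom T)) Om.
Proof.
have [Ha _ _] := Hcan.
split=> [X Y|].
(* The lifted [co2] at free modules is [T]-linear; restricting this along the units gives the
   equation for [Om] through [law_eq]. *)
- have E := und_act (co2 cZQ (F X) (F Y)).
  rewrite und_lift_co2 /= /ten_act /= in E.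
  have N := tnat Om (eta (bmon T) X ⊠ eta (bmon T) Y); rewrite /= in N.
  rewrite /= /comp_co2 (law_eq X) (law_eq Y) tenm_comp !comp_assoc.
  rewrite -(re2 (co2_nat (bcom T) _ _)) -fmap_comp -(co2_nat cZ) fmap_comp.
  rewrite !comp_assoc in E; rewrite (re3 (esym E)) Ha !comp_assoc N.
  rewrite (re1 (esym (fmap_comp Z _ _))).
  by rewrite -und_free_co2.
- have E := und_act (co0 cZQ); rewrite und_lift_co0 /= Ha in E.
  by rewrite /= -E comp_assoc.
Qed.
End LiftedCentralizer.

Section LawTransport.
Variables (C : MonCat) (T : Bimonad C) (Z : Functor C C).
Variables (z : monad_data Z) (cZ : comonoidal_data Z) (Om : Trans (T ∘F Z) (Z ∘F T)).
Variables (l : lift (bmon T) Z) (zQ : monad_data (lift_functor l)).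
Variable cZQ : @comonoidal_data (mod_mon T) (mod_mon T) (lift_functor l).
Hypothesis H : is_law_lift_bimonad z cZ Om zQ cZQ.

(** The predicate [S] is kept arbitrary so that one transport serves both bimonads and Hopf
    monads. *)
Lemma law_of_cross
    (S : forall G : Functor C C, monad_data G -> comonoidal_data G -> Prop) :
  S _ (cross_monad (T := T) zQ) (cross_com (T := T) cZQ) ->
  S _ (law_monad (bmon T) z Om) (comp_comonoidal cZ (bcom T)).
Proof.
have [Hl _ _ _] := H; have [H2 H0] := cross_lift_com H.
apply: functor_data_eq => [X|X|X Y|].
- by have [E _] := cross_lift_monad X Hl; exact: E.
- by have [_ E] := cross_lift_monad X Hl; exact: E.
- exact: H2.
- exact: H0.
Qed.
End LawTransport.

Theorem proposition7p5
  (C : MonCat) (Cstrict : strict C) (DC : Autonomous C) (T : HopfMonad DC)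
  (Q : Functor (mod_mon T) (mod_mon T)) (cQ : comonoidal_data Q)
  (HcQ : is_comonoidal cQ)
  (* the centralizer Z of the cross product of Q and T, and its monad structure *)
  (Z : Functor C C) (d : forall X Y : C, hom (X ⊗ Y) (cross Q Y ⊗ Z X))
  (Hd : is_centralizer d)
  (z : monad_data Z) (Hz : is_centralizer_monad d (cross_com cQ) z)
  (* the centralizer of Q lifting Z, and its monad structure *)
  (l : lift (bmon T) Z)
  (dQ : forall M N : mod_mon T, hom (M ⊗ N) (Q N ⊗ (lift_functor l M : mod_mon T)))
  (HdQ : is_centralizer dQ)
  (HdQd : forall M N : mod_mon T,
    und (dQ M N)
    = (und (fmap Q (counit (bim_monad T) N)) ⊠ idm (Z (car M))) ∘ d (car M) (car N))
  (zQ : monad_data (lift_functor l)) (HzQ : is_centralizer_monad dQ cQ zQ)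
  (* the canonical distributive law *)
  (Om : Trans (T ∘F Z) (Z ∘F T)) (HOm : is_distributive_law (bmon T) z Om)
  (Hcan : is_law_lift z Om zQ) :
  (forall q : monad_data Q, is_bimonad q cQ ->
   forall cZ : comonoidal_data Z, is_centralizer_com d (cross_monad q) cZ ->
   forall cZQ : @comonoidal_data (mod_mon T) (mod_mon T) (lift_functor l),
   is_centralizer_com dQ q cZQ ->
   [/\ is_comonoidal_trans (comp_comonoidal (bcom T) cZ) (comp_comonoidal cZ (bcom T)) Om,
       is_bimonad (law_monad (bmon T) z Om) (comp_comonoidal cZ (bcom T))
     & is_law_lift_bimonad z cZ Om zQ cZQ])
  /\
  (forall q : monad_data Q, is_hopf_monad (mod_autonomous T) q cQ ->
   forall cZ : comonoidal_data Z, is_centralizer_com d (cross_monad q) cZ ->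
   is_hopf_monad DC (law_monad (bmon T) z Om) (comp_comonoidal cZ (bcom T))).
Proof.
have bimonad_lift q (Hq : is_bimonad q cQ) cZ (HcZ : is_centralizer_com d (cross_monad q) cZ)
    cZQ (HcZQ : is_centralizer_com dQ q cZQ) : is_law_lift_bimonad z cZ Om zQ cZQ.
  (* Modules over the Hopf monad [T] have left duals, so the result on centralizers applies to [Q]
     itself on the category of modules. *)
  have HB := centralizer_bimonad (ldual (mod_autonomous T)) HdQ HcZQ Hq HzQ.
  have H2 := und_lift_co2 Hd HdQd HcZ HcZQ; have H0 := und_lift_co0 Hd HdQd HcZ HcZQ.
  by split.
split=> q Hq cZ HcZ.
- move=> cZQ HcZQ; have H := bimonad_lift q Hq cZ HcZ cZQ HcZQ.
  split=> //; first exact: (law_comonoidal Hd HdQd HcZ HcZQ Hcan).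
  have [_ HB _ _] := H.
  exact: (law_of_cross H (S := fun G => @is_bimonad C G)) (cross_bimonad HB).
(* Only [cZ] is given here, so a comonoidal structure on the lift is first obtained from its
   universal property. *)
- have [Hb _ _] := Hq; have [cZQ HcZQ] := centralizer_com_exists HdQ q.
  have H := bimonad_lift q Hb cZ HcZ cZQ HcZQ.
  have HH := centralizer_hopf_monad HdQ Hb HzQ HcZQ Hq.
  exact: (law_of_cross H (S := fun G => @is_hopf_monad C DC G)) (cross_hopf_monad HH).
Qed.
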